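(* In the lattice setting described in the context, assume $\sigma(\Lambda)=\Lambda$ and let $\widehat\sigma:\mathfrak V_\Lambda\to\mathfrak V_\Lambda$ be an automorphism extending $\sigma$. Then the category $\mathcal O_{\widehat\sigma}$ of $\widehat\sigma$-twisted $\mathfrak V_\Lambda$-modules is semisimple with finitely many isomorphism classes of simple objects; that is, every module $V\in\mathcal O_{\widehat\sigma}$ is a direct sum of irreducible submodules, and up to isomorphism there are only finitely many irreducible modules in $\mathcal O_{\widehat\sigma}$.
   Context: Ground field $\mathbb C$. Lattice data. $\mathfrak h$ is a complex vector space of finite dimension with a nondegenerate symmetric bilinear form $(\cdot|\cdot)$; $p\ge1$ is an integer; $\mathfrak h=\bigoplus_{\lambda\in\{0,\frac1p,\dots,\frac{p-1}p\}}\mathfrak h^{[\lambda]}$ with $(\mathfrak h^{[\lambda]}|\mathfrak h^{[\mu]})=0$ unless $\lambda+\mu\in\mathbb Z$. For $n\in\frac1p\mathbb Z$, $\mathfrak h^{[n]}$ is the component of class $n\bmod\mathbb Z$, $h^{[n]}$ the projection of $h$ to it. $\sigma:\mathfrak h\to\mathfrak h$ acts on $\mathfrak h^{[\lambda]}$ by $e^{2\pi i\lambda}$; $\omega=e^{2\pi i/p}$. $\Lambda\subset\mathfrak h$ is the $\mathbb Z$-span of a $\mathbb C$-basis of $\mathfrak h$ such that $m_s=m_s(\alpha,\beta)=(\sigma^{-s}\alpha|\beta)\in\mathbb Z$ for all $\alpha,\beta\in\Lambda$, $0\le s\le p-1$. $\varepsilon:\Lambda\times\Lambda\to\mathbb C^\times$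 is a 2-cocycle with $\varepsilon(\alpha,\beta)\varepsilon(\beta,\alpha)^{-1}=(-1)^{(\alpha|\alpha)(\beta|\beta)+p(\alpha^{[0]}|\beta^{[0]})}\omega^{-\sum_{s=1}^{p-1}sm_s}$. Heisenberg algebra. $H$ is the Lie algebra spanned by a central $\mathsf c$ and symbols $a(n)$, $n\in\frac1p\mathbb Z$, $a\in\mathfrak h^{[n]}$, with $[a(m),b(n)]=\delta_{m+n,0}m(a|b)\mathsf c$; for general $a\in\mathfrak h$, $a(n)=a^{[n]}(n)$. $H_+=\operatorname{span}\{a(n):n>0\}$. Lattice vertex superalgebra. $\mathfrak V_\Lambda=\bigoplus_{\alpha\in\Lambda}\mathfrak V_\alpha$ is the vertex superalgebra ($\mathfrak V_\alpha$ of parity $(\alpha|\alpha)\bmod2$) containing even elements $\tilde h$ ($h\in\mathfrak h$, linear in $h$) and elements $X_\alpha\in\mathfrak V_\alpha$, with $X_0=\varepsilon(0,0)\mathbf 1$, $\tilde a_{(n)}\tilde b=\delta_{n,1}(a|b)\mathbf 1$ and $\tilde h_{(n)}X_\alpha=\delta_{n,0}(h|\alpha)X_\alpha$ for $n\ge0$, $DX_\alpha=\tilde\alpha_{(-1)}X_\alpha$ (where $Da=a_{(-2)}\mathbf 1$); $\mathfrak V_\alpha$ has as a basis the monomials in the commuting operators $\tilde h_{i\,(-n)}$ ($n\ge1$, $h_i$ a basis of $\mathfrak h$) applied to $X_\alpha$; and $X_\alpha{}_{(-(\alpha|\beta)-n-1)}X_\beta=\varkappa(\alpha,\beta)\frac1{n!}(D-\tilde\beta_{(-1)})^nX_{\alpha+\beta}$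 for $n\ge0$, $X_\alpha{}_{(n)}X_\beta=0$ for $n\ge-(\alpha|\beta)$, with $\varkappa(\alpha,\beta)=\varepsilon(\alpha,\beta)p^{-(\alpha|\beta)}\prod_{s=1}^{p-1}(1-\omega^s)^{m_s}$. Automorphism. ''Extending $\sigma$'' means $\widehat\sigma\tilde h=\widetilde{\sigma h}$ for $h\in\mathfrak h$; then $\widehat\sigma X_\alpha=\phi(\alpha)X_{\sigma\alpha}$ for some $\phi:\Lambda\to\mathbb C^\times$, and $\mathfrak V_\Lambda$ is the direct sum of the eigenspaces of $\widehat\sigma$ (which may have infinite order). Generalized and twisted modules. $\mathcal F\{V\}$ is the linear span of series $\sum_{n\in\lambda+\mathbb Z}\alpha(n)z^{-n-1}$ ($\lambda\in\mathbb C$, $\alpha(n)\in\mathfrak{gl}(V)$) such that for each $v\in V$, $\alpha(\lambda+j)v=0$ for integers $j\gg0$; those with exponents in the class of $\lambda$ form $\mathcal F\{V\}^{[\lambda]}=z^{-\lambda}\mathcal F(V)$, $\mathcal F(V)=\mathcal F\{V\}^{[0]}$; $\mathbf 1$ is the constant series $\mathrm{id}$. Elements $\alpha,\beta$ with given parities are local if $(z-w)^N(\alpha(w)\beta(z)-(-1)^{p(\alpha)p(\beta)}\beta(z)\alpha(w))=0$ for some $N\ge0$. For local $\alpha_0,\beta_0\in\mathcal F(V)$, $n\in\mathbb Z$: $(\alpha_0{}_{(n)}\beta_0)(m)=\sum_{s\ge0}(-1)^s\binom ns\alpha_0(n-s)\beta_0(m+s)-(-1)^{p(\alpha_0)p(\beta_0)}\sum_{s\le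 n}(-1)^s\binom n{n-s}\beta_0(m+s)\alpha_0(n-s)$; for $\alpha=z^\lambda\alpha_0,\beta=z^\mu\beta_0$: $\alpha_{(n)}\beta=\sum_{j\ge0}\binom\lambda j(\alpha_0{}_{(n+j)}\beta_0)z^{\lambda+\mu-j}$, extended bilinearly. A generalized module over a vertex superalgebra $\mathfrak A$ is a vector space $V$ with a linear map $\pi:\mathfrak A\to\mathcal F\{V\}$ such that $\pi(a),\pi(b)$ are local (with the parities of $a,b$), $\pi(a_{(n)}b)=\pi(a)_{(n)}\pi(b)$ for all $n\in\mathbb Z$, and $\pi(\mathbf 1)=\mathbf 1$. It is $\widehat\sigma$-twisted if for every eigenvalue $\mu$ of $\widehat\sigma$, $\pi$ maps the $\mu$-eigenspace into $\mathcal F\{V\}^{[\lambda]}$, $\lambda=\frac1{2\pi i}\ln\mu$. On a $\widehat\sigma$-twisted module the coefficients of $\pi(\tilde h)$ define an $H$-module structure with $\mathsf c=\mathrm{id}$. Submodules are subspaces stable under all coefficients of all $\pi(a)$; morphisms are linear maps commuting with all these coefficients. Category $\mathcal O_{\widehat\sigma}$: $\widehat\sigma$-twisted $\mathfrak V_\Lambda$-modules $V$ that are $\mathfrak h^{[0]}$-diagonalizable ($V=\bigoplus_{\xi\in(\mathfrak h^{[0]})^*}V_\xi$ with $h(0)=\xi(h)$ on $V_\xi$ for $h\in\mathfrak h^{[0]}$) and such that, as an $H$-module, $V=U(H)\Omega$, where $\Omega=\{v\in V:H_+v=0\}$ (equivalently, $V\cong M(1)\otimes\Omega$ with $M(1)$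 the canonical Fock module $U(H_-)\mathbf 1$ of $H$, $H_-=\operatorname{span}\{a(n):n<0\}$). *)

(* Defs.v *)
(* The ground field C is R[i], with R : realType. *)
From HB Require Import structures.
From mathcomp Require Import all_boot all_order all_algebra.
From mathcomp Require Import finmap multiset.
From mathcomp Require Import all_classical all_reals all_analysis.
From mathcomp Require Import complex.

Set Implicit Arguments.
Unset Strict Implicit.
Unset Printing Implicit Defensive.

Import Order.TTheory GRing.Theory Num.Theory.
Local Open Scope classical_set_scope.
Local Open Scope ring_scope.

Definition cexp (R : realType) (z : R[i]) : R[i] :=
  (expR (complex.Re z))%:C%C *
  (cos (complex.Im z) +i* sin (complex.Im z))%C.

(* exp(2 pi i z) *)
Definition exp2pii (R : realType) (z : R[i]) : R[i] :=
  cexp (2 * (pi : R)%:C%C * 'i%C * z).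

Definition isint (R : realType) (z : R[i]) : Prop := exists k : int, z = k%:~R.

(* Only used on complex numbers that are integers: toint k%:~R = k. *)
Definition toint (R : realType) (z : R[i]) : int := Num.floor (complex.Re z).

(* binomial coefficient x (x - 1) ... (x - j + 1) / j! *)
Definition gbin (R : realType) (x : R[i]) (j : nat) : R[i] :=
  (\prod_(i < j) (x - i%:R)) / (j`!)%:R.

Definition psign (R : realType) (a b : bool) : R[i] := (-1) ^+ (a && b).

(* In this file \sum_(x \in D) F x is the sum of a finitely supported family;
   every such sum below has finite support in the situations considered. *)

Definition subspace (R : realType) (V : lmodType R[i]) (W : set V) : Prop :=
  W 0 /\ forall (c : R[i]) (u v : V), W u -> W v -> W (c *: u + v).

(* V is the internal direct sum of the subspaces W i, i in D *)
Definition direct_sum (R : realType) (V : lmodType R[i]) (I : choiceType)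
    (D : set I) (W : I -> set V) : Prop :=
  [/\ forall i, D i -> subspace (W i),
      forall v : V, exists w : I -> V,
        [/\ forall i, D i -> W i (w i),
            finite_set [set i | D i /\ w i <> 0] &
            v = \sum_(i \in D) w i] &
      forall w : I -> V,
        (forall i, D i -> W i (w i)) ->
        finite_set [set i | D i /\ w i <> 0] ->
        \sum_(i \in D) w i = 0 -> forall i, D i -> w i = 0].

(* the family b is a (Hamel) basis of the subspace W *)
Definition hamel_basis (R : realType) (V : lmodType R[i]) (I : choiceType)
    (W : set V) (b : I -> V) : Prop :=
  (forall v : V, W v <->
     exists c : I -> R[i], finite_set [set i | c i <> 0] /\
       v = \sum_(i \in [set: I]) c i *: b i) /\
  (forall c : I -> R[i], finite_set [set i | c i <> 0] ->
     \sum_(i \in [set: I]) c i *: b i = 0 -> forall i, c i = 0).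

Record lattice_data (R : realType) := LatticeData {
  ld_h : vectType R[i];
  ld_form : {bilinear ld_h -> ld_h -> R[i]^o};
  ld_form_sym : forall u v, ld_form u v = ld_form v u;
  ld_form_nondeg : forall u, (forall v, ld_form u v = 0) -> u = 0;
  ld_p : nat;
  ld_p_gt0 : (0 < ld_p)%N;
  (* ld_part k is the component of class k / p, for 0 <= k < p *)
  ld_part : nat -> {vspace ld_h};
  ld_part_direct : directv (\sum_(0 <= k < ld_p) ld_part k)%VS;
  ld_part_full : (\sum_(0 <= k < ld_p) ld_part k)%VS = fullv;
  ld_part_orth : forall k l u v, (k < ld_p)%N -> (l < ld_p)%N ->
    ~~ (ld_p %| k + l)%N -> u \in ld_part k -> v \in ld_part l ->
    ld_form u v = 0;
  (* the lattice is the Z-span of this basis *)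
  ld_basis : (\dim (fullv : {vspace ld_h})).-tuple ld_h;
  ld_basisP : basis_of fullv ld_basis;
  ld_eps : ld_h -> ld_h -> R[i]   (* only used on the lattice *)
}.

Section LatticeNotions.
Variables (R : realType) (L : lattice_data R).
Local Notation h := (ld_h L).
Local Notation p := (ld_p L).
Local Notation form := (@ld_form R L).
Local Notation eps := (@ld_eps R L).

Definition Lam : set h :=
  [set v | exists a : 'I_(\dim (fullv : {vspace h})) -> int,
     v = \sum_(i < \dim (fullv : {vspace h})) (ld_basis L)`_i *~ a i].

Definition lproj (k : nat) : 'End(h) :=
  sumv_pi (\sum_(0 <= k < p) ld_part L k)%VS k.

(* the projection a |-> a^[n/p], for an integer n *)
Definition cproj (n : int) : 'End(h) := lproj `|(n %% p)%Z|%N.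

Definition omega : R[i] := exp2pii (p%:R^-1).

Definition sigma : 'End(h) :=
  \sum_(0 <= k < p) exp2pii (k%:R / p%:R) *: lproj k.

(* (sigma^{-s} a | b) *)
Definition mform (s : nat) (a b : h) : R[i] :=
  form (iter s (sigma^-1)%VF a) b.

Definition mint (s : nat) (a b : h) : int := toint (mform s a b).

Definition ipair (a b : h) : int := toint (form a b).

Definition lattice_integral : Prop :=
  forall a b s, Lam a -> Lam b -> (s < p)%N -> isint (mform s a b).

Definition eps_cocycle : Prop :=
  (forall a b, Lam a -> Lam b -> eps a b <> 0) /\
  (forall a b c, Lam a -> Lam b -> Lam c ->
     eps a b * eps (a + b) c = eps b c * eps a (b + c)).

Definition eps_commutator : Prop :=
  forall a b, Lam a -> Lam b ->
    eps a b * (eps b a)^-1 =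
    (-1) ^ (ipair a a * ipair b b
            + toint (p%:R * form (cproj 0 a) (cproj 0 b)))
    * omega ^ (- \sum_(1 <= s < p) (s%:Z * mint s a b)).

Definition lattice_ok : Prop :=
  [/\ lattice_integral, eps_cocycle & eps_commutator].

Definition varkappa (a b : h) : R[i] :=
  eps a b * p%:R ^ (- ipair a b)
  * \prod_(1 <= s < p) (1 - omega ^+ s) ^ (mint s a b).

End LatticeNotions.
Arguments Lam {R} L _.
Arguments lproj {R} L k.
Arguments cproj {R} L n.
Arguments sigma {R} L.
Arguments omega {R} L.

Record vertex_superalgebra (R : realType) := VertexSuperalgebra {
  vs_sort :> lmodType R[i];
  (* vs_par false, vs_par true: the even and the odd subspace *)
  vs_par : bool -> set vs_sort;
  (* vs_prod n a b = a_(n) b *)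
  vs_prod : int -> vs_sort -> vs_sort -> vs_sort;
  vs_one : vs_sort;
  vs_par_sum : direct_sum [set: bool] vs_par;
  vs_prod_linl : forall n (c : R[i]) a a' b,
    vs_prod n (c *: a + a') b = c *: vs_prod n a b + vs_prod n a' b;
  vs_prod_linr : forall n (c : R[i]) a b b',
    vs_prod n a (c *: b + b') = c *: vs_prod n a b + vs_prod n a b';
  vs_prod_par : forall n x y a b, vs_par x a -> vs_par y b ->
    vs_par (x (+) y) (vs_prod n a b);
  vs_trunc : forall a b, exists N : int,
    forall n : int, N <= n -> vs_prod n a b = 0;
  vs_one_even : vs_par false vs_one;
  vs_one_l : forall n a, vs_prod n vs_one a = if n == -1 then a else 0;
  vs_one_r : forall (n : int) a, 0 <= n -> vs_prod n a vs_one = 0;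
  vs_creation : forall a, vs_prod (-1) a vs_one = a;
  (* the Borcherds identity *)
  vs_borcherds : forall x y a b c (k m n : int), vs_par x a -> vs_par y b ->
    \sum_(j \in [set: nat])
       gbin m%:~R j *: vs_prod (m + k - j%:Z) (vs_prod (n + j%:Z) a b) c =
    \sum_(j \in [set: nat])
       ((-1) ^+ j * gbin n%:~R j) *:
         vs_prod (m + n - j%:Z) a (vs_prod (k + j%:Z) b c)
    - ((-1) ^ n * psign R x y) *: \sum_(j \in [set: nat])
       ((-1) ^+ j * gbin n%:~R j) *:
         vs_prod (n + k - j%:Z) b (vs_prod (m + j%:Z) a c)
}.

Definition vs_D (R : realType) (A : vertex_superalgebra R) (a : A) : A :=
  vs_prod (- 2) a (vs_one A).

Record vs_automorphism (R : realType) (A : vertex_superalgebra R)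
    (f : A -> A) : Prop := VsAutomorphism {
  vsaut_linear : forall (c : R[i]) (a b : A), f (c *: a + b) = c *: f a + f b;
  vsaut_bij : bijective f;
  vsaut_par : forall x a, vs_par x a -> vs_par x (f a);
  vsaut_one : f (vs_one A) = vs_one A;
  vsaut_prod : forall n (a b : A), f (vs_prod n a b) = vs_prod n (f a) (f b)
}.

Section LatticeVSA.
Variables (R : realType) (L : lattice_data R) (A : vertex_superalgebra R).
Local Notation h := (ld_h L).
Variables (tilde : h -> A) (X : h -> A).

(* A multiset B of pairs (i, n) encodes the monomial given by the product of
   the operators (h_i)~_(-n-1) over B, with h_i the i-th vector of vbasis. *)
Definition heis_monomial (a : h)
    (B : {mset ('I_(\dim (fullv : {vspace h})) * nat)%type}%mset) : A :=
  foldr (fun (q : 'I_(\dim (fullv : {vspace h})) * nat) v =>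
           vs_prod (- (q.2.+1)%:Z)
             (tilde (vbasis (fullv : {vspace h}))`_(q.1)) v)
        (X a) (enum_mset B).

Record is_lattice_vsa : Prop := IsLatticeVsa {
  lv_comp : exists comp : h -> set A,
    [/\ direct_sum (Lam L) comp,
        forall a v, Lam L a -> comp a v -> vs_par (odd `|ipair a a|%N) v,
        forall a, Lam L a -> comp a (X a) &
        forall a, Lam L a -> hamel_basis (comp a) (heis_monomial a)];
  lv_tilde_linear : forall (c : R[i]) (u v : h),
    tilde (c *: u + v) = c *: tilde u + tilde v;
  lv_tilde_even : forall u, vs_par false (tilde u);
  lv_X0 : X 0 = ld_eps (0 : h) 0 *: vs_one A;
  lv_tilde_tilde : forall (n : nat) (u v : h),
    vs_prod n%:Z (tilde u) (tilde v) =
    if n == 1%N then (@ld_form R L u v : R[i]) *: vs_one A else 0;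
  lv_tilde_X : forall (n : nat) (u a : h), Lam L a ->
    vs_prod n%:Z (tilde u) (X a) =
    if n == 0%N then (@ld_form R L u a : R[i]) *: X a else 0;
  lv_DX : forall a, Lam L a -> vs_D (X a) = vs_prod (-1) (tilde a) (X a);
  lv_XX : forall (n : nat) a b, Lam L a -> Lam L b ->
    vs_prod (- ipair a b - n%:Z - 1) (X a) (X b) =
    (varkappa a b / (n`!)%:R) *:
      iter n (fun v => vs_D v - vs_prod (-1) (tilde b) v) (X (a + b));
  lv_XX0 : forall (n : int) a b, Lam L a -> Lam L b ->
    - ipair a b <= n -> vs_prod n (X a) (X b) = 0
}.

End LatticeVSA.

Section Fields.
Variables (R : realType) (V : lmodType R[i]).

(* A series sum_n f(n) z^(-n-1) with coefficients in gl(V) and exponents in C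
   is represented by f : C -> V -> V; F{V} consists of those supported on
   finitely many classes modulo Z and truncated on each class. *)
Definition in_FF (f : R[i] -> V -> V) : Prop :=
  [/\ forall n (c : R[i]) (u v : V), f n (c *: u + v) = c *: f n u + f n v,
      exists s : seq R[i], forall n v, f n v <> 0 ->
        exists2 l, l \in s & isint (n - l) &
      forall (l : R[i]) (v : V), exists N : int, forall j : int,
        N <= j -> f (l + j%:~R) v = 0].

(* membership in F{V}^[l], for elements of F{V} *)
Definition of_class (l : R[i]) (f : R[i] -> V -> V) : Prop :=
  forall n v, f n v <> 0 -> isint (n - l).

(* coefficient at w^(-m-1) z^(-n-1) of the locality equation *)
Definition local (s : R[i]) (f g : R[i] -> V -> V) : Prop :=
  exists N : nat, forall (m n : R[i]) (v : V),
    \sum_(i < N.+1) ((-1) ^+ i * ('C(N, i))%:R) *: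
      (f (m + i%:R) (g (n + (N - i)%:R) v)
       - s *: g (n + (N - i)%:R) (f (m + i%:R) v)) = 0.

(* (f_(n) g)(m) for f, g in F(V); the second sum is indexed by j = n - s *)
Definition nprod0 (s : R[i]) (n : int) (f g : int -> V -> V) (m : int) (v : V)
    : V :=
  \sum_(j \in [set: nat])
     ((-1) ^+ j * gbin n%:~R j) *: f (n - j%:Z) (g (m + j%:Z) v)
  - s *: \sum_(j \in [set: nat])
     ((-1) ^ (n - j%:Z) * gbin n%:~R j) *: g (m + n - j%:Z) (f j%:Z v).

(* f0 in F(V) such that z^l f0 is the component of f in z^l F(V) *)
Definition class_part (l : R[i]) (f : R[i] -> V -> V) : int -> V -> V :=
  fun k => f (k%:~R - l).

(* z^l f0 *)
Definition zshift (l : R[i]) (f0 : int -> V -> V) : R[i] -> V -> V :=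
  fun n v => if `[< isint (n + l) >] then f0 (toint (n + l)) v else 0.

(* representatives of C / Z *)
Definition class_rep : set R[i] :=
  [set l | 0 <= complex.Re l /\ complex.Re l < 1].

(* f_(n) g for f, g in F{V}: bilinear extension of the formula for z^l f0 and
   z^m g0.  For local f, g that formula depends only on z^l f0 and z^m g0, so
   the choice of representatives l, m does not matter. *)
Definition nprod (s : R[i]) (n : int) (f g : R[i] -> V -> V)
    : R[i] -> V -> V :=
  fun x v =>
    \sum_(l \in class_rep) \sum_(m \in class_rep) \sum_(j \in [set: nat])
      gbin l j *:
        zshift (l + m - j%:R)
          (nprod0 s (n + j%:Z) (class_part l f) (class_part m g)) x v.

End Fields.

(* gm_act a n is the coefficient of z^(-n-1) in pi(a) *)
Record gen_module (R : realType) (A : vertex_superalgebra R) := GenModule {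
  gm_sort :> lmodType R[i];
  gm_act : A -> R[i] -> gm_sort -> gm_sort;
  gm_field : forall a, in_FF (gm_act a);
  gm_linear : forall (c : R[i]) (a b : A) n v,
    gm_act (c *: a + b) n v = c *: gm_act a n v + gm_act b n v;
  gm_local : forall x y a b, vs_par x a -> vs_par y b ->
    local (psign R x y) (gm_act a) (gm_act b);
  gm_prod : forall x y a b (n : int) k v, vs_par x a -> vs_par y b ->
    gm_act (vs_prod n a b) k v =
    nprod (psign R x y) n (gm_act a) (gm_act b) k v;
  gm_one : forall n v, gm_act (vs_one A) n v = if n == -1 then v else 0
}.

Section Modules.
Variables (R : realType) (A : vertex_superalgebra R).

(* l runs through all values of ln(mu) / (2 pi i) *)
Definition twisted (f : A -> A) (V : gen_module A) : Prop :=
  forall (l : R[i]) (a : A), f a = exp2pii l *: a -> of_class l (@gm_act _ _ V a).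

Definition submodule (V : gen_module A) (W : set V) : Prop :=
  subspace W /\ forall a n v, W v -> W (gm_act a n v).

Definition irreducible_submodule (V : gen_module A) (W : set V) : Prop :=
  [/\ submodule W, (exists v, W v /\ v <> 0) &
      forall U : set V, submodule U -> U `<=` W -> U = [set 0] \/ U = W].

Definition irreducible_module (V : gen_module A) : Prop :=
  irreducible_submodule [set: V].

Definition module_iso (V W : gen_module A) : Prop :=
  exists f : V -> W,
    [/\ forall (c : R[i]) (u v : V), f (c *: u + v) = c *: f u + f v,
        bijective f &
        forall a n v, f (gm_act a n v) = gm_act a n (f v)].

End Modules.

Section CategoryO.
Variables (R : realType) (L : lattice_data R) (A : vertex_superalgebra R).
Local Notation h := (ld_h L).
Variables (tilde : h -> A).

(* a(n/p) = a^[n/p](n/p), the action on V of the Heisenberg algebra *)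
Definition heis (V : gen_module A) (a : h) (n : int) : V -> V :=
  gm_act (tilde (cproj L n a)) (n%:~R / (ld_p L)%:R).

Definition vacuum_space (V : gen_module A) : set V :=
  [set v | forall (a : h) (n : int), 0 < n -> heis a n v = 0].

(* U(H) S for a subspace S; the central element acts by the identity *)
Definition UH_span (V : gen_module A) (S : set V) : set V :=
  [set v | exists s : seq (seq (h * int) * V),
     (forall x, x \in s -> S x.2) /\
     v = \sum_(x <- s) foldr (fun q u => heis q.1 q.2 u) x.2 x.1].

Definition h0_dual := 'Hom(subvs_of (ld_part L 0), R[i]^o).

Definition weight_space (V : gen_module A) (xi : h0_dual) : set V :=
  [set v | forall u : subvs_of (ld_part L 0),
     heis (vsval u) 0 v = (xi u : R[i]) *: v].

Definition in_O (f : A -> A) (V : gen_module A) : Prop :=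
  [/\ twisted f V,
      direct_sum [set: h0_dual] (@weight_space V) &
      UH_span (@vacuum_space V) = [set: V]].

End CategoryO.

(* Main.v *)
(* For V in O let Om mu be the space of vectors of weight mu killed by H_+.  On
   Om mu the identity D X_al = al~_(-1) X_al is a recursion for the coefficients
   of the field X_al: there is a leading coefficient, an operator U_al from Om mu
   to Om (mu + flat al), and all the others are Heisenberg descendants of it.
   Locality and the products X_al_(n) X_be give U_be U_al = c U_(al+be) with
   c <> 0, so that V is governed by a projective action of the lattice on its
   vacuum vectors.  The twisting makes U_(sigma al) proportional to U_al.  Hence,
   for g in the sublattice Lperp orthogonal to h^[0], U_(p g) is a scalar.

   Let I be a maximal subset of Lperp whose operators commute on Om mu.  A joint
   eigenvector of I generates an irreducible submodule, because the translates of
   the vector by Lperp / I have distinct eigenvalues; and the U_g, g in I, are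
   simultaneously diagonalizable, because U_g^p is a scalar.  Complete
   reducibility follows by Zorn's lemma.  Two irreducible modules whose eigenvectors
   have the same weight and the same eigenvalues are isomorphic, the isomorphism
   being the submodule of the product generated by the pair of eigenvectors; the
   product is also used to see that the scalars above do not depend on the module.
   There are finitely many eigenvalues since U_g^p is a scalar depending only on
   mu and Lperp / p Lperp is finite.  For al fixed by sigma, sigmahat X_al is a
   multiple of X_al which determines mu(al) modulo Z, and this leaves finitely many
   weights modulo flat Lam, whose elements are reached by the operators U_al. *)

From Pilot Require Import Defs.
From HB Require Import structures.
From mathcomp Require Import all_boot all_order all_algebra.
From mathcomp Require Import finmap multiset.
From mathcomp Require Import all_classical all_reals all_analysis.
From mathcomp Require Import complex.
From mathcomp Require Import ring lra zify.

Set Implicit Arguments.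
Unset Strict Implicit.
Unset Printing Implicit Defensive.

Import Order.TTheory GRing.Theory Num.Theory.
Local Open Scope classical_set_scope.
Local Open Scope ring_scope.

(* MathComp-Analysis has a different [subspace]. *)
Notation subspace := Pilot.Defs.subspace.

(** * The exponential exp(2 pi i z) and binomial coefficients *)

(** The constants relating the operators U_al are never evaluated. It suffices that they do not
    depend on the vector and are nonzero, the latter because [varkappa] and eps(0,0) are. For g in
    Lperp the sum of sigma^s g over s < p is p g^[0] = 0, so p g telescopes to sigma be - be with be
    in the lattice; U_(sigma be) being proportional to U_be, this makes U_(p g) a scalar. Vacuum
    spaces may have infinite dimension, so eigenvectors come from a discrete Fourier transform,
    available for any operator with a scalar p-th power. The same device handles sigmahat of
    infinite order: its p-th iterate multiplies each X_al by a scalar. Translates of a joint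
    eigenvector by a and b with equal eigenvalues are proportional: U_(b - a) then commutes with the
    operators of I, so b - a lies in I by maximality. For the weights, the sigma-fixed lattice
    vectors p b^[0] determine p mu(b) modulo Z, and the lattice has finite index in its dual. *)

Section ComplexExponential.
Variable R : realType.
Implicit Types z w : R[i].

Lemma exp2piiE (x y : R) :
  exp2pii (x +i* y)%C =
  ((expR (- (pi *+ 2 * y)))%:C%C) * (cos (pi *+ 2 * x) +i* sin (pi *+ 2 * x))%C.
Proof.
rewrite /exp2pii /cexp.
have -> : 2 * (pi : R)%:C%C * 'i%C * (x +i* y)%C
          = ((- (pi *+ 2 * y)) +i* (pi *+ 2 * x))%C :> R[i].
  rewrite -mulrA mulr_natl mulr2n.
  by apply/eqP; rewrite eq_complex /=; apply/andP; split; apply/eqP; rewrite mulr2n; ring.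
by [].
Qed.

Lemma exp2piiD z w : exp2pii (z + w) = exp2pii z * exp2pii w.
Proof.
case: z w => [a b] [c d].
rewrite [X in exp2pii X](_ : _ = ((a + c) +i* (b + d))%C) //.
rewrite !exp2piiE !mulrDr opprD expRD cosD sinD.
by apply/eqP; rewrite eq_complex /=; apply/andP; split; apply/eqP; ring.
Qed.

Lemma exp2pii0 : exp2pii (0 : R[i]) = 1.
Proof.
by rewrite [X in exp2pii X](_ : _ = (0 +i* 0)%C) // exp2piiE !mulr0 oppr0 expR0 cos0 sin0 mul1r.
Qed.

Lemma exp2pii_neq0 z : exp2pii z != 0.
Proof.
apply/eqP => h; have := exp2piiD z (- z).
by rewrite subrr exp2pii0 h mul0r => /eqP; rewrite oner_eq0.
Qed.

Lemma exp2piiN z : exp2pii (- z) = (exp2pii z)^-1.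
Proof.
apply: (mulfI (exp2pii_neq0 z)).
by rewrite -exp2piiD subrr exp2pii0 divff // exp2pii_neq0.
Qed.

Lemma exp2piiX z n : exp2pii (z *+ n) = exp2pii z ^+ n.
Proof.
elim: n => [|n IH]; first by rewrite mulr0n exp2pii0.
by rewrite mulrS exp2piiD IH exprS.
Qed.

Lemma exp2pii1 : exp2pii (1 : R[i]) = 1.
Proof.
rewrite [X in exp2pii X](_ : _ = (1 +i* 0)%C) // exp2piiE !mulr0 oppr0 expR0.
by rewrite mulr1 cos2pi sin2pi mul1r.
Qed.

Lemma exp2pii_int (k : int) : exp2pii (k%:~R : R[i]) = 1.
Proof.
have h n : exp2pii (n%:R : R[i]) = 1 by rewrite exp2piiX exp2pii1 expr1n.
case: k => n; first exact: h.
by rewrite NegzE mulrNz exp2piiN h invr1.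
Qed.

Lemma cos_lt1 (t : R) : 0 < t < pi *+ 2 -> cos t != 1.
Proof.
move=> /andP[t0 t2]; apply/eqP => ct.
have s0 : sin t = 0.
  by have := cos2Dsin2 t; rewrite ct expr1n => /(canRL (addKr _)); rewrite addNr => /eqP; rewrite sqrf_eq0 => /eqP.
case: (ltrgtP t pi) => [tp|tp|tp].
- have : 0 < sin t by apply: sin_gt0_pi; rewrite t0.
  by rewrite s0 ltxx.
- have : 0 < sin (t - pi).
    by apply: sin_gt0_pi; rewrite subr_gt0 tp ltrBlDr -mulr2n.
  have := sinDpi (t - pi); rewrite subrK s0 => /eqP.
  by rewrite eq_sym oppr_eq0 => /eqP ->; rewrite ltxx.
- by move: ct; rewrite tp cospi => /eqP; rewrite eq_sym -subr_eq0 opprK -(natrD _ 1 1) pnatr_eq0.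
Qed.

Lemma cos2pi_eq1 (x : R) : cos (pi *+ 2 * x) = 1 -> exists k : int, x = k%:~R.
Proof.
move=> cx; exists (Num.floor x); apply/eqP; rewrite -subr_eq0; apply/negP => /negP fx.
set f := x - (Num.floor x)%:~R in fx.
have f0 : 0 <= f < 1.
  by rewrite subr_ge0 floor_le_tmp ltrBlDr addrC; have := floorD1_gt x; rewrite intrD.
have cf : cos (pi *+ 2 * f) = 1.
  have := exp2piiD (f%:C)%C ((Num.floor x)%:~R); rewrite exp2pii_int mulr1.
  have -> : (f%:C)%C + (Num.floor x)%:~R = (x +i* 0)%C :> R[i].
    by rewrite -(rmorph_int (real_complex R)) -[LHS](rmorphD (real_complex R)) /f subrK.
  rewrite [X in _ = exp2pii X](_ : _ = (f +i* 0)%C) // !exp2piiE !mulr0 oppr0 expR0 cx !mul1r.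
  by case.
have := @cos_lt1 (pi *+ 2 * f); rewrite cf eqxx.
have p0 := pi_gt0 R.
move=> H; apply/notF/H; case/andP: f0 => f0 f1.
have p2 : 0 < pi *+ 2 :> R by rewrite mulrn_wgt0.
have fp : 0 < f by rewrite lt_def fx.
by rewrite mulr_gt0 //= gtr_pMr.
Qed.

Lemma exp2pii_eq1 z : exp2pii z = 1 -> isint z.
Proof.
case: z => x y; rewrite exp2piiE => h.
have [h1 h2] : expR (- (pi *+ 2 * y)) * cos (pi *+ 2 * x) = 1 /\
               expR (- (pi *+ 2 * y)) * sin (pi *+ 2 * x) = 0.
  by case: h => h1 h2; split; [rewrite -h1|rewrite -h2]; ring.
have e0 := expR_gt0 (- (pi *+ 2 * y)).
have s0 : sin (pi *+ 2 * x) = 0.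
  by apply/eqP; move/eqP: h2; rewrite mulf_eq0 gt_eqF.
have c1 : cos (pi *+ 2 * x) = 1.
  have := cos2Dsin2 (pi *+ 2 * x); rewrite s0 expr0n addr0 => /eqP.
  rewrite sqrf_eq1 => /orP[/eqP //|/eqP c]; move: h1; rewrite c mulrN1 => h1.
  by move: e0; rewrite -(opprK (expR _)) h1 oppr_gt0 ltr10.
have y0 : y = 0.
  move: h1; rewrite c1 mulr1 -expR0 => /expR_inj /eqP.
  rewrite oppr_eq0 mulf_eq0 => /orP[|/eqP //].
  by rewrite mulrn_eq0 /= gt_eqF ?pi_gt0.
have [k ->] := cos2pi_eq1 c1.
by exists k; rewrite y0 -(rmorph_int (real_complex R)).
Qed.

Lemma exp2pii_surj z : z != 0 -> exists l, exp2pii l = z.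
Proof.
move=> z0.
pose r := Num.sqrt (complex.Re z ^+ 2 + complex.Im z ^+ 2).
have r2 : r ^+ 2 = complex.Re z ^+ 2 + complex.Im z ^+ 2.
  by rewrite sqr_sqrtr // addr_ge0 // sqr_ge0.
have r0 : 0 < r.
  rewrite sqrtr_gt0 lt_def addr_ge0 ?sqr_ge0 // andbT paddr_eq0 ?sqr_ge0 // !sqrf_eq0.
  by move: z0; rewrite eq_complex.
pose c := complex.Re z / r; pose s := complex.Im z / r.
have cs : c ^+ 2 + s ^+ 2 = 1.
  by rewrite /c /s !expr_div_n -mulrDl -r2 divff // sqrf_eq0 gt_eqF.
have c1 : c \in `[-1, 1].
  by rewrite in_itv /= -ler_norml -(expr_le1 (n := 2)) // real_normK ?num_real // -cs lerDl sqr_ge0.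
have [t [ct st]] : exists t, cos t = c /\ sin t = s.
  have ca := acosK c1.
  have sa := cos2Dsin2 (acos c); rewrite ca -cs in sa; move/addrI/eqP: sa.
  rewrite eqf_sqr => /orP[/eqP sa|/eqP sa]; first by exists (acos c).
  by exists (- acos c); rewrite cosN sinN sa opprK ca.
have p0 := pi_gt0 R.
have p2 : pi *+ 2 != 0 :> R by rewrite mulrn_eq0 /= gt_eqF.
exists ((t / (pi *+ 2)) +i* (- (ln r / (pi *+ 2))))%C.
rewrite exp2piiE mulrN opprK ![pi *+ 2 * _]mulrC !divfK // lnK ?posrE // ct st.
have rn : r != 0 by rewrite gt_eqF.
have -> : z = (complex.Re z +i* complex.Im z)%C by case: (z).
by apply/eqP; rewrite eq_complex /= !mul0r subr0 addr0 ![r * _]mulrC /c /s !divfK ?eqxx.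
Qed.

Lemma exp2pii_eq z w : exp2pii z = exp2pii w -> isint (z - w).
Proof.
move=> e; apply: exp2pii_eq1; rewrite exp2piiD exp2piiN e divff //.
exact: exp2pii_neq0.
Qed.

Lemma toint_int (k : int) : toint (k%:~R : R[i]) = k.
Proof. by rewrite /toint -(rmorph_int (real_complex R)) /= intrKfloor. Qed.

Lemma isint_int (k : int) : isint (k%:~R : R[i]). Proof. by exists k. Qed.

Lemma isintD z w : isint z -> isint w -> isint (z + w).
Proof. by move=> [k ->] [l ->]; exists (k + l); rewrite intrD. Qed.

Lemma isintN z : isint z -> isint (- z).
Proof. by move=> [k ->]; exists (- k); rewrite mulrNz. Qed.

Lemma tointK z : isint z -> (toint z)%:~R = z.
Proof. by move=> [k ->]; rewrite toint_int. Qed.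

Lemma class_rep_ex z : exists2 l : R[i], class_rep l & isint (z + l).
Proof.
case: z => x y.
exists (((Num.ceil x)%:~R - x) +i* (- y))%C.
  rewrite /class_rep /=; split; first by rewrite subr_ge0 ceil_ge.
  by have := gt_pred_ceil x; rewrite intrD; lra.
exists (Num.ceil x); rewrite -(rmorph_int (real_complex R)).
by apply/eqP; rewrite eq_complex /= subrr addrC subrK !eqxx.
Qed.

Lemma class_rep_uniq z w : class_rep z -> class_rep w -> isint (z - w) -> z = w.
Proof.
case: z w => [a b] [c d] /= [/= a0 a1] [/= c0 c1] [k].
rewrite -(rmorph_int (real_complex R)) => -[h /eqP]; rewrite subr_eq0 => /eqP ->.
have : (k < 1) && (k > -1).
  rewrite -(ltr_int R) -(ltr_int R) -h mulrNz; lra.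
move=> /andP[k1 k2]; have k0 : k = 0 by lia.
by move: h; rewrite k0 => /eqP; rewrite subr_eq0 => /eqP ->.
Qed.

Lemma gbin0 z : gbin z 0 = 1.
Proof. by rewrite /gbin big_ord0 fact0 divr1. Qed.

Lemma gbin1 z : gbin z 1 = z.
Proof. by rewrite /gbin big_ord1 subr0 divr1. Qed.

Lemma gbin_nat (n i : nat) : gbin (n%:R : R[i]) i = 'C(n, i)%:R.
Proof.
have f0 : (i`!)%:R != 0 :> R[i] by rewrite pnatr_eq0 -lt0n fact_gt0.
rewrite /gbin; apply: (mulIf f0); rewrite divfK // -natrM bin_ffact.
elim: i {f0} => [|i IH]; first by rewrite big_ord0.
rewrite big_ord_recr /= IH ffactnSr natrM; case: (leqP i n) => h.
  by rewrite natrB.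
by rewrite ffact_small // !mul0r.
Qed.

Lemma gbinN1 i : gbin (- 1 : R[i]) i = (- 1) ^+ i.
Proof.
have f0 : (i`!)%:R != 0 :> R[i] by rewrite pnatr_eq0 -lt0n fact_gt0.
rewrite /gbin; apply: (mulIf f0); rewrite divfK //.
elim: i {f0} => [|i IH]; first by rewrite big_ord0 mul1r.
rewrite big_ord_recr /= IH factS natrM exprS -natr1; ring.
Qed.

Lemma gbinN2 i : gbin (- 2 : R[i]) i = (- 1) ^+ i * (i.+1)%:R.
Proof.
have f0 : (i`!)%:R != 0 :> R[i] by rewrite pnatr_eq0 -lt0n fact_gt0.
rewrite /gbin; apply: (mulIf f0); rewrite divfK //.
elim: i {f0} => [|i IH]; first by rewrite big_ord0 !mul1r.
rewrite big_ord_recr /= IH factS natrM exprS -[i.+2%:R]natr1 -natr1; ring.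
Qed.

End ComplexExponential.

(** * Linear maps and sums with finite support *)

Definition lin (K : nzRingType) (V W : lmodType K) (f : V -> W) : Prop :=
  forall (c : K) u v, f (c *: u + v) = c *: f u + f v.

Section Lin.
Variables (K : nzRingType) (V W : lmodType K) (f : V -> W).
Hypothesis fL : lin f.

Lemma lin0 : f 0 = 0.
Proof. by have := fL (-1) 0 0; rewrite scaler0 add0r scaleN1r addNr. Qed.

Lemma linD u v : f (u + v) = f u + f v.
Proof. by have := fL 1 u v; rewrite !scale1r. Qed.

Lemma linZ c u : f (c *: u) = c *: f u.
Proof. by have := fL c u 0; rewrite lin0 !addr0. Qed.

Lemma lin_sum (I : Type) (r : seq I) (P : pred I) (F : I -> V) :
  f (\sum_(i <- r | P i) F i) = \sum_(i <- r | P i) f (F i).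
Proof. exact: (big_morph f linD lin0). Qed.

End Lin.

Lemma lin_iter (K : nzRingType) (V : lmodType K) (f : V -> V) n :
  lin f -> lin (iter n f).
Proof. by move=> fL; elim: n => [//|n IH] c u v /=; rewrite IH fL. Qed.

Section FiniteSupportSums.
Variables (K : fieldType) (V : lmodType K).

Lemma fsum_single (I : choiceType) (D : set I) (F : I -> V) i0 :
  D i0 -> (forall i, D i -> i <> i0 -> F i = 0) -> \sum_(i \in D) F i = F i0.
Proof.
move=> Di0 F0; rewrite (fsbigE [:: i0]) //=.
- by rewrite big_mkcond big_seq1 mem_set.
- by move=> i /=; rewrite inE => /eqP ->.
- by move=> i Di; rewrite inE => /eqP /(F0 _ Di).
Qed.

Lemma fsum_nat (F : nat -> V) n :
  (forall i, (n <= i)%N -> F i = 0) -> \sum_(i \in [set: nat]) F i = \sum_(i < n) F i.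
Proof.
move=> F0; rewrite (fsbigE (iota 0 n)) ?iota_uniq //.
  rewrite -(big_mkord xpredT F) /index_iota subn0; apply: eq_bigl => i.
  by rewrite in_setT.
by move=> i _; rewrite mem_iota add0n /= -leqNgt => /F0.
Qed.

(** For nonzero [u] both families have the same support, so either both sums are finite or both take
    the default value 0 of an infinite support. This allows the constants of the product formula to
    be written as formal sums of scalars. *)
Lemma fsum_scaler (I : choiceType) (D : set I) (c : I -> K) (u : V) :
  \sum_(i \in D) (c i *: u) = (\sum_(i \in D) c i) *: u.
Proof.
have [->|u0] := eqVneq u 0.
  by rewrite scaler0 fsbig1 // => i _; rewrite scaler0.
have E : D `&` (fun i => c i *: u) @^-1` [set~ 0] = D `&` c @^-1` [set~ 0].
  apply/seteqP; split => i /= [Di h]; split => // h'; apply: h.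
    by rewrite h' scale0r.
  by move/eqP: h'; rewrite scaler_eq0 (negbTE u0) orbF => /eqP.
have -> : finite_support 0 D (fun i => c i *: u) = finite_support 0 D c.
  by rewrite /finite_support !unlock E.
by rewrite scaler_suml.
Qed.

Lemma eq_fsum_scaler (I : choiceType) (D : set I) (F : I -> V) (c : I -> K) (u : V) :
  (forall i, D i -> F i = c i *: u) ->
  \sum_(i \in D) F i = (\sum_(i \in D) c i) *: u.
Proof.
move=> h; rewrite -fsum_scaler; apply: eq_fsbigr => i; rewrite inE; exact: h.
Qed.

Lemma fsum_ind (I : choiceType) (D : set I) (F : I -> V) (P : V -> Prop) :
  P 0 -> (forall u v, P u -> P v -> P (u + v)) -> (forall i, D i -> P (F i)) ->
  P (\sum_(i \in D) F i).
Proof.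
move=> P0 PD PF; case: finite_supportP => [_|X XD _ _]; first by rewrite big_nil.
by rewrite big_seq; apply: (big_ind P) => // i iX; apply/PF/XD.
Qed.

Lemma fsum_seq (I : choiceType) (D : set I) (F : I -> V) (r : seq I) :
  uniq r -> (forall i, i \in r -> D i) -> (forall i, D i -> i \notin r -> F i = 0) ->
  \sum_(i \in D) F i = \sum_(i <- r) F i.
Proof.
move=> ur rD F0; rewrite (fsbigE r) //.
rewrite [LHS]big_seq_cond [RHS]big_seq; apply: eq_bigl => i.
by case: (boolP (i \in r)) => //= /rD /mem_set ->.
Qed.

Lemma fsum_supp_seq (I : choiceType) (D : set I) (F : I -> V) :
  finite_set [set i | D i /\ F i <> 0] ->
  exists r : seq I, [/\ uniq r, (forall i, (i \in r) <-> D i /\ F i <> 0) &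
    \sum_(i \in D) F i = \sum_(i <- r) F i].
Proof.
move=> /finite_fsetP[X XE].
have H i : (i \in X) <-> D i /\ F i <> 0.
  by have := congr1 (fun A : set I => A i) XE => /= ->.
exists X; split; [exact: fset_uniq|exact: H|].
apply: fsum_seq => [|i /H [] //|i Di].
  exact: fset_uniq.
by move=> /negP nX; apply: contrapT => Fi; apply: nX; apply/H.
Qed.

End FiniteSupportSums.

(** * Finite differences of sequences indexed by the integers *)

Section Differences.
Variables (K : fieldType) (V : lmodType K).
Implicit Type c : int -> V.

Definition dif c : int -> V := fun q => c (q + 1) - c q.

Lemma iter_difE n c q :
  iter n dif c q = \sum_(i < n.+1) ((-1) ^+ (n + i) * ('C(n, i))%:R) *: c (q + i%:Z).
Proof.
elim: n q => [|n IH] q.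
  by rewrite big_ord1 /= bin0 mulr1 scale1r addr0.
have E i : (-1) ^+ (n.+1 + i.+1) * ('C(n.+1, i.+1))%:R =
    (-1) ^+ (n + i) * ('C(n, i))%:R - (-1) ^+ (n + i.+1) * ('C(n, i.+1))%:R :> K.
  by rewrite binS natrD addSn addnS !exprS; ring.
rewrite iterS {1}/dif !IH [RHS]big_ord_recl /= bin0 mulr1 addr0 addn0 addrC.
under [X in _ = _ + X]eq_bigr => i _.
  rewrite /bump /= add1n E scalerBl -[i.+1%:Z]/(1%:Z + i%:Z) addrA; over.
rewrite sumrB addrCA addrC; congr (_ + _).
rewrite big_ord_recl /= bin0 mulr1 addn0 addr0 opprD exprS mulN1r scaleNr.
congr (_ - _); rewrite [RHS]big_ord_recr /= bin_small // mulr0 scale0r addr0.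
by apply: eq_bigr => i _; rewrite /bump /= add1n -addrA.
Qed.

Lemma dif0_const c : (forall q, dif c q = 0) -> forall q, c q = c 0.
Proof.
move=> h; have s q : c (q + 1) = c q by apply/eqP; rewrite -subr_eq0; apply/eqP/h.
elim/int_ind => [//|n IH|n IH]; first by rewrite -[n.+1]addn1 PoszD s.
by rewrite -(s (- _)) -IH; congr c; lia.
Qed.

(** Newton interpolation: if all differences of one order vanish, those of the previous order are
    constant, hence equal to their value at 0; descending to order 2 leaves an affine sequence. The
    first hypothesis will come from locality, the second from the vanishing of the products of order
    at least 2. *)
Lemma dif_affine n c :
  (forall q, iter n dif c q = 0) ->
  (forall j, (2 <= j)%N -> iter j dif c 0 = 0) ->
  forall q, c q = c 0 + q%:~R *: dif c 0.
Proof.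
move=> hn h0.
have h2 : forall q, iter 2 dif c q = 0.
  elim: n hn => [|n IH] hn.
    have c0 : c = (fun=> 0) by apply/funext => q; exact: hn.
    by move=> q; rewrite /= /dif c0 !subrr.
  case: (leqP 2 n) => n2; last first.
    case: n n2 hn {IH} => [|[|//]] _ hn q.
      by rewrite /= /dif !(dif0_const hn) !subrr.
    exact: hn.
  by apply: IH => q; rewrite (dif0_const (c := iter n dif c)) // h0.
have h1 := dif0_const h2.
have s q : c (q + 1) = c q + dif c 0 by rewrite -(h1 q) /dif addrCA subrr addr0.
elim/int_ind => [|m IH|m IH]; first by rewrite scale0r addr0.
  have -> : m.+1%:Z = m%:Z + 1 by lia.
  by rewrite s IH (intrD K m 1) scalerDl scale1r -[LHS]addrA.
apply: (addIr (dif c 0)); rewrite -s -addrA -{2}[dif c 0]scale1r -scalerDl.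
have -> : - m.+1%:Z + 1 = - m%:Z by lia.
by rewrite IH; congr (_ + _ *: _); rewrite -(intrD _ _ 1); congr (_%:~R); lia.
Qed.

End Differences.
Arguments dif {K V} c _.

(** * Roots of unity and operators with a scalar power *)

Section RootsOfUnity.
Variables (R : realType) (V : lmodType R[i]).

Lemma exp2piiX_frac (p : nat) (x : R[i]) :
  (0 < p)%N -> exp2pii (x / p%:R) ^+ p = exp2pii x.
Proof.
by move=> p0; rewrite -exp2piiX -[_ *+ p]mulr_natr divfK // pnatr_eq0 -lt0n.
Qed.

Lemma exp2pii_frac_neq1 (p s : nat) :
  (0 < s < p)%N -> exp2pii (s%:R / p%:R : R[i]) != 1.
Proof.
move=> /andP[s0 sp]; apply/eqP => /exp2pii_eq1[k e].
have p0 : (p%:R : R[i]) != 0 by rewrite pnatr_eq0 -lt0n (leq_trans _ sp).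
have : (s%:Z)%:~R = (k * p%:Z)%:~R :> R[i].
  by rewrite intrM -[RHS]/(k%:~R * p%:R) -e divfK.
move/intr_inj => h; have : (p %| s)%N by apply/dvdnP; exists `|k|%N; lia.
by move/dvdn_leq => /(_ s0); rewrite leqNgt sp.
Qed.

Lemma sum_exp2pii_frac (p i : nat) : (0 < i < p)%N ->
  \sum_(j < p) exp2pii (- ((i%:R : R[i]) * j%:R / p%:R)) = 0.
Proof.
move=> ip; have := exp2pii_frac_neq1 ip.
set x := exp2pii _ => x1.
have x1' : x^-1 - 1 != 0 by rewrite subr_eq0 invr_eq1.
have p0 : (p%:R : R[i]) != 0.
  by case/andP: ip => i0 ip; rewrite pnatr_eq0 -lt0n (leq_trans _ ip).
have xp : x ^+ p = 1.
  rewrite /x exp2piiX_frac ?(exp2pii_int R i) //.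
  by case/andP: ip => i0; apply: leq_trans.
have E : \sum_(j < p) exp2pii (- ((i%:R : R[i]) * j%:R / p%:R)) = \sum_(j < p) x^-1 ^+ j.
  by apply: eq_bigr => j _; rewrite /x -exp2piiN -exp2piiX -[_ *+ j]mulr_natr; congr exp2pii; ring.
by apply: (mulfI x1'); rewrite E -subrX1 exprVn xp invr1 subrr mulr0.
Qed.

(* The [w j] are the discrete Fourier transform of the iterates [iter i T v]. *)
Lemma eigen_split (p : nat) (T : V -> V) (l : R[i]) (v : V) :
  (0 < p)%N -> lin T -> iter p T v = exp2pii l *: v ->
  exists w : nat -> V,
    [/\ v = \sum_(j < p) w j,
        forall j, T (w j) = exp2pii ((l + j%:R) / p%:R) *: w j &
        exists a : nat -> nat -> R[i], forall j, w j = \sum_(i < p) a j i *: iter i T v].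
Proof.
move=> p_gt0 TL Tp.
have p0 : (p%:R : R[i]) != 0 by rewrite pnatr_eq0 -lt0n.
pose z j : R[i] := exp2pii ((l + j%:R) / p%:R).
have z0 j : z j != 0 by exact: exp2pii_neq0.
have zp j : z j ^+ p = exp2pii l.
  rewrite /z exp2piiX_frac // exp2piiD.
  by rewrite -[j%:R]/((j%:Z)%:~R) exp2pii_int mulr1.
pose w j := \sum_(i < p) (p%:R^-1 * z j ^- i) *: iter i T v.
exists w; split; last by exists (fun j i => p%:R^-1 * z j ^- i).
- rewrite /w exchange_big /=.
  under eq_bigr => i _ do rewrite -scaler_suml -mulr_sumr.
  rewrite -(big_mkord xpredT (fun i => (p%:R^-1 * \sum_(j < p) z j ^- i) *: iter i T v)).
  have S i : (0 < i < p)%N -> \sum_(j < p) z j ^- i = 0.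
    move=> ip; transitivity (exp2pii (- (l * i%:R / p%:R)) *
       \sum_(j < p) exp2pii (- ((i%:R : R[i]) * j%:R / p%:R))).
      rewrite mulr_sumr; apply: eq_bigr => j _.
      by rewrite /z -exp2piiX -exp2piiN -exp2piiD -[_ *+ i]mulr_natr; congr exp2pii; ring.
    by rewrite sum_exp2pii_frac // mulr0.
  have S0 : \sum_(j < p) z j ^- 0 = p%:R.
    rewrite (eq_bigr (fun=> 1)); last by move=> j _; rewrite expr0 invr1.
    by rewrite sumr_const card_ord.
  rewrite big_ltn // S0 mulVf // scale1r big_nat big1 ?addr0 // => i ip.
  by rewrite S // mulr0 scale0r.
- move=> j; pose g i := (p%:R^-1 * z j ^- i) *: iter i T v.
  have gp : g p = g 0 by rewrite /g zp Tp scalerA expr0 invr1 mulr1 divfK ?exp2pii_neq0.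
  have shift : \sum_(i < p) g i.+1 = \sum_(i < p) g i.
    apply: (addrI (g 0)).
    have : \sum_(i < p.+1) g i = g 0 + \sum_(i < p) g i by rewrite big_ord_recr /= gp addrC.
    by rewrite big_ord_recl.
  rewrite /w (lin_sum TL) scaler_sumr.
  transitivity (\sum_(i < p) z j *: g i.+1); last first.
    by rewrite -[LHS]scaler_sumr shift scaler_sumr.
  apply: eq_bigr => i _; rewrite (linZ TL) /g scalerA exprS invfM /=.
  by congr (_ *: _); field; rewrite p0 z0 expf_neq0.
Qed.

End RootsOfUnity.

(** * Products of fields *)

Section Fields.
Variables (R : realType) (V : lmodType R[i]).
Implicit Types (f g : R[i] -> V -> V) (l s x y T : R[i]) (v : V).

(* [NP s l n f g y] is the coefficient at [y + Z] of [f0_(n) g0], with [z^l f0] the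
   class [-l] part of [f]; unlike in [nprod0], modes keep their complex indices. *)
Definition NP s l (n : int) f g y v : V :=
  \sum_(i \in [set: nat])
     ((-1) ^+ i * gbin n%:~R i) *: f (n%:~R - i%:R - l) (g (y + i%:R) v)
  - s *: \sum_(i \in [set: nat])
     ((-1) ^ (n - i%:Z) * gbin n%:~R i) *: g (y + n%:~R - i%:R) (f (i%:R - l) v).

(** With the total index [T] fixed, multiplication by z - w becomes, up to sign, a difference in
    [q]. Locality of order N is then the vanishing of the N-th difference, and the products of the
    fields are read off from the lower ones. *)
Definition cmt s l f g T v : int -> V := fun q =>
  f (q%:~R - l) (g (T + l - q%:~R) v) - s *: g (T + l - q%:~R) (f (q%:~R - l) v).

(** At the exponent [x] only one class m survives, the one for which x + l + m is an integer. *)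
Lemma nprodE s n f g x v :
  nprod s n f g x v =
  \sum_(l \in @class_rep R) \sum_(j \in [set: nat])
    gbin l j *: NP s l (n + j%:Z) f g (x + l - j%:R) v.
Proof.
rewrite /nprod; apply: eq_fsbigr => l _.
have [m0 m0c xm] := class_rep_ex (x + l).
rewrite (fsum_single (i0 := m0)) //; last first.
  move=> m mc mm0; rewrite fsbig1 // => j _; rewrite /zshift asboolF ?scaler0 // => h.
  apply: mm0; apply: class_rep_uniq => //.
  have -> : m - m0 = (x + (l + m - j%:R)) - (x + l + m0) + (j%:Z)%:~R by rewrite -[j%:~R]/(j%:R); ring.
  by apply: isintD; [apply/isintD/isintN|apply: isint_int].
apply: eq_fsbigr => j _; congr (_ *: _).
have h : isint (x + (l + m0 - j%:R)).
  have -> : x + (l + m0 - j%:R) = x + l + m0 + (- j%:Z)%:~R by rewrite mulrNz -[j%:~R]/(j%:R); ring.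
  by apply: isintD => //; exact: isint_int.
rewrite /zshift asboolT // /nprod0 /NP /class_part.
congr (_ - _ *: _); apply: eq_fsbigr => i _; congr (_ *: _).
  rewrite !intrD mulrNz -[i%:~R]/(i%:R) tointK //; congr (f _ (g _ v)); ring.
rewrite !intrD mulrNz -[i%:~R]/(i%:R) tointK //; congr (g _ (f _ v)); ring.
Qed.

(** For n >= 0 both binomial sums stop at n. Reversing the first one matches its modes with those of
    the second, and the signs become those of the binomial expansion of a difference. *)
Lemma NP_nat s l (n : nat) f g y v :
  NP s l n%:Z f g y v = iter n dif (cmt s l f g (y + n%:R - l) v) 0.
Proof.
rewrite /NP iter_difE.
rewrite !(fsum_nat (n := n.+1)); try by move=> i ni; rewrite gbin_nat bin_small // mulr0 scale0r.
rewrite (reindex_inj rev_ord_inj) /= scaler_sumr -sumrB; apply: eq_bigr => i _.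
have le_in : (i <= n)%N by rewrite -ltnS.
rewrite subSS !gbin_nat bin_sub // natrB // /cmt add0r scalerBr.
have -> : (-1) ^+ (n - i) = (-1) ^+ (n + i) :> R[i].
  by rewrite -[RHS]signr_odd -[LHS]signr_odd oddB // oddD.
have -> : (-1) ^ (n%:Z - i%:Z) = (-1) ^+ (n + i) :> R[i].
  by rewrite subzn // -exprnP -[RHS]signr_odd -[LHS]signr_odd oddB // oddD.
congr (_ - _).
  congr (_ *: f _ (g _ v)); rewrite -?[n%:~R]/(n%:R) -?[i%:~R]/(i%:R); ring.
rewrite !scalerA mulrC; congr (_ *: g _ (f _ v)); rewrite -?[n%:~R]/(n%:R) -?[i%:~R]/(i%:R); ring.
Qed.

Lemma local_dif s f g : local s f g ->
  exists N : nat, forall n, (N <= n)%N -> forall l T v q, iter n dif (cmt s l f g T v) q = 0.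
Proof.
move=> [N H]; exists N => n; elim: n => [|n IH].
  rewrite leqn0 => /eqP N0 l T v q; move: (H (q%:~R - l) (T + l - q%:~R) v).
  by rewrite N0 big_ord1 /= !addr0 mulr1 scale1r.
rewrite leq_eqVlt => /orP[/eqP <- {n IH} l T v q|/IH IH' l T v q]; last first.
  by rewrite /= /dif !IH' subrr.
have := H (q%:~R - l) (T + l - q%:~R - N%:R) v.
rewrite iter_difE => /(congr1 (fun u => (-1) ^+ N *: u)); rewrite scaler0 => H0.
rewrite -[RHS]H0 scaler_sumr; apply: eq_bigr => i _.
have le_iN : (i <= N)%N by rewrite -ltnS.
rewrite scalerA exprD mulrA; congr (_ *: _); rewrite /cmt natrB // intrD -[i%:~R]/(i%:R).
have -> : q%:~R + i%:R - l = q%:~R - l + i%:R by ring.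
have -> // : T + l - (q%:~R + i%:R) = T + l - q%:~R - N%:R + (N%:R - i%:R) by ring.
Qed.

Lemma nprod_class s n f g x v lam l :
  of_class lam f -> class_rep l -> isint (lam + l) -> (forall y, lin (g y)) ->
  nprod s n f g x v =
  \sum_(j \in [set: nat]) gbin l j *: NP s l (n + j%:Z) f g (x + l - j%:R) v.
Proof.
move=> fc lc ll gL; rewrite nprodE (fsum_single (i0 := l)) // => l' l'c l'l.
have f0 (k : int) w : f (k%:~R - l') w = 0.
  apply: contrapT => /fc h; apply: l'l; apply: class_rep_uniq => //.
  have -> : l' - l = k%:~R - (k%:~R - l' - lam) - (lam + l) by ring.
  by apply: isintD; [apply: isintD; [exact: isint_int|exact: isintN]|exact: isintN].
rewrite fsbig1 // => j _; rewrite /NP.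
rewrite !fsbig1 ?subrr ?scaler0 ?subr0 ?scaler0 // => i _.
  by rewrite -[i%:R]/((i%:Z)%:~R) f0 (lin0 (gL _)) scaler0.
by rewrite -[i%:R]/((i%:Z)%:~R) -mulrzBr f0 scaler0.
Qed.

End Fields.

(** * Commutators, normally ordered products and the derivation in terms of modes *)

Section Modes.
Variables (R : realType) (A : vertex_superalgebra R) (M : gen_module A).
Implicit Types (l s x y T : R[i]) (v : M).

Lemma act_lin (a : A) n : lin (@gm_act _ _ M a n).
Proof. by move=> c u v; have [h _ _] := gm_field M a; exact: h. Qed.

Lemma act_lin_l n v : lin (fun a : A => gm_act a n v).
Proof. by move=> c a b; rewrite gm_linear. Qed.

Section Products.
Variables (xa xb : bool) (a b : A) (lam l : R[i]).
Hypotheses (pa : vs_par xa a) (pb : vs_par xb b).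
Hypotheses (ac : of_class lam (@gm_act _ _ M a)) (lc : class_rep l) (ll : isint (lam + l)).
Hypothesis ab0 : forall n : nat, (2 <= n)%N -> vs_prod n%:Z a b = 0.
Let s := psign R xa xb.
Let f := @gm_act _ _ M a.
Let g := @gm_act _ _ M b.

Lemma act_prod_sum (n : nat) T v :
  gm_act (vs_prod n%:Z a b) (T - n%:R) v =
  \sum_(j \in [set: nat]) gbin l j *: iter (n + j) dif (cmt s l f g T v) 0.
Proof.
rewrite (gm_prod _ _ _ pa pb) (nprod_class _ _ _ _ ac lc ll); last exact: act_lin.
apply: eq_fsbigr => j _; congr (_ *: _).
rewrite -PoszD NP_nat natrD; congr (iter _ _ (cmt _ _ _ _ _ _) _); ring.
Qed.

(** Descending induction: locality kills the differences of large order, and [a_(j) b = 0] says that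
    a combination of differences of order at least j, in which order j has coefficient 1,
    vanishes. *)
Lemma cmt_dif0 T v j : (2 <= j)%N -> iter j dif (cmt s l f g T v) 0 = 0.
Proof.
have [N HN] := local_dif (gm_local M pa pb).
suff H d : forall j, (2 <= j)%N -> (N <= j + d)%N -> iter j dif (cmt s l f g T v) 0 = 0.
  by move=> j2; apply: (H N) => //; rewrite leq_addl.
elim: d {j} => [|d IH] j j2; first by rewrite addn0 => jN; exact: HN.
move=> jN; have := act_prod_sum j T v.
rewrite ab0 // (lin0 (act_lin_l _ _)) (fsum_single (i0 := 0%N)) //; last first.
  move=> [//|i] _ _; rewrite IH ?scaler0 //; first by rewrite (leq_trans j2) // leq_addr.
  by rewrite addnS addSn -addnS (leq_trans jN) // leq_add2r leq_addr.
by rewrite gbin0 scale1r addn0.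
Qed.

Lemma cmt_val T v : cmt s l f g T v 0 =
  gm_act (vs_prod 0 a b) T v - l *: gm_act (vs_prod 1 a b) (T - 1) v
  /\ dif (cmt s l f g T v) 0 = gm_act (vs_prod 1 a b) (T - 1) v.
Proof.
have D1 : dif (cmt s l f g T v) 0 = gm_act (vs_prod 1 a b) (T - 1) v.
  rewrite (act_prod_sum 1) (fsum_single (i0 := 0%N)) //; first by rewrite gbin0 scale1r.
  by move=> [//|i] _ _; rewrite cmt_dif0 ?scaler0.
split=> //; have := act_prod_sum 0 T v; rewrite subr0 (fsum_nat (n := 2)).
  rewrite big_ord_recl big_ord1 /= gbin0 gbin1 scale1r D1 => ->.
  by rewrite -addrA subrr addr0.
by move=> i i2; rewrite add0n cmt_dif0 ?scaler0.
Qed.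

(** The Borcherds commutator formula with a fractional index. The commutator is affine in [q], and
    its value at 0 carries the correction - l, so the first product gets the coefficient q - l =
    m. *)
Lemma act_comm (m k : R[i]) v : isint (m - lam) ->
  gm_act a m (gm_act b k v) - s *: gm_act b k (gm_act a m v) =
  gm_act (vs_prod 0 a b) (m + k) v + m *: gm_act (vs_prod 1 a b) (m + k - 1) v.
Proof.
move=> mi; have [q qE] : isint (m + l).
  by (have -> : m + l = m - lam + (lam + l) by ring); apply: isintD.
have mE : m = q%:~R - l by rewrite -qE; ring.
have kE : k = m + k + l - q%:~R by rewrite -qE; ring.
have [N HN] := local_dif (gm_local M pa pb).
have := dif_affine (HN N (leqnn N) l (m + k) v) (cmt_dif0 (m + k) v) q.
have [-> ->] := cmt_val (m + k) v.
rewrite {1}/cmt -mE -kE => ->.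
by move: (gm_act (vs_prod 1 a b) _ v) => w; rewrite mE scalerBl addrA addrAC.
Qed.

(** Only [j = 0] and [j = 1] contribute in the binomial expansion of z^l: the former gives the
    normally ordered product, the latter the correction by l times the zeroth product. *)
Lemma act_prodN1 x v : vs_prod 1 a b = 0 ->
  gm_act (vs_prod (-1) a b) x v =
  NP s l (-1) f g (x + l) v + l *: gm_act (vs_prod 0 a b) (x - 1) v.
Proof.
move=> ab1.
rewrite (gm_prod _ _ _ pa pb) (nprod_class _ _ _ _ ac lc ll); last exact: act_lin.
rewrite (fsum_nat (n := 2)); last first.
  case=> [//|[//|i]] _; have -> : -1 + i.+2%:Z = i.+1%:Z by lia.
  rewrite NP_nat; case: i => [|i]; last by rewrite cmt_dif0 ?scaler0.
  by rewrite /= (cmt_val _ _).2 ab1 (lin0 (act_lin_l _ _)) scaler0.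
transitivity (NP s l (-1) f g (x + l) v + l *: NP s l 0%:Z f g (x + l - 1) v).
  rewrite -(big_mkord xpredT (fun i => gbin l i *: NP _ l (-1 + i%:Z) _ _ (x + l - i%:R) v)).
  rewrite big_ltn // big_ltn // big_geq // !addr0 gbin0 gbin1 scale1r subr0.
  by congr (NP _ _ _ _ _ _ _ + _ *: NP _ _ _ _ _ _ _).
congr (_ + _ *: _).
have := cmt_val (x - 1) v; rewrite ab1 (lin0 (act_lin_l _ _)) scaler0 subr0 => -[<- _].
by rewrite NP_nat /=; congr (cmt _ _ _ _ _ _ _); ring.
Qed.

Lemma NP_N1 y v (B : nat) : 
  (forall i : nat, (B <= i)%N -> gm_act b (y + i%:R) v = 0) ->
  (forall i : nat, (B <= i)%N -> gm_act a (i%:R - l) v = 0) ->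
  NP s l (-1) f g y v =
  \sum_(i < B) (gm_act a (- 1 - i%:R - l) (gm_act b (y + i%:R) v) +
                s *: gm_act b (y - 1 - i%:R) (gm_act a (i%:R - l) v)).
Proof.
move=> b0 a0; rewrite /NP /f /g !(fsum_nat (n := B)); last first.
- by move=> i Bi; rewrite b0 // (lin0 (act_lin _ _)) scaler0.
- by move=> i Bi; rewrite a0 // (lin0 (act_lin _ _)) scaler0.
rewrite scaler_sumr -sumrB; apply: eq_bigr => i _.
have -> : (-1) ^ (-1 - i%:Z) = (-1) ^+ i.+1 :> R[i].
  have -> : -1 - i%:Z = - (i.+1)%:Z by lia.
  by rewrite -exprnN; exact: invr_sign.
rewrite gbinN1 -!exprD addSn exprS -signr_odd oddD addbb expr0 mulr1 scale1r scaleN1r scalerN opprK.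
by rewrite mulrN1z.
Qed.

End Products.

(** The identity field has the single mode -1, so each sum reduces to at most one term. The terms
    [j = 0] and [j = 1] of the expansion of z^l0 contribute - k and l0, where k = x + l0, and l0 - k
    = - x. *)
Lemma act_D xa (a : A) x v : vs_par xa a ->
  gm_act (vs_D a) x v = - x *: gm_act a (x - 1) v.
Proof.
move=> pa; rewrite /vs_D (gm_prod _ _ _ pa (vs_one_even A)) /psign andbF expr0 nprodE.
have [l0 l0c [k kE]] := class_rep_ex x.
set f := @gm_act _ _ M a; set g := @gm_act _ _ M (vs_one A).
have fL y : lin (f y) by exact: act_lin.
have gE n w : g n w = if n == -1 then w else 0 by rewrite /g gm_one.
have g0 n w : n != -1 -> g n w = 0 by move=> h; rewrite gE (negbTE h).
have nat_neqN1 (m : nat) : (m%:R : R[i]) != -1.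
  by rewrite -subr_eq0 opprK natr1 pnatr_eq0.
have int_eqN1 (m : int) : ((m%:~R : R[i]) == -1) = (m == -1) by exact: (eqr_int _ m (-1)).
rewrite (fsum_single (i0 := l0)) //; last first.
  move=> l lc ll0; rewrite fsbig1 // => j _.
  have ne (n : int) : x + l - j%:R + n%:~R != -1.
    apply/eqP => e; apply: ll0; apply: class_rep_uniq => //.
    exists (j%:Z - n - 1 - k); rewrite !intrD !mulrNz -kE -[j%:~R]/(j%:R).
    have -> : x = - 1 - n%:~R - l + j%:R by rewrite -e; ring.
    ring.
  rewrite /NP !fsbig1 ?scaler0 ?subr0 ?scaler0 // => i _.
    by rewrite g0 ?scaler0 // -addrA -[i%:R]/((i%:Z)%:~R) -mulrzBr -[1 *~ _]/(_%:~R) ne.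
  by rewrite g0 ?(lin0 (fL _)) ?scaler0 // -[i%:R]/((i%:Z)%:~R) ne.
rewrite (fsum_nat (n := 2)); last first.
  case=> [//|[//|i]] _; have -> : -2 + i.+2%:Z = i%:Z by lia.
  rewrite NP_nat; suff -> : cmt 1 l0 f g (x + l0 - i.+2%:R + i%:R - l0) v = (fun=> 0).
    suff H n q : iter n dif (fun=> 0 : M) q = 0 by rewrite H scaler0.
    by elim: n q => [//|n IH] q; rewrite iterS /dif !IH subrr.
  apply/funext => q; rewrite /cmt !gE scale1r; case: eqP => _; first by rewrite subrr.
  by rewrite (lin0 (fL _)) subrr.
(* The mode -1 of the identity field is met in the second sum if k > 0, in the first if k < 0, and
   in neither if k = 0. *)
have NP2 : NP 1 l0 (-2) f g k%:~R v = - k%:~R *: f (x - 1) v.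
  rewrite /NP scale1r; case: k kE => k kE.
    rewrite fsbig1 ?sub0r; last first.
      move=> i _; rewrite g0 ?(lin0 (fL _)) ?scaler0 //.
      by rewrite -[k%:~R]/(k%:R) -natrD nat_neqN1.
    case: k kE => [|k] kE.
      rewrite fsbig1 ?oppr0 ?scale0r // => i _.
      rewrite g0 ?scaler0 // -[i%:R]/((i%:Z)%:~R) -mulrzDr -mulrzBr int_eqN1.
      by lia.
    rewrite (fsum_single (i0 := k)) //; last first.
      move=> i _ ik; rewrite g0 ?scaler0 // -[i%:R]/((i%:Z)%:~R) -mulrzDr -mulrzBr int_eqN1.
      by lia.
    rewrite gE ifT; last first.
      rewrite -[k%:R]/((k%:Z)%:~R) -mulrzDr -mulrzBr int_eqN1; lia.
    rewrite scaleNr; congr (- (_ *: f _ v)).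
      have -> : (-2 - k%:Z) = - (k.+2)%:Z by lia.
      rewrite gbinN2 -exprnN mulrA; have -> : (-1) ^- k.+2 = (-1) ^+ k :> R[i].
        by rewrite invr_sign !exprS; ring.
      by rewrite -exprD -signr_odd oddD addbb mul1r.
    have -> : x = (k.+1)%:~R - l0 by rewrite -kE; ring.
    rewrite -[(k.+1)%:~R]/(k.+1%:R) -natr1; ring.
  rewrite [X in _ - X]fsbig1 ?subr0; last first.
    move=> i _; rewrite g0 ?scaler0 // -[i%:R]/((i%:Z)%:~R) -mulrzDr -mulrzBr int_eqN1.
    by lia.
  rewrite (fsum_single (i0 := k)) //; last first.
    move=> i _ ik; rewrite g0 ?(lin0 (fL _)) ?scaler0 // -[i%:R]/((i%:Z)%:~R) -mulrzDr int_eqN1.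
    by lia.
  rewrite gE ifT; last first.
    rewrite -[k%:R]/((k%:Z)%:~R) -mulrzDr int_eqN1; lia.
  rewrite gbinN2 mulrA -exprD -signr_odd oddD addbb mul1r; congr (_ *: f _ v).
    by rewrite NegzE mulrNz opprK.
  have -> : x = (Negz k)%:~R - l0 by rewrite -kE; ring.
  rewrite NegzE mulrNz -[(k.+1)%:~R]/(k.+1%:R) -natr1 -[(-2)%:~R]/(- 2%:R); ring.
have NP1 : NP 1 l0 (-1) f g (k%:~R - 1) v = f (x - 1) v.
  have -> : (k%:~R - 1 : R[i]) = (k - 1)%:~R by rewrite intrD.
  rewrite /NP scale1r; case: (lerP k 0) => k0.
    rewrite [X in _ - X]fsbig1 ?subr0; last first.
      move=> i _; rewrite g0 ?scaler0 // -[i%:R]/((i%:Z)%:~R) -mulrzDr -mulrzBr int_eqN1.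
      by lia.
    rewrite (fsum_single (i0 := `|k|%N)) //; last first.
      move=> i _ ik; rewrite g0 ?(lin0 (fL _)) ?scaler0 // -[i%:R]/((i%:Z)%:~R) -mulrzDr int_eqN1.
      by lia.
    rewrite gE ifT; last first.
      rewrite -[X in _ + X]/((`|k|%N%:Z)%:~R) -mulrzDr int_eqN1; lia.
    rewrite gbinN1 -exprD -signr_odd oddD addbb expr0 scale1r; congr (f _ v).
    have -> : x = k%:~R - l0 by rewrite -kE; ring.
    have -> : k%:~R = - (`|k|%N)%:R :> R[i].
      by rewrite -[X in - X]/((`|k|%N%:Z)%:~R) -mulrNz; congr (_%:~R); lia.
    rewrite -[(-1)%:~R]/(- 1%:R); ring.
  rewrite fsbig1 ?sub0r; last first.
    move=> i _; rewrite g0 ?(lin0 (fL _)) ?scaler0 // -[i%:R]/((i%:Z)%:~R) -mulrzDr int_eqN1.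
    by lia.
  clear NP2; case: k kE k0 => // -[//|k] kE _.
  rewrite (fsum_single (i0 := k)) //; last first.
    move=> i _ ik; rewrite g0 ?scaler0 // -[i%:R]/((i%:Z)%:~R) -mulrzDr -mulrzBr int_eqN1.
    by lia.
  rewrite gE ifT; last first.
    rewrite -[k%:R]/((k%:Z)%:~R) -mulrzDr -mulrzBr int_eqN1; lia.
  have -> : (-1 - k%:Z) = - (k.+1)%:Z by lia.
  rewrite gbinN1 -exprnN invr_sign exprS -mulrA -exprD -signr_odd oddD addbb mulr1 scaleN1r opprK.
  congr (f _ v); have -> : x = (k.+1)%:~R - l0 by rewrite -kE; ring.
  rewrite -[(k.+1)%:~R]/(k.+1%:R) -natr1; ring.
transitivity (NP 1 l0 (-2) f g k%:~R v + l0 *: NP 1 l0 (-1) f g (k%:~R - 1) v).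
  rewrite -(big_mkord xpredT (fun i => gbin l0 i *: NP _ l0 (-2 + i%:Z) _ _ (x + l0 - i%:R) v)).
  rewrite big_ltn // big_ltn // big_geq // !addr0 gbin0 gbin1 scale1r subr0 kE.
  by congr (NP _ _ _ _ _ _ _ + _ *: NP _ _ _ _ _ _ _).
rewrite NP2 NP1 -scalerDl; congr (_ *: _); rewrite -kE; ring.
Qed.

End Modes.

(** * Subspaces and components for distinct eigenvalues *)

Section Subspaces.
Variables (R : realType) (V : lmodType R[i]) (W : set V).
Hypothesis WS : subspace W.

Lemma sub0 : W 0. Proof. by case: WS. Qed.

Lemma subZ c u : W u -> W (c *: u).
Proof. by case: WS => W0 WL Wu; rewrite -[_ *: _]addr0; exact: WL. Qed.

Lemma subD u v : W u -> W v -> W (u + v).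
Proof. by case: WS => W0 WL Wu Wv; rewrite -[u]scale1r; exact: WL. Qed.

Lemma subB u v : W u -> W v -> W (u - v).
Proof. by move=> Wu Wv; rewrite -scaleN1r; apply: subD => //; exact: subZ. Qed.

Lemma subZ_inv c u : c != 0 -> W (c *: u) -> W u.
Proof. by move=> c0 /(subZ c^-1); rewrite scalerA mulVf // scale1r. Qed.

Lemma sub_sum (I : Type) (r : seq I) (P : pred I) (F : I -> V) :
  (forall i, P i -> W (F i)) -> W (\sum_(i <- r | P i) F i).
Proof. by move=> h; apply: (big_ind W) => //; [exact: sub0|exact: subD]. Qed.

Lemma sub_sum_seq (I : eqType) (r : seq I) (F : I -> V) :
  (forall i, i \in r -> W (F i)) -> W (\sum_(i <- r) F i).
Proof. by move=> h; rewrite big_seq; apply: sub_sum. Qed.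

Lemma sub_fsum (I : choiceType) (D : set I) (F : I -> V) :
  (forall i, D i -> W (F i)) -> W (\sum_(i \in D) F i).
Proof. by move=> h; apply: fsum_ind => //; [exact: sub0|exact: subD]. Qed.

(** Applying T minus the last eigenvalue removes the last component and rescales the others by
    nonzero factors, which drives the induction. *)
Lemma eigen_components (T : V -> V) n (x : nat -> V) (lam : nat -> R[i]) :
  lin T -> (forall v, W v -> W (T v)) ->
  (forall i, (i < n)%N -> T (x i) = lam i *: x i) ->
  (forall i j, (i < j < n)%N -> lam i != lam j) ->
  W (\sum_(i < n) x i) -> forall i, (i < n)%N -> W (x i).
Proof.
move=> TL WT; elim: n x => [//|n IH] x Tx ld Wx.
have H i : (i < n)%N -> W (x i).
  move=> i_n; have ne : lam i - lam n != 0 by rewrite subr_eq0 ld // i_n ltnS leqnn.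
  apply: (subZ_inv ne); apply: (IH (fun i => (lam i - lam n) *: x i)) => //.
  - by move=> j jn; rewrite (linZ TL) Tx ?scalerA 1?mulrC // ltnS ltnW.
  - by move=> j k /andP[jk kn]; rewrite ld // jk ltnS ltnW.
  have -> : \sum_(j < n) (lam j - lam n) *: x j =
      T (\sum_(j < n.+1) x j) - lam n *: \sum_(j < n.+1) x j.
    rewrite (lin_sum TL) scaler_sumr -sumrB big_ord_recr /= Tx // subrr addr0.
    by apply: eq_bigr => j _; rewrite Tx ?scalerBl // ltnS ltnW.
  by apply: subB; [exact: WT|exact: subZ].
move=> i; rewrite ltnS leq_eqVlt => /orP[/eqP ->|]; last exact: H.
have -> : x n = \sum_(j < n.+1) x j - \sum_(j < n) x j.
  by rewrite big_ord_recr /= addrAC subrr add0r.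
by apply: subB => //; apply: sub_sum => j _; exact: H.
Qed.

End Subspaces.

(** * Heisenberg modules *)

(* Heisenberg modes [op a n] with [[op a m, op b n]] the scalar [br m a b] when
   [m + n = 0] and zero otherwise; [e], [e'] are dual families with respect to [br]. *)
Section HeisenbergModes.
Variables (R : realType) (V : lmodType R[i]) (H : Type).
Variables (op : H -> int -> V -> V) (br : int -> H -> H -> R[i]).
Variables (r : nat) (e e' : 'I_r -> H).
Hypothesis opL : forall a n, lin (op a n).
Hypothesis op_comm : forall a b m n v,
  op a m (op b n v) = op b n (op a m v) + (if m + n == 0 then br m a b else 0) *: v.
Hypothesis op_dual : forall (n : nat) b v, (0 < n)%N ->
  \sum_i br n%:Z (e' i) b *: op (e i) (- n%:Z) v = n%:R *: op b (- n%:Z) v.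

Inductive Fock (S : set V) : nat -> V -> Prop :=
| Fock_base v : S v -> Fock S 0 v
| Fock_op d a n v : (0 < n)%N -> Fock S d v -> Fock S (d + n) (op a (- n%:Z) v)
| Fock_zero d : Fock S d 0
| Fock_lin d c u v : Fock S d u -> Fock S d v -> Fock S d (c *: u + v).

Variable S : set V.
Hypothesis S_vac : forall a (n : nat) v, (0 < n)%N -> S v -> op a n%:Z v = 0.

Lemma FockD d u v : Fock S d u -> Fock S d v -> Fock S d (u + v).
Proof. by move=> Fu Fv; rewrite -[u]scale1r; exact: Fock_lin. Qed.

Lemma FockZ d c u : Fock S d u -> Fock S d (c *: u).
Proof. by move=> Fu; rewrite -[_ *: _]addr0; apply: Fock_lin => //; exact: Fock_zero. Qed.

Lemma Fock_sum d (I : Type) (s : seq I) (F : I -> V) :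
  (forall i, Fock S d (F i)) -> Fock S d (\sum_(i <- s) F i).
Proof. by move=> h; apply: big_ind => //; [exact: Fock_zero|exact: FockD]. Qed.

Lemma Fock_lower a (m : nat) d v : (0 < m)%N -> Fock S d v ->
  if (m <= d)%N then Fock S (d - m) (op a m%:Z v) else op a m%:Z v = 0.
Proof.
move=> m0; elim=> {d v} [v Sv|d b n v n0 Fv IH|d|d c u v Fu IHu Fv IHv].
- by rewrite leqNgt m0 /=; exact: S_vac.
- rewrite op_comm.
  have [md|dm] := leqP m d.
    rewrite md in IH; rewrite (leq_trans md (leq_addr _ _)).
    rewrite -addnBAC //; apply: FockD; first exact: Fock_op.
    case: eqP => [h|_]; last by rewrite scale0r; exact: Fock_zero.
    have -> : (d - m + n = d)%N by lia.
    exact: FockZ.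
  rewrite leqNgt dm /= in IH; rewrite IH (lin0 (opL _ _)) add0r.
  case: eqP => h; last by rewrite scale0r; case: ifP => // _; exact: Fock_zero.
  have -> : m = n by lia.
  by rewrite leq_addl addnK; exact: FockZ.
- by rewrite (lin0 (opL _ _)); case: ifP => // _; exact: Fock_zero.
- rewrite opL; case: ifP IHu IHv => _; first exact: Fock_lin.
  by move=> -> ->; rewrite scaler0 addr0.
Qed.

Lemma Fock_op0 a d v : (forall b s, S s -> S (op b 0 s)) ->
  Fock S d v -> Fock S d (op a 0 v).
Proof.
move=> S0; elim=> {d v} [v Sv|d b n v n0 Fv IH|d|d c u v Fu IHu Fv IHv].
- by apply: Fock_base; exact: S0.
- rewrite op_comm; case: eqP => [h|_]; first by lia.
  by rewrite scale0r addr0; exact: Fock_op.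
- by rewrite (lin0 (opL _ _)); exact: Fock_zero.
- by rewrite opL; exact: Fock_lin.
Qed.

(** The Heisenberg part of the energy operator L_0, truncated to the modes up to K. By [op_dual] its
    commutator with a creation mode of index - n, 0 < n <= K, is n times that mode. *)
Definition degree_op K v : V :=
  \sum_(n < K) \sum_i op (e i) (- (n.+1)%:Z) (op (e' i) (n.+1)%:Z v).

Lemma degree_opL K : lin (degree_op K).
Proof.
move=> c u v; rewrite /degree_op scaler_sumr -big_split; apply: eq_bigr => n _.
rewrite scaler_sumr -big_split; apply: eq_bigr => i _.
by rewrite !opL.
Qed.

Lemma degree_opE K d v : (d <= K)%N -> Fock S d v -> degree_op K v = d%:R *: v.
Proof.
move=> dK Fv; elim: Fv dK => {d v} [v Sv|d b n v n0 Fv IH|d|d c u v Fu IHu Fv IHv] dK.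
- rewrite scale0r /degree_op big1 // => n _; rewrite big1 // => i _.
  by rewrite S_vac // (lin0 (opL _ _)).
- have IH' := IH (leq_trans (leq_addr _ _) dK).
  have nK : (n.-1 < K)%N by rewrite prednK // (leq_trans _ dK) // leq_addl.
  have E : degree_op K (op b (- n%:Z) v) = op b (- n%:Z) (degree_op K v)
    + \sum_i br n%:Z (e' i) b *: op (e i) (- n%:Z) v.
    rewrite /degree_op (lin_sum (opL _ _)).
    rewrite (bigD1 (Ordinal nK)) //= [in RHS](bigD1 (Ordinal nK)) //= prednK //.
    rewrite addrAC; congr (_ + _).
      rewrite (lin_sum (opL _ _)) -big_split; apply: eq_bigr => i _ /=.
      rewrite (op_comm (e' i) b) subrr eqxx linD // linZ // (op_comm (e i) b).
      by case: eqP => [h|_]; [lia|rewrite scale0r addr0].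
    apply: eq_bigr => k kn; rewrite (lin_sum (opL _ _)); apply: eq_bigr => i _.
    rewrite (op_comm (e' i) b); case: eqP => [h|_].
      by case/eqP: kn; apply: val_inj => /=; lia.
    rewrite scale0r addr0 (op_comm (e i) b).
    by case: eqP => [h|_]; [lia|rewrite scale0r addr0].
  by rewrite E IH' op_dual // (linZ (opL _ _)) -scalerDl natrD.
- by rewrite (lin0 (degree_opL K)) scaler0.
- by rewrite degree_opL IHu // IHv // scalerDr !scalerA mulrC.
Qed.

Definition Fock_le D v :=
  exists2 w : nat -> V, (forall d, Fock S d (w d)) & v = \sum_(d < D) w d.

Lemma Fock_le0 D : Fock_le D 0.
Proof. by exists (fun=> 0); [move=> d; exact: Fock_zero|rewrite big1]. Qed.

Lemma Fock_leL D c u v : Fock_le D u -> Fock_le D v -> Fock_le D (c *: u + v).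
Proof.
move=> [w Fw ->] [w' Fw' ->]; exists (fun d => c *: w d + w' d).
  by move=> d; exact: Fock_lin.
by rewrite big_split scaler_sumr.
Qed.

Lemma Fock_le_of D d v : (d < D)%N -> Fock S d v -> Fock_le D v.
Proof.
move=> dD Fv; exists (fun d' => if d' == d then v else 0).
  by move=> d'; case: eqP => [-> //|_]; exact: Fock_zero.
rewrite (bigD1 (Ordinal dD)) //= eqxx big1 ?addr0 // => i id.
by case: eqP => // h; case/eqP: id; exact: val_inj.
Qed.

Lemma Fock_le_sum D (I : Type) (s : seq I) (P : pred I) (F : I -> V) :
  (forall i, P i -> Fock_le D (F i)) -> Fock_le D (\sum_(i <- s | P i) F i).
Proof.
move=> h; apply: (big_ind (Fock_le D)) => //; first exact: Fock_le0.
by move=> u v Fu Fv; rewrite -[u]scale1r; exact: Fock_leL.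
Qed.

Lemma Fock_le_widen D D' v : (D <= D')%N -> Fock_le D v -> Fock_le D' v.
Proof.
move=> DD' [w Fw ->]; apply: Fock_le_sum => d _; apply: (Fock_le_of (d := d)) => //.
exact: leq_trans DD'.
Qed.

Lemma Fock_le_lower D a (m : nat) v : (0 < m)%N ->
  Fock_le D v -> Fock_le D.-1 (op a m%:Z v).
Proof.
move=> m0 [w Fw ->]; rewrite (lin_sum (opL _ _)); apply: Fock_le_sum => d _.
have := Fock_lower a m0 (Fw d); case: ifP => [md|_ ->]; last exact: Fock_le0.
by apply: Fock_le_of; have := ltn_ord d; lia.
Qed.

(** A vector killed by the positive modes is killed by [degree_op], which acts on the part of degree
    d as d; so the parts of positive degree vanish. *)
Lemma Fock_vacuum D v : S 0 -> (forall c u v, S u -> S v -> S (c *: u + v)) ->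
  Fock_le D v -> (forall a (n : nat), (0 < n)%N -> op a n%:Z v = 0) -> S v.
Proof.
move=> S0 SL [w Fw vE] vac.
have F0 u : Fock S 0 u -> S u.
  move=> Fu; have : 0%N = 0%N by []; move: {1 3}0%N Fu => d Fu; elim: Fu => //.
  - by move=> d' a n w' n0 _ _ h; exfalso; lia.
  - by move=> d' c x y _ Sx _ Sy d0; apply: SL; [exact: Sx|exact: Sy].
case: D vE => [->|D vE]; first by rewrite big_ord0.
have dv0 : degree_op D v = 0.
  by rewrite /degree_op big1 // => n _; rewrite big1 // => i _; rewrite vac // (lin0 (opL _ _)).
(* The line spanned by [v] is stable, since [degree_op] is zero on it. Hence it contains every
   component [w d], and these are killed too. *)
have WS : subspace [set u | exists c : R[i], u = c *: v].
  split; first by exists 0; rewrite scale0r.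
  by move=> c x y [a ->] [b ->]; exists (c * a + b); rewrite scalerDl scalerA.
have w0 d : (0 < d < D.+1)%N -> w d = 0.
  move=> /andP[d0 dD].
  have Ew i : (i < D.+1)%N -> degree_op D (w i) = i%:R *: w i by move=> iD; exact: degree_opE.
  have [] := @eigen_components _ _ _ WS (degree_op D) D.+1 w (fun i => i%:R) (degree_opL D) _ Ew _ _ d dD.
  - by move=> _ [c ->]; exists 0; rewrite (linZ (degree_opL D)) dv0 scaler0 scale0r.
  - by move=> i j /andP[ij _]; rewrite eqr_nat neq_ltn ij.
  - by exists 1; rewrite scale1r vE.
  move=> c wc; have := Ew d dD; rewrite {1}wc (linZ (degree_opL D)) dv0 scaler0 => /esym/eqP.
  by rewrite scaler_eq0 pnatr_eq0 gtn_eqF //= => /eqP.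
rewrite vE big_ord_recl /= big1 ?addr0; first exact: F0.
by move=> i _; apply: w0; rewrite /bump add1n /= ltnS.
Qed.

(** Each positive mode lowers the degree bound, so applying modes that do not kill the vector must
    stop. *)
Lemma Fock_lowest D v (Q : set V) :
  (forall a (n : nat) u, (0 < n)%N -> Q u -> Q (op a n%:Z u)) ->
  Fock_le D v -> v <> 0 -> Q v ->
  exists u, [/\ Q u, u <> 0 & forall a (n : nat), (0 < n)%N -> op a n%:Z u = 0].
Proof.
move=> Qop; elim: D v => [|D IH] v Fv v0 Qv.
  by case: Fv v0 => w _ ->; rewrite big_ord0.
case: (pselect (forall a (n : nat), (0 < n)%N -> op a n%:Z v = 0)) => [vac|].
  by exists v.
move=> /existsNP[a /existsNP[n /not_implyP[n0 nv]]].
apply: (IH (op a n%:Z v)) => //; last exact: Qop.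
exact: (Fock_le_lower a n0 Fv).
Qed.

Lemma Fock_le_op D a (n : int) v : (forall b s, S s -> S (op b 0 s)) ->
  Fock_le D v -> exists D', Fock_le D' (op a n v).
Proof.
move=> S0; case: n => [[|n]|n] Fv.
- case: Fv => w Fw ->; exists D; rewrite (lin_sum (opL _ _)); apply: Fock_le_sum => d _.
  by apply: (Fock_le_of (d := d)) => //; exact: Fock_op0.
- by exists D.-1; exact: Fock_le_lower.
- case: Fv => w Fw ->; exists (D + n.+1)%N; rewrite (lin_sum (opL _ _)); apply: Fock_le_sum => d _.
  apply: (Fock_le_of (d := (d + n.+1)%N)); first by rewrite ltn_add2r.
  by rewrite NegzE; exact: Fock_op.
Qed.

Lemma Fock_le_sub D v (Q : set V) : subspace Q -> (forall s, S s -> Q s) ->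
  (forall a n u, Q u -> Q (op a n u)) -> Fock_le D v -> Q v.
Proof.
move=> QS SQ Qop [w Fw ->]; apply: sub_sum => // d _; elim: (Fw d) => //.
- by move=> *; exact: Qop.
- by move=> *; exact: sub0.
- by move=> d' c x y _ Qx _ Qy; case: QS => _; apply.
Qed.

End HeisenbergModes.

(** The values are typed in [R[i]] instead of [R[i]^o], for use as scalars in ring computations. *)
Definition bform (R : realType) (L : lattice_data R) (a b : ld_h L) : R[i] := ld_form L a b.

(** * The lattice *)

Section LatticeTheory.
Variables (R : realType) (L : lattice_data R).
Local Notation h := (ld_h L).
Local Notation p := (ld_p L).
Local Notation form := (@bform R L).
Implicit Types a b : h.

Lemma bformDl a a' b : form (a + a') b = form a b + form a' b.
Proof. by rewrite /bform linearDl. Qed.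

Lemma bformZl c a b : form (c *: a) b = c * form a b.
Proof. by rewrite /bform linearZl_LR. Qed.

Lemma bformC a b : form a b = form b a.
Proof. exact: ld_form_sym. Qed.

Lemma bformDr a b b' : form a (b + b') = form a b + form a b'.
Proof. by rewrite bformC bformDl !(bformC a). Qed.

Lemma bformZr c a b : form a (c *: b) = c * form a b.
Proof. by rewrite bformC bformZl bformC. Qed.

Lemma form_nondeg a : (forall b, form a b = 0) -> a = 0.
Proof. exact: ld_form_nondeg. Qed.

Lemma form_orth k l a b : (k < p)%N -> (l < p)%N -> ~~ (p %| k + l)%N ->
  a \in ld_part L k -> b \in ld_part L l -> form a b = 0.
Proof. exact: ld_part_orth. Qed.

Lemma bform0l b : form 0 b = 0.
Proof. by rewrite -(scale0r 0) bformZl mul0r. Qed.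

Lemma bformNl a b : form (- a) b = - form a b.
Proof. by rewrite -scaleN1r bformZl mulN1r. Qed.

Lemma form_suml (I : Type) (r : seq I) (P : pred I) (F : I -> h) b :
  form (\sum_(i <- r | P i) F i) b = \sum_(i <- r | P i) form (F i) b.
Proof. by apply: (big_morph (form^~ b)) => [x y|]; [exact: bformDl|exact: bform0l]. Qed.

Lemma form_sumr (I : Type) (r : seq I) (P : pred I) (F : I -> h) a :
  form a (\sum_(i <- r | P i) F i) = \sum_(i <- r | P i) form a (F i).
Proof. by rewrite bformC form_suml; apply: eq_bigr => i _; rewrite bformC. Qed.

Lemma p_gt0 : (0 < p)%N. Proof. exact: ld_p_gt0. Qed.

Lemma p_neq0 : (p%:R : R[i]) != 0.
Proof. by rewrite pnatr_eq0 -lt0n p_gt0. Qed.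

Lemma lproj_mem k a : lproj L k a \in ld_part L k.
Proof. exact: memv_sum_pi. Qed.

Lemma sum_lproj a : \sum_(0 <= k < p) lproj L k a = a.
Proof. by apply: sumv_pi_nat_sum; rewrite ld_part_full memvf. Qed.

(** The component of class k pairs nontrivially only with that of class - k, so pairing the sum with
    vectors of class - k isolates [c k]; nondegeneracy concludes. *)
Lemma part_indep (c : nat -> h) :
  (forall k, (k < p)%N -> c k \in ld_part L k) ->
  \sum_(0 <= k < p) c k = 0 -> forall k, (k < p)%N -> c k = 0.
Proof.
move=> cP c0 k kp; apply: form_nondeg => v; rewrite -(sum_lproj v) form_sumr.
rewrite big_nat big1 // => l /= lp.
case: (boolP (p %| k + l)%N) => kl; last exact: form_orth kp lp kl (cP k kp) (lproj_mem l v).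
transitivity (form (\sum_(0 <= j < p) c j) (lproj L l v)); last by rewrite c0 bform0l.
rewrite form_suml big_mkord (bigD1 (Ordinal kp)) //= big1 ?addr0 // => j jk.
apply: (form_orth (k := j) (l := l)) (cP j (ltn_ord j)) (lproj_mem l v) => //.
apply: contra jk => jl; apply/eqP/val_inj => /=.
have : j = k %[mod p].
  by apply/eqP; rewrite -(eqn_modDr l); move: jl kl; rewrite /dvdn => /eqP -> /eqP ->.
by rewrite !modn_small.
Qed.

Lemma lproj_part k l a : (k < p)%N -> (l < p)%N -> a \in ld_part L k ->
  lproj L l a = if l == k then a else 0.
Proof.
move=> kp lp ak; apply/eqP; rewrite -subr_eq0; apply/eqP.
apply: (@part_indep (fun l => lproj L l a - (if l == k then a else 0))) lp => [j jp|].
  by rewrite rpredB ?lproj_mem //; case: eqP => [->//|_]; exact: mem0v.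
rewrite sumrB sum_lproj big_mkord (bigD1 (Ordinal kp)) //= eqxx big1 ?addr0 ?subrr // => j.
by case: (eqVneq (j : nat) k) => // e; rewrite -val_eqE /= e eqxx.
Qed.

Lemma lproj_lproj k l a : (k < p)%N -> (l < p)%N ->
  lproj L l (lproj L k a) = if l == k then lproj L k a else 0.
Proof. by move=> kp lp; apply: lproj_part => //; exact: lproj_mem. Qed.

Lemma form_lproj k l a b : (k < p)%N -> (l < p)%N -> (p %| k + l)%N ->
  form (lproj L k a) b = form a (lproj L l b).
Proof.
move=> kp lp kl.
have U j : (j < p)%N -> (p %| k + j)%N -> j = l.
  move=> jp kj; have : j = l %[mod p].
    by apply/eqP; rewrite -(eqn_modDl k); move: kj kl; rewrite /dvdn => /eqP -> /eqP ->.
  by rewrite !modn_small.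
have U' j : (j < p)%N -> (p %| j + l)%N -> j = k.
  move=> jp kj; have : j = k %[mod p].
    by apply/eqP; rewrite -(eqn_modDr l); move: kj kl; rewrite /dvdn => /eqP -> /eqP ->.
  by rewrite !modn_small.
transitivity (form (lproj L k a) (lproj L l b)).
  rewrite -{1}(sum_lproj b) form_sumr big_mkord (bigD1 (Ordinal lp)) //= big1 ?addr0 // => j jl.
  apply: form_orth (lproj_mem k a) (lproj_mem j b) => //.
  by apply: contra jl => kj; apply/eqP/val_inj/U => /=.
rewrite -{2}(sum_lproj a) form_suml big_mkord (bigD1 (Ordinal kp)) //= big1 ?addr0 // => j jl.
apply: form_orth (lproj_mem j a) (lproj_mem l b) => //.
by apply: contra jl => kj; apply/eqP/val_inj/U' => /=.
Qed.

Lemma cproj_lt (n : int) : (`|(n %% p)%Z|%N < p)%N.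
Proof.
have p0 := p_gt0; have h1 : (n %% p)%Z < p%:Z by apply: ltz_pmod.
have h2 : 0 <= (n %% p)%Z by apply: modz_ge0; rewrite eqz_nat -lt0n.
by rewrite -ltz_nat gez0_abs.
Qed.

Lemma cprojE (n : int) (k : nat) : (k < p)%N -> (exists q : int, n = k%:Z + q * p%:Z) ->
  cproj L n = lproj L k.
Proof.
move=> kp [q ->]; rewrite /cproj addrC modzMDl modz_small //.
Qed.

Lemma cproj_ex (n : int) : exists k : nat, exists q : int, (k < p)%N /\ n = k%:Z + q * p%:Z.
Proof.
exists `|(n %% p)%Z|%N, (n %/ p)%Z; split; first exact: cproj_lt.
rewrite gez0_abs ?modz_ge0 // ?eqz_nat -?lt0n ?p_gt0 //.
by rewrite addrC -divz_eq.
Qed.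

Lemma cproj_cproj n a : cproj L n (cproj L n a) = cproj L n a.
Proof.
by have [k [q [kp nE]]] := cproj_ex n; rewrite (cprojE kp) ?lproj_lproj ?eqxx //; exists q.
Qed.

Lemma form_cproj n a b : form (cproj L n a) b = form a (cproj L (- n) b).
Proof.
have [k [q [kp ->]]] := cproj_ex n; have [l [s [lp e]]] := cproj_ex (- (k%:Z + q * p%:Z)).
rewrite (cprojE kp); last by exists q.
rewrite (cprojE lp); last by exists s.
apply: form_lproj => //; have : (p%:Z %| (k + l)%:Z)%Z by apply/dvdzP; exists (- (q + s)); lia.
by rewrite dvdzE.
Qed.

Lemma sigmaE a : sigma L a = \sum_(0 <= k < p) exp2pii (k%:R / p%:R) *: lproj L k a.
Proof. by rewrite /sigma sum_lfunE; apply: eq_bigr => k _; rewrite scale_lfunE. Qed.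

Lemma sigma_part k a : (k < p)%N -> a \in ld_part L k ->
  sigma L a = exp2pii (k%:R / p%:R) *: a.
Proof.
move=> kp ak; rewrite sigmaE big_mkord (bigD1 (Ordinal kp)) //= big1 ?addr0.
  by rewrite (lproj_part kp) // eqxx.
by move=> j jk; rewrite (lproj_part kp) // ifN ?scaler0.
Qed.

Lemma lproj_sigma k a : (k < p)%N -> lproj L k (sigma L a) = exp2pii (k%:R / p%:R) *: lproj L k a.
Proof.
move=> kp; rewrite sigmaE linear_sum big_mkord (bigD1 (Ordinal kp)) //= big1 ?addr0.
  by rewrite linearZ /= lproj_lproj // eqxx.
by move=> j jk; rewrite linearZ /= lproj_lproj // ifN ?scaler0 // eq_sym.
Qed.

Lemma lproj_iter_sigma k m a : (k < p)%N ->
  lproj L k (iter m (sigma L) a) = exp2pii (k%:R / p%:R) ^+ m *: lproj L k a.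
Proof.
move=> kp; elim: m => [|m IH]; first by rewrite scale1r.
by rewrite iterS lproj_sigma // IH scalerA exprS.
Qed.

Lemma lproj_inj a b : (forall k, (k < p)%N -> lproj L k a = lproj L k b) -> a = b.
Proof.
move=> e; rewrite -(sum_lproj a) -(sum_lproj b) big_nat [RHS]big_nat.
by apply: eq_bigr => k /= /e.
Qed.

(** On the component of class k this is a geometric sum whose ratio is a p-th root of unity, equal
    to 1 only for k = 0. *)
Lemma sum_iter_sigma a : \sum_(s < p) iter s (sigma L) a = p%:R *: lproj L 0 a.
Proof.
apply: lproj_inj => k kp; rewrite linear_sum linearZ /=.
under eq_bigr => s _ do rewrite lproj_iter_sigma //.
rewrite -scaler_suml lproj_lproj ?p_gt0 //; case: eqP => [->|/eqP k0].
  congr (_ *: _); rewrite mul0r exp2pii0 (eq_bigr (fun=> 1)) => [|s _]; last by rewrite expr1n.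
  by rewrite sumr_const card_ord.
rewrite scaler0 -[RHS](scale0r (lproj L k a)); congr (_ *: _).
have ne : exp2pii (k%:R / p%:R) - 1 != 0 :> R[i].
  by rewrite subr_eq0 exp2pii_frac_neq1 // kp lt0n k0.
apply: (mulfI ne); rewrite -subrX1 exp2piiX_frac ?p_gt0 // mulr0.
by rewrite (exp2pii_int R k%:Z) subrr.
Qed.

Lemma form_sigma a b : form (sigma L a) (sigma L b) = form a b.
Proof.
rewrite -[in RHS](sum_lproj a) form_suml sigmaE form_suml big_nat [RHS]big_nat.
apply: eq_bigr => k /= kp.
have [l [q [lp e]]] := cproj_ex (- k%:Z).
have kl : (p %| k + l)%N.
  by have : (p%:Z %| (k + l)%:Z)%Z by [apply/dvdzP; exists (- q); lia]; rewrite dvdzE.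
rewrite bformZl (form_lproj _ _ kp lp kl) lproj_sigma // bformZr mulrA -exp2piiD -mulrDl -natrD.
rewrite -(form_lproj _ _ kp lp kl).
have -> : exp2pii ((k + l)%:R / p%:R) = 1 :> R[i].
  case/dvdnP: kl => m ->; rewrite natrM mulfK ?p_neq0 //; exact: (exp2pii_int R m%:Z).
by rewrite mul1r.
Qed.

Lemma LamD a b : Lam L a -> Lam L b -> Lam L (a + b).
Proof.
move=> [x ->] [y ->]; exists (fun i => x i + y i); rewrite -big_split /=.
by apply: eq_bigr => i _; rewrite mulrzDr.
Qed.

Lemma LamN a : Lam L a -> Lam L (- a).
Proof.
move=> [x ->]; exists (fun i => - x i); rewrite -sumrN.
by apply: eq_bigr => i _; rewrite mulrNz.
Qed.

Lemma Lam0 : Lam L 0.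
Proof. by exists (fun=> 0); rewrite big1 // => i _; rewrite mulr0z. Qed.

Lemma LamB a b : Lam L a -> Lam L b -> Lam L (a - b).
Proof. by move=> La Lb; apply: LamD => //; exact: LamN. Qed.

Lemma Lam_sum (I : Type) (r : seq I) (F : I -> h) :
  (forall i, Lam L (F i)) -> Lam L (\sum_(i <- r) F i).
Proof. by move=> hF; apply: big_ind => //; [exact: Lam0|exact: LamD]. Qed.

Lemma LamMn a n : Lam L a -> Lam L (a *+ n).
Proof. by move=> La; elim: n => [|n IH]; [exact: Lam0|rewrite mulrS; exact: LamD]. Qed.

Lemma LamMz a (z : int) : Lam L a -> Lam L (a *~ z).
Proof. by case: z => n La; [exact: LamMn|rewrite NegzE mulrNz; exact/LamN/LamMn]. Qed.

Lemma Lam_basis (i : 'I_(\dim (fullv : {vspace h}))) : Lam L (ld_basis L)`_i.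
Proof.
exists (fun j => (j == i)%:Z); rewrite (bigD1 i) //= eqxx mulr1z big1 ?addr0 // => j ji.
by rewrite (negbTE ji) mulr0z.
Qed.

Lemma Lam_sigma (sL : [set sigma L a | a in Lam L] = Lam L) a :
  Lam L a -> Lam L (sigma L a).
Proof. by move=> La; rewrite -sL; exists a. Qed.

Lemma Lam_iter_sigma (sL : [set sigma L a | a in Lam L] = Lam L) m a :
  Lam L a -> Lam L (iter m (sigma L) a).
Proof. by move=> La; elim: m => [//|m IH]; exact: Lam_sigma. Qed.

Lemma form_int (ok : lattice_ok L) a b : Lam L a -> Lam L b -> form a b = (ipair a b)%:~R.
Proof.
case: ok => li _ _ La Lb; rewrite tointK //; exact: (li a b 0%N La Lb p_gt0).
Qed.

Local Notation r := (\dim (fullv : {vspace h})).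
Local Notation B := (ld_basis L).

Definition gram : 'M[R[i]]_r := \matrix_(i, j) form B`_i B`_j.

Lemma basis_expand a : exists x : 'rV[R[i]]_r, a = \sum_i x 0 i *: B`_i.
Proof.
exists (\row_i coord B i a); rewrite {1}(coord_basis (ld_basisP L) (memvf a)).
by apply: eq_bigr => i _; rewrite mxE.
Qed.

Lemma gram_unit : gram \in unitmx.
Proof.
rewrite -row_free_unit -kermx_eq0; apply/eqP/row_matrixP => k; rewrite row0.
set x := row k _.
have xg : x *m gram = 0 by apply/sub_kermxP; exact: row_sub.
have v0 : \sum_i x 0 i *: B`_i = 0.
  apply: form_nondeg => v; have [y ->] := basis_expand v.
  rewrite form_sumr big1 // => j _; rewrite bformZr form_suml.
  have := congr1 (fun m : 'rV_r => m 0 j) xg; rewrite !mxE => e.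
  rewrite (_ : \sum_i _ = 0) ?mulr0 // -[RHS]e; apply: eq_bigr => i _.
  by rewrite bformZl [gram i j]mxE.
apply/rowP => i; rewrite [RHS]mxE.
by move/freeP: (basis_free (ld_basisP L)); apply.
Qed.

Definition dual_basis (i : 'I_r) : h := \sum_j invmx gram i j *: B`_j.

Lemma dual_basisE a : \sum_i form (dual_basis i) a *: B`_i = a.
Proof.
have [x ->] := basis_expand a; apply: eq_bigr => i _; congr (_ *: _).
rewrite form_sumr (eq_bigr (fun k => x 0 k * (invmx gram *m gram) i k)).
  rewrite mulVmx ?gram_unit // (bigD1 i) //= mxE eqxx mulr1 big1 ?addr0 // => k ki.
  by rewrite mxE eq_sym (negbTE ki) mulr0.
move=> k _; rewrite bformZr; congr (_ * _); rewrite form_suml mxE.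
by apply: eq_bigr => j _; rewrite bformZl mxE.
Qed.

End LatticeTheory.

(** * The product of two modules *)

Section PairSums.
Variables (K : fieldType) (V1 V2 : lmodType K).

Lemma fst_lin : lin (fst : V1 * V2 -> V1). Proof. by []. Qed.
Lemma snd_lin : lin (snd : V1 * V2 -> V2). Proof. by []. Qed.

(** Both supports have to be finite: an infinite support in one coordinate would turn the left side
    into the default value 0 in both. *)
Lemma pair_fsum (I : choiceType) (D : set I) (F : I -> V1 * V2) :
  finite_set [set i | D i /\ (F i).1 <> 0] -> finite_set [set i | D i /\ (F i).2 <> 0] ->
  \sum_(i \in D) F i = (\sum_(i \in D) (F i).1, \sum_(i \in D) (F i).2).
Proof.
move=> f1 f2; have fU : finite_set ([set i | D i /\ (F i).1 <> 0] `|` [set i | D i /\ (F i).2 <> 0]).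
  by rewrite finite_setU.
have [r rE] := finite_fsetP.1 fU.
have H i : (i \in r) <-> ([set i | D i /\ (F i).1 <> 0] `|` [set i | D i /\ (F i).2 <> 0]) i.
  by rewrite rE.
have rD i : i \in r -> D i by move=> /H[[]|[]].
have n1 i : D i -> i \notin r -> (F i).1 = 0.
  by move=> Di /negP nr; apply: contrapT => h; apply: nr; apply/H; left.
have n2 i : D i -> i \notin r -> (F i).2 = 0.
  by move=> Di /negP nr; apply: contrapT => h; apply: nr; apply/H; right.
rewrite !(fsum_seq (r := r)) ?fset_uniq //.
  rewrite [LHS]surjective_pairing; congr (_, _).
    by rewrite (lin_sum fst_lin).
  by rewrite (lin_sum snd_lin).
by move=> i Di nr; rewrite [F i]surjective_pairing n1 // n2.
Qed.

Lemma pair_fsum_nat (F : nat -> V1 * V2) B1 B2 :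
  (forall i, (B1 <= i)%N -> (F i).1 = 0) -> (forall i, (B2 <= i)%N -> (F i).2 = 0) ->
  \sum_(i \in [set: nat]) F i = (\sum_(i \in [set: nat]) (F i).1, \sum_(i \in [set: nat]) (F i).2).
Proof.
move=> h1 h2; apply: pair_fsum.
  apply: (sub_finite_set (B := `I_B1)) => // i /= [_ n]; rewrite ltnNge; apply/negP => /h1; exact: n.
apply: (sub_finite_set (B := `I_B2)) => // i /= [_ n]; rewrite ltnNge; apply/negP => /h2; exact: n.
Qed.

End PairSums.

Section Truncation.
Variables (R : realType) (A : vertex_superalgebra R) (V : gen_module A).

Lemma act_trunc (a : A) (y : R[i]) (v : V) :
  exists B : nat, forall i, (B <= i)%N -> gm_act a (y + i%:R) v = 0.
Proof.
have [_ _ tr] := gm_field V a; have [N HN] := tr y v.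
by exists `|N|%N => i Bi; apply: (HN i%:Z); lia.
Qed.

Lemma NP_trunc xa xb (a b : A) l (n : int) x (v : V) : vs_par xa a -> vs_par xb b ->
  exists B : nat, forall j, (B <= j)%N ->
    NP (psign R xa xb) l (n + j%:Z) (@gm_act _ _ V a) (@gm_act _ _ V b) (x + l - j%:R) v = 0.
Proof.
move=> pa pb; have [N HN] := local_dif (gm_local V pa pb).
exists (N + absz n)%N => j Bj; have -> : n + j%:Z = (absz (n + j%:Z))%:Z by lia.
by rewrite NP_nat HN //; lia.
Qed.

(** A class l contributes only if [a] has a nonzero mode in - l + Z, and a field has finitely many
    classes. *)
Lemma NP_classes (a b : A) s n x (v : V) :
  finite_set [set l : R[i] | class_rep l /\
    \sum_(j \in [set: nat]) gbin l j *: NP s l (n + j%:Z) (@gm_act _ _ V a) (@gm_act _ _ V b) (x + l - j%:R) v <> 0].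
Proof.
have [_ [cl clP] _] := gm_field V a.
have /choice[rep repP] : forall c : R[i], exists l, class_rep l /\ isint (c + l).
  by move=> c; have [l lc ci] := class_rep_ex c; exists l.
apply: (sub_finite_set (B := rep @` [set` cl])); last exact/finite_image/finite_seq.
move=> l /= [lc nz].
have [k [w nw]] : exists (k : int) (w : V), gm_act a (k%:~R - l) w <> 0.
  apply: contrapT => h; apply: nz; rewrite fsbig1 // => j _.
  have a0 (k : int) (w : V) : gm_act a (k%:~R - l) w = 0.
    by apply: contrapT => nw; apply: h; exists k, w.
  rewrite /NP !fsbig1 ?subrr ?scaler0 ?subr0 ?scaler0 // => i _.
    by rewrite -[i%:R]/((i%:Z)%:~R) a0 (lin0 (act_lin _ _)) scaler0.
  by rewrite -[i%:R]/((i%:Z)%:~R) -mulrzBr a0 scaler0.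
have [c cc ci] := clP _ _ nw; exists c => //.
have [rc ri] := repP c; apply: class_rep_uniq => //.
have -> : rep c - l = (c + rep c) + (k%:~R - l - c) - k%:~R by ring.
by apply: isintD; [exact: isintD|apply: isintN; exact: isint_int].
Qed.

End Truncation.

Section ProductModule.
Variables (R : realType) (A : vertex_superalgebra R) (V1 V2 : gen_module A).
Local Notation V := (V1 * V2)%type.

Definition pact (a : A) (n : R[i]) (v : V) : V := (gm_act a n v.1, gm_act a n v.2).

Lemma pact_field a : in_FF (pact a).
Proof.
have [l1 [s1 H1] t1] := gm_field V1 a; have [l2 [s2 H2] t2] := gm_field V2 a; split.
- by move=> n c u v; rewrite /pact l1 l2.
- exists (s1 ++ s2) => n v nz.
  case: (pselect (gm_act a n v.1 = 0)) => [e1|n1]; last first.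
    by have [l ls li] := H1 _ _ n1; exists l; rewrite // mem_cat ls.
  case: (pselect (gm_act a n v.2 = 0)) => [e2|n2]; last first.
    by have [l ls li] := H2 _ _ n2; exists l; rewrite // mem_cat ls orbT.
  by case: nz; rewrite /pact e1 e2.
- move=> l v; have [N1 h1] := t1 l v.1; have [N2 h2] := t2 l v.2.
  exists (Num.max N1 N2) => j; rewrite ge_max => /andP[j1 j2].
  by rewrite /pact h1 // h2.
Qed.

Lemma pact_linear (c : R[i]) (a b : A) n v : pact (c *: a + b) n v = c *: pact a n v + pact b n v.
Proof. by rewrite /pact !gm_linear. Qed.

Lemma local_eq_ge (W : gen_module A) s (a b : A) N :
  (forall l T (v : W) q, iter N dif (cmt s l (@gm_act _ _ W a) (@gm_act _ _ W b) T v) q = 0) ->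
  forall m n (v : W), \sum_(i < N.+1) ((-1) ^+ i * ('C(N, i))%:R) *:
      (gm_act a (m + i%:R) (gm_act b (n + (N - i)%:R) v)
       - s *: gm_act b (n + (N - i)%:R) (gm_act a (m + i%:R) v)) = 0.
Proof.
move=> H m n v; have := H (- m) (n + N%:R + m) v 0; rewrite iter_difE.
move=> /(congr1 (fun u => (-1) ^+ N *: u)); rewrite scaler0 scaler_sumr => e.
rewrite -[RHS]e; apply: eq_bigr => i _; have le_iN : (i <= N)%N by rewrite -ltnS.
rewrite scalerA mulrA -exprD addnA addnn exprD -[(-1) ^+ N.*2]signr_odd odd_double expr0 mul1r /cmt add0r opprK.
have -> : (i%:Z)%:~R + m = m + i%:R by rewrite addrC.
by have -> : n + N%:R + m - m - (i%:Z)%:~R = n + (N - i)%:R by rewrite natrB // addrK addrA.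
Qed.

Lemma pact_local x y a b : vs_par x a -> vs_par y b -> local (psign R x y) (pact a) (pact b).
Proof.
move=> pa pb; have [N1 H1] := local_dif (gm_local V1 pa pb).
have [N2 H2] := local_dif (gm_local V2 pa pb).
exists (maxn N1 N2) => m n v.
rewrite [LHS]surjective_pairing (lin_sum (@fst_lin _ V1 V2)) (lin_sum (@snd_lin _ V1 V2)) /=.
congr (_, _).
  by apply: local_eq_ge => l T w q; apply: H1; rewrite leq_maxl.
by apply: local_eq_ge => l T w q; apply: H2; rewrite leq_maxr.
Qed.

Lemma NP_pair s l n a b y (v : V) : NP s l n (pact a) (pact b) y v =
  (NP s l n (@gm_act _ _ V1 a) (@gm_act _ _ V1 b) y v.1,
   NP s l n (@gm_act _ _ V2 a) (@gm_act _ _ V2 b) y v.2).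
Proof.
have [B1 b1] := act_trunc b y v.1; have [B2 b2] := act_trunc b y v.2.
have [C1 c1] := act_trunc a (- l) v.1; have [C2 c2] := act_trunc a (- l) v.2.
rewrite /NP (pair_fsum_nat (B1 := B1) (B2 := B2)) /=.
- rewrite (pair_fsum_nat (B1 := C1) (B2 := C2)) //= => i Bi.
    by rewrite [i%:R - l]addrC c1 // (lin0 (act_lin _ _)) scaler0.
  by rewrite [i%:R - l]addrC c2 // (lin0 (act_lin _ _)) scaler0.
- by move=> i Bi; rewrite b1 // (lin0 (act_lin _ _)) scaler0.
- by move=> i Bi; rewrite b2 // (lin0 (act_lin _ _)) scaler0.
Qed.

Lemma pact_prod x y a b (n : int) k v : vs_par x a -> vs_par y b ->
  pact (vs_prod n a b) k v = nprod (psign R x y) n (pact a) (pact b) k v.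
Proof.
move=> pa pb; rewrite /pact !(gm_prod _ _ _ pa pb) !nprodE.
have E l : \sum_(j \in [set: nat]) gbin l j *:
     NP (psign R x y) l (n + j%:Z) (pact a) (pact b) (k + l - j%:R) v =
   (\sum_(j \in [set: nat]) gbin l j *: NP (psign R x y) l (n + j%:Z) (@gm_act _ _ V1 a) (@gm_act _ _ V1 b) (k + l - j%:R) v.1,
    \sum_(j \in [set: nat]) gbin l j *: NP (psign R x y) l (n + j%:Z) (@gm_act _ _ V2 a) (@gm_act _ _ V2 b) (k + l - j%:R) v.2).
  have [B1 b1] := NP_trunc l n k v.1 pa pb; have [B2 b2] := NP_trunc l n k v.2 pa pb.
  rewrite (pair_fsum_nat (B1 := B1) (B2 := B2)).
  - by congr (_, _); apply: eq_fsbigr => j _; rewrite NP_pair.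
  - by move=> j Bj; rewrite NP_pair /= b1 // scaler0.
  - by move=> j Bj; rewrite NP_pair /= b2 // scaler0.
under [RHS]eq_fsbigr do rewrite E.
by rewrite pair_fsum //; exact: NP_classes.
Qed.

Lemma pact_one n v : pact (vs_one A) n v = if n == -1 then v else 0.
Proof. by rewrite /pact !gm_one; case: ifP => // _; case: v. Qed.

Definition prodm : gen_module A :=
  GenModule pact_field pact_linear pact_local pact_prod pact_one.

End ProductModule.

(** * Isolating one eigenvector inside a stable subspace *)

Section EigenPick.
Variables (R : realType) (V : lmodType R[i]) (Q P : set V).
Hypothesis QS : subspace Q.
Hypothesis PZ : forall c x, P x -> P (c *: x).
Hypothesis P_split : forall x y, P x -> P y -> P (x + y) \/
  exists (T : V -> V), [/\ lin T, (forall u, Q u -> Q (T u)),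
    (forall z, P z -> exists c, T z = c *: z) &
    exists a b, [/\ a != b, T x = a *: x & T y = b *: y]].

Lemma scale_list (T : V -> V) (c1 c2 : R[i]) (s : seq V) : lin T ->
  (forall z, P z -> exists c, T z = c *: z) -> (forall x, x \in s -> P x) ->
  exists s', [/\ size s' = size s, (forall x, x \in s' -> P x) &
    \sum_(x <- s') x = c1 *: \sum_(x <- s) x + c2 *: T (\sum_(x <- s) x)].
Proof.
move=> TL TP; elim: s => [|x s IH] Ps.
  by exists [::]; split=> //; rewrite !big_nil (lin0 TL) !scaler0 addr0.
have [|s' [sz Ps' E]] := IH; first by move=> y ys; apply: Ps; rewrite inE ys orbT.
have [|c Tx] := TP x; first by apply: Ps; rewrite inE eqxx.
exists ((c1 + c2 * c) *: x :: s'); split=> [|y|]; first by rewrite /= sz.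
  by rewrite inE => /orP[/eqP ->|/Ps' //]; apply: PZ; apply: Ps; rewrite inE eqxx.
by rewrite !big_cons E (linD TL) Tx !scalerDr scalerDl scalerA addrACA.
Qed.

(* A nonzero sum of elements of [P] that lies in [Q] and has minimal length has one term. *)
Lemma eigen_pick (s : seq V) : (forall x, x \in s -> P x) -> Q (\sum_(x <- s) x) ->
  \sum_(x <- s) x <> 0 -> exists x, [/\ x <> 0, P x & Q x].
Proof.
move: {-1}(size s) (leqnn (size s)) => n; elim: n s => [|n IH] s.
  by rewrite leqn0 size_eq0 => /eqP -> _ _; rewrite big_nil.
case: s => [|x [|y s]] sn Ps Qs s0; first by rewrite big_nil in s0.
  by rewrite big_seq1 in Qs s0; exists x; split=> //; apply: Ps; rewrite inE eqxx.
have Px : P x by apply: Ps; rewrite inE eqxx.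
have Py : P y by apply: Ps; rewrite !inE eqxx orbT.
have Ps' z : z \in s -> P z by move=> zs; apply: Ps; rewrite !inE zs !orbT.
rewrite !big_cons in Qs s0.
case: (P_split Px Py) => [Pxy|[T [TL TQ TP [a [b [ab Tx Ty]]]]]].
  apply: (IH ((x + y) :: s)); rewrite ?big_cons -?addrA // => z.
  by rewrite inE => /orP[/eqP -> //|]; exact: Ps'.
set q := x + _ in Qs s0.
have ba : b - a != 0 by rewrite subr_eq0 eq_sym.
have [s1 [sz1 P1 E1]] := scale_list (- a) 1 TL TP Ps'.
have Eq : (b - a) *: y + \sum_(z <- s1) z = T q - a *: q.
  rewrite E1 /q !(linD TL) Tx Ty !scalerDr scalerBl scaleNr scale1r !opprD.
  by rewrite [RHS]addrACA subrr add0r [RHS]addrACA; congr (_ + _); exact: addrC.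
(* The vector [T q - a *: q] lies in [Q] and no longer involves [x]. If it is nonzero, it is a
   shorter sum; if it is zero, [y] is a combination of the remaining terms and can be eliminated
   from [q]. *)
case: (pselect (T q - a *: q = 0)) => [q0|q0]; last first.
  apply: (IH ((b - a) *: y :: s1)); rewrite ?big_cons ?Eq //.
  - by rewrite /= sz1.
  - by move=> z; rewrite inE => /orP[/eqP ->|]; [exact: PZ|exact: P1].
  - by apply: (subB QS); [exact: TQ|exact: (subZ QS)].
have yE : y = - (b - a)^-1 *: \sum_(z <- s1) z.
  apply: (scalerI ba); rewrite scalerA mulrN divff // scaleN1r; apply/eqP.
  by rewrite -addr_eq0 Eq q0.
have [s2 [sz2 P2 E2]] := scale_list (1 - - (b - a)^-1 * a) (- (b - a)^-1) TL TP Ps'.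
have qE : q = \sum_(z <- x :: s2) z.
  rewrite big_cons /q E2; congr (_ + _); rewrite {1}yE E1 scalerDr !scalerA mulr1 scalerBl scale1r.
  by rewrite mulrN scaleNr addrC addrA.
apply: (IH (x :: s2)); rewrite -?qE //.
  by rewrite /= sz2.
by move=> z; rewrite inE => /orP[/eqP -> //|]; exact: P2.
Qed.

End EigenPick.

(** * Twisted modules over the lattice vertex superalgebra *)

Section LatticeAlgebra.
Variables (R : realType) (L : lattice_data R) (A : vertex_superalgebra R).
Local Notation h := (ld_h L).
Local Notation p := (ld_p L).
Local Notation form := (@bform R L).
Variables (tilde X : h -> A) (sigmahat : A -> A).
Hypotheses (L_ok : lattice_ok L) (A_lattice : is_lattice_vsa tilde X).
Hypothesis sigma_Lam : [set sigma L a | a in Lam L] = Lam L.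
Hypothesis sigmahat_aut : vs_automorphism sigmahat.
Hypothesis sigmahat_ext : forall a, sigmahat (tilde a) = tilde (sigma L a).

Lemma tilde_lin : lin tilde. Proof. exact: lv_tilde_linear A_lattice. Qed.

Lemma tilde_even a : vs_par false (tilde a).
Proof. exact: lv_tilde_even A_lattice a. Qed.

Lemma vs_prodl_lin n (b : A) : lin (fun a => vs_prod n a b).
Proof. by move=> c a a'; rewrite vs_prod_linl. Qed.

Lemma vs_prodr_lin n (a : A) : lin (vs_prod n a).
Proof. by move=> c b b'; rewrite vs_prod_linr. Qed.

Lemma X_par a : Lam L a -> vs_par (odd `|ipair a a|%N) (X a).
Proof. by move=> La; have [comp [_ hp hX _]] := lv_comp A_lattice; apply: hp => //; exact: hX. Qed.

Lemma tilde_tilde (n : nat) a b :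
  vs_prod n%:Z (tilde a) (tilde b) = if n == 1%N then form a b *: vs_one A else 0.
Proof. exact: lv_tilde_tilde A_lattice n a b. Qed.

Lemma tilde_X (n : nat) a b : Lam L b ->
  vs_prod n%:Z (tilde a) (X b) = if n == 0%N then form a b *: X b else 0.
Proof. exact: lv_tilde_X A_lattice n a b. Qed.

(** The Borcherds identity with its third index equal to 0: only [j = 0] survives on the right and
    [j = 1] on the left. *)
Lemma heisA_comm a b (m n : int) (v : A) :
  vs_prod m (tilde a) (vs_prod n (tilde b) v) =
  vs_prod n (tilde b) (vs_prod m (tilde a) v) +
  (if m + n == 0 then m%:~R * form a b else 0) *: v.
Proof.
have := vs_borcherds v n m 0 (tilde_even a) (tilde_even b).
have g0 (F : nat -> A) : \sum_(j \in [set: nat]) ((-1) ^+ j * gbin (0%:~R : R[i]) j) *: F j = F 0%N.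
  rewrite (fsum_single (i0 := 0%N)) //; first by rewrite expr0 mul1r gbin0 scale1r.
  by move=> [//|i] _ _; rewrite -[0%:~R]/(0%N%:R) gbin_nat bin0n mulr0 scale0r.
rewrite !g0 !addr0 add0r expr0z mul1r /psign andbF expr0 scale1r => e.
apply/eqP; rewrite addrC -subr_eq -[X in X == _]e; apply/eqP.
rewrite (fsum_single (i0 := 1%N)) //; last first.
  move=> i _ i1; rewrite add0r tilde_tilde.
  by case: eqP => // _; rewrite (lin0 (vs_prodl_lin _ _)) scaler0.
rewrite add0r tilde_tilde eqxx (linZ (vs_prodl_lin _ _)) vs_one_l gbin1 scalerA.
have -> : (m + n - 1 == -1) = (m + n == 0) by lia.
by case: ifP => _; rewrite ?scaler0 ?scale0r.
Qed.

Let opA (a : h) (n : int) : A -> A := vs_prod n (tilde a).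
Let brA (m : int) a b : R[i] := m%:~R * form a b.

Lemma heisA_dual (n : nat) b (v : A) : (0 < n)%N ->
  \sum_i brA n%:Z (dual_basis i) b *: opA (ld_basis L)`_i (- n%:Z) v = n%:R *: opA b (- n%:Z) v.
Proof.
move=> _; rewrite -[in RHS](dual_basisE b) /opA (lin_sum tilde_lin).
rewrite (lin_sum (vs_prodl_lin _ _)) scaler_sumr; apply: eq_bigr => i _.
by rewrite (linZ tilde_lin) (linZ (vs_prodl_lin _ _)) scalerA.
Qed.

Definition Xline (a : h) : set A := [set v | exists c : R[i], v = c *: X a].

Lemma Xline_vac a : Lam L a ->
  forall b (n : nat) v, (0 < n)%N -> Xline a v -> opA b n%:Z v = 0.
Proof.
move=> La b n v n0 [c ->]; rewrite /opA (linZ (vs_prodr_lin _ _)) tilde_X //.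
by rewrite gtn_eqF // scaler0.
Qed.

Lemma Fock_weight a d v b : Lam L a -> Fock opA (Xline a) d v ->
  vs_prod 0 (tilde b) v = form b a *: v.
Proof.
move=> La; elim=> {d v} [v [c ->]|d e n v n0 _ IH|d|d c u v _ IHu _ IHv].
- rewrite (linZ (vs_prodr_lin _ _)) (tilde_X 0) // !scalerA.
  by rewrite mulrC.
- rewrite /opA heisA_comm IH (linZ (vs_prodr_lin _ _)).
  by case: ifP => _; rewrite ?mul0r scale0r addr0.
- by rewrite (lin0 (vs_prodr_lin _ _)) scaler0.
- by rewrite vs_prod_linr IHu IHv scalerDr !scalerA mulrC.
Qed.

Lemma heis_monomial_Fock a B : exists d, Fock opA (Xline a) d (heis_monomial tilde X a B).
Proof.
rewrite /heis_monomial; elim: (enum_mset B) => [|q s [d IH]] /=.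
  by exists 0%N; apply: Fock_base; exists 1; rewrite scale1r.
by exists (d + q.2.+1)%N; exact: (Fock_op (op := opA)).
Qed.

Lemma Fock_le_all (op : h -> int -> A -> A) (S : set A) (I : choiceType) (D : set I) (F : I -> A) :
  (forall i, exists D, Fock_le op S D (F i)) -> exists D', Fock_le op S D' (\sum_(i \in D) F i).
Proof.
move=> hF; apply: (fsum_ind (P := fun v => exists D', Fock_le op S D' v)) => //; first by exists 0%N; exact: Fock_le0.
move=> u v [D1 F1] [D2 F2]; exists (maxn D1 D2); rewrite -[u]scale1r.
by apply: Fock_leL; [apply: Fock_le_widen F1|apply: Fock_le_widen F2]; rewrite (leq_maxl, leq_maxr).
Qed.

Lemma X_neq0 a : Lam L a -> X a <> 0.
Proof.
move=> La X0; have [comp [_ _ _ hb]] := lv_comp A_lattice.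
have [_ ind] := hb a La.
pose c (B : {mset 'I_(\dim (fullv : {vspace h})) * nat}%mset) : R[i] := if B == mset0%mset then 1 else 0.
have := ind c; rewrite (fsum_single (i0 := mset0%mset)) //; last first.
  by move=> B _ /eqP B0; rewrite /c (negbTE B0) scale0r.
have -> : heis_monomial tilde X a mset0%mset = X a by rewrite /heis_monomial enum_mset0.
rewrite X0 scaler0 => /(_ _ erefl mset0%mset) H; suff : c mset0%mset = 0.
  by rewrite /c eqxx => /eqP; rewrite oner_eq0.
apply: H; apply: (sub_finite_set (B := [set mset0%mset])); last exact: finite_set1.
by move=> B; rewrite /c /=; case: eqP.
Qed.

(** The zero modes act on the component of index b through (. | b), so nondegeneracy leaves only the
    component a; there [Fock_vacuum] leaves only degree 0. Applied to the image of X_al under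
    sigmahat, this makes it proportional to X_(sigma al). *)
Lemma vacuum_line a (Y : A) : Lam L a ->
  (forall b (n : nat), vs_prod n%:Z (tilde b) Y = if n == 0%N then form b a *: Y else 0) ->
  exists c : R[i], Y = c *: X a.
Proof.
move=> La Yvac; have [comp [ds _ _ hb]] := lv_comp A_lattice.
have [cs ex un] := ds; have [w [wc wf YE]] := ex Y.
have FL b v : Lam L b -> comp b v -> exists D, Fock_le opA (Xline b) D v.
  move=> Lb; rewrite (hb b Lb).1 => -[c [_ ->]]; apply: Fock_le_all => B.
  have [d Fd] := heis_monomial_Fock b B; exists d.+1.
  by apply: (Fock_le_of (d := d)) => //; exact: FockZ.
have wt b e : Lam L b -> vs_prod 0 (tilde e) (w b) = form e b *: w b.
  move=> Lb; have [D [x Fx ->]] := FL b _ Lb (wc b Lb).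
  rewrite (lin_sum (vs_prodr_lin _ _)) scaler_sumr; apply: eq_bigr => d _.
  exact: Fock_weight Lb (Fx d).
have [r [ur rP rE]] := fsum_supp_seq wf.
have w0 b : Lam L b -> b <> a -> w b = 0.
  move=> Lb ba; apply: contrapT => wb0; apply: ba; apply/eqP; rewrite -subr_eq0; apply/eqP.
  apply: form_nondeg => e; apply/eqP.
  have := un (fun b => (form e b - form e a) *: w b).
  have -> : \sum_(b \in Lam L) (form e b - form e a) *: w b = 0.
    rewrite (fsum_seq (r := r)) //.
    - under eq_bigr do rewrite scalerBl.
      rewrite sumrB -scaler_sumr -rE -YE.
      have := Yvac e 0%N; rewrite /= => e0; apply/eqP; rewrite subr_eq0 -[X in _ == X]e0; apply/eqP.
      rewrite [in RHS]YE rE (lin_sum (vs_prodr_lin _ _)) big_seq [RHS]big_seq; apply: eq_bigr => i ir.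
      by rewrite wt //; case/rP: ir.
    - by move=> i /rP[].
    - move=> i Li; apply: contraNeq => h0; apply/rP; split=> // wi0.
      by rewrite wi0 scaler0 eqxx in h0.
  move=> /(_ _ _ erefl b Lb) H; have : (form e b - form e a) *: w b = 0.
    apply: H.
      by move=> i Li; apply: (subZ (cs i Li)); exact: wc.
    apply: sub_finite_set wf => i /= [Li h0]; split=> // wi0.
    by apply: h0; rewrite wi0 scaler0.
  move/eqP; rewrite scaler_eq0 => /orP[|/eqP //].
  by rewrite subr_eq0 bformDl bformNl subr_eq0 !(bformC e).
have YL : Y = w a by rewrite YE (fsum_single (i0 := a)).
have [D FY] : exists D, Fock_le opA (Xline a) D Y by apply: FL => //; rewrite YL; exact: wc.
have := @Fock_vacuum _ _ _ opA brA _ (fun i => (ld_basis L)`_i) (@dual_basis _ L) _ _ heisA_dual (Xline a) (Xline_vac La) D Y.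
apply.
- by move=> b n; exact: vs_prodr_lin.
- by move=> b e m n v; exact: heisA_comm.
- by exists 0; rewrite scale0r.
- by move=> c _ _ [x ->] [y ->]; exists (c * x + y); rewrite scalerDl scalerA.
- exact: FY.
- by move=> b n n0; rewrite /opA Yvac gtn_eqF.
Qed.

Lemma sigma_p a : iter p (sigma L) a = a.
Proof.
apply: lproj_inj => k kp; rewrite lproj_iter_sigma // exp2piiX_frac ?p_gt0 //.
by rewrite (exp2pii_int R k%:Z) scale1r.
Qed.

Lemma sigma_onto a : exists b, a = sigma L b.
Proof.
exists (iter p.-1 (sigma L) a).
by rewrite -iterS prednK ?p_gt0 // sigma_p.
Qed.

Lemma sigmahat_lin : lin sigmahat.
Proof. exact: vsaut_linear sigmahat_aut. Qed.

Lemma sigmahat_X a : Lam L a -> exists2 f : R[i], f != 0 & sigmahat (X a) = f *: X (sigma L a).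
Proof.
move=> La; have [|f fE] := @vacuum_line (sigma L a) (sigmahat (X a)) (Lam_sigma sigma_Lam La).
  move=> b n; have [b' ->] := sigma_onto b.
  rewrite -sigmahat_ext -(vsaut_prod sigmahat_aut) tilde_X // form_sigma.
  by case: eqP => _; [exact: (linZ sigmahat_lin)|exact: (lin0 sigmahat_lin)].
exists f => //; apply/eqP => f0; apply: (X_neq0 La).
apply: (bij_inj (vsaut_bij sigmahat_aut)).
by rewrite fE f0 scale0r (lin0 sigmahat_lin).
Qed.

Lemma iter_sigmahat_X a m : Lam L a ->
  exists2 f : R[i], f != 0 & iter m sigmahat (X a) = f *: X (iter m (sigma L) a).
Proof.
move=> La; elim: m => [|m [f f0 IH]]; first by exists 1; rewrite ?oner_eq0 ?scale1r.
have [g g0 gE] := sigmahat_X (Lam_iter_sigma sigma_Lam m La).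
by exists (f * g); rewrite ?mulf_neq0 //= IH (linZ sigmahat_lin) gE scalerA.
Qed.

(** * The Heisenberg action on a twisted module *)

Section TwistedModule.
Variable V : gen_module A.
Hypothesis V_tw : twisted sigmahat V.

(** As sigma^p = 1, the p-th iterate of sigmahat multiplies X_a by a scalar, so X_a is a sum of
    eigenvectors. One with eigenvalue exp(2 pi i l) acts only through modes n in l + Z, for which
    exp(2 pi i n) is that eigenvalue. *)
Lemma act_sigmahat_X a n (v : V) : Lam L a ->
  gm_act (sigmahat (X a)) n v = exp2pii n *: gm_act (X a) n v.
Proof.
move=> La; have [f f0 fE] := iter_sigmahat_X p La.
have [l lE] := exp2pii_surj f0; rewrite sigma_p -lE in fE.
have [w [XE we _]] := eigen_split (p_gt0 L) sigmahat_lin fE.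
rewrite XE (lin_sum sigmahat_lin) !(lin_sum (act_lin_l n v)) scaler_sumr.
apply: eq_bigr => j _; rewrite we (linZ (act_lin_l n v)).
case: (pselect (gm_act (w j) n v = 0)) => [->|h0]; first by rewrite !scaler0.
congr (_ *: _); have [k kE] := V_tw (we j) h0.
by rewrite -[in RHS](subrK ((l + j%:R) / p%:R) n) exp2piiD kE exp2pii_int mul1r.
Qed.

Lemma tilde_class k a : (k < p)%N -> a \in ld_part L k ->
  of_class (k%:R / p%:R) (@gm_act _ _ V (tilde a)).
Proof.
move=> kp ak; apply: V_tw; rewrite sigmahat_ext (sigma_part kp ak).
exact: (linZ tilde_lin).
Qed.

Lemma heis_lin a n : lin (heis tilde (V := V) a n).
Proof. exact: act_lin. Qed.

Lemma heis_lin_l n (v : V) : lin (fun a => heis tilde a n v).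
Proof. by move=> c a b; rewrite /heis linearP tilde_lin gm_linear. Qed.

Lemma heis_cproj a n (v : V) : heis tilde (cproj L n a) n v = heis tilde a n v.
Proof. by rewrite /heis cproj_cproj. Qed.

Lemma heis_act_comm (a : h) (m : int) (y : bool) (b : A) x (v : V) :
  vs_par y b -> (forall n : nat, (2 <= n)%N -> vs_prod n%:Z (tilde (cproj L m a)) b = 0) ->
  heis tilde a m (gm_act b x v) = gm_act b x (heis tilde a m v) +
    (gm_act (vs_prod 0 (tilde (cproj L m a)) b) (m%:~R / p%:R + x) v +
     (m%:~R / p%:R) *: gm_act (vs_prod 1 (tilde (cproj L m a)) b) (m%:~R / p%:R + x - 1) v).
Proof.
move=> pb b0; have [k [q [kp mE]]] := cproj_ex L m.
have ck : cproj L m a \in ld_part L k by rewrite (cprojE kp) ?lproj_mem //; exists q.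
have [l lc ll] := class_rep_ex (k%:R / p%:R : R[i]).
rewrite /heis; have := act_comm (M := V) (tilde_even _) pb (tilde_class kp ck) lc ll b0.
move=> /(_ (m%:~R / p%:R) x v); rewrite /psign /= expr0 scale1r => <-; first by rewrite addrC subrK.
exists q; rewrite mE intrD intrM -[k%:~R]/(k%:R) -[(p%:Z)%:~R]/(p%:R) -mulrBl addrAC subrr add0r.
by rewrite mulfK ?p_neq0.
Qed.

Definition brV (m : int) a b : R[i] := m%:~R / p%:R * form (cproj L m a) b.

Lemma heis_comm a b (m n : int) (v : V) :
  heis tilde a m (heis tilde b n v) = heis tilde b n (heis tilde a m v) +
  (if m + n == 0 then brV m a b else 0) *: v.
Proof.
rewrite {2}/heis (heis_act_comm _ _ (tilde_even _)); last first.
  by move=> [|[|k]] //; rewrite tilde_tilde.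
congr (_ + _).
rewrite (tilde_tilde 0) (tilde_tilde 1) /=.
rewrite (lin0 (act_lin_l _ _)) add0r (linZ (act_lin_l _ _)) gm_one.
have -> : (m%:~R / p%:R + n%:~R / p%:R - 1 == -1 :> R[i]) = (m + n == 0).
  rewrite -[X in _ == X]add0r -subr_eq opprK subrK -mulrDl -intrD mulf_eq0 invr_eq0.
  by rewrite (negbTE (p_neq0 L)) orbF intr_eq0.
case: eqP => [mn0|_]; last by rewrite !scaler0 scale0r.
rewrite scalerA /brV; congr (_ * _ *: _).
have -> : n = - m by lia.
by rewrite -form_cproj cproj_cproj.
Qed.

Lemma heis_X a (m : int) b x (v : V) : Lam L b ->
  heis tilde a m (gm_act (X b) x v) = gm_act (X b) x (heis tilde a m v) +
    form (cproj L m a) b *: gm_act (X b) (m%:~R / p%:R + x) v.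
Proof.
move=> Lb; rewrite (heis_act_comm _ _ (X_par Lb)); last first.
  by move=> [|[|k]] //; rewrite tilde_X.
rewrite (tilde_X 0) // (tilde_X 1) //=.
by rewrite (linZ (act_lin_l _ _)) (lin0 (act_lin_l _ _)) scaler0 addr0.
Qed.

(** The factor p in the dual family cancels the denominator p of [brV]. *)
Lemma heis_dual (n : nat) b (v : V) : (0 < n)%N ->
  \sum_i brV n%:Z (p%:R *: dual_basis i) b *: heis tilde (ld_basis L)`_i (- n%:Z) v =
  n%:R *: heis tilde b (- n%:Z) v.
Proof.
move=> _; rewrite -[in RHS]heis_cproj -[cproj L _ b in RHS](dual_basisE (cproj L (- n%:Z) b)).
rewrite (lin_sum (heis_lin_l _ _)) scaler_sumr; apply: eq_bigr => i _.
rewrite (linZ (heis_lin_l _ _)) scalerA; congr (_ *: _).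
by rewrite /brV linearZ /= bformZl form_cproj mulrA divfK ?p_neq0.
Qed.

Lemma act_tilde x : (exists n, forall a (v : V), gm_act (tilde a) x v = heis tilde a n v) \/
  (forall a (v : V), gm_act (tilde a) x v = 0).
Proof.
have E a (v : V) : gm_act (tilde a) x v = \sum_(0 <= k < p) gm_act (tilde (lproj L k a)) x v.
  by rewrite -{1}(sum_lproj a) (lin_sum tilde_lin) (lin_sum (act_lin_l _ _)).
case: (pselect (exists n : int, x = n%:~R / p%:R)) => [[n xE]|nx].
  left; exists n => a v; rewrite E /heis -xE.
  have [k [q [kp nE]]] := cproj_ex L n.
  rewrite big_mkord (bigD1 (Ordinal kp)) //= big1 ?addr0; first by rewrite (cprojE kp) //; exists q.
  move=> j jk; apply: contrapT => /(tilde_class (ltn_ord j) (lproj_mem j a))[s].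
  rewrite xE -mulrBl => /(canRL (divfK (p_neq0 L))) e.
  have : (n - j%:Z)%:~R = (s * p%:Z)%:~R :> R[i] by rewrite intrM intrD mulrNz.
  move/intr_inj => e'; case/eqP: jk; apply: val_inj => /=.
  have lj := ltn_ord j; have : (p%:Z %| j%:Z - k%:Z)%Z by apply/dvdzP; exists (q - s); lia.
  rewrite -eqz_mod_dvd !modz_small ?lez_nat ?ltz_nat ?lj ?kp // => /eqP; lia.
right=> a v; rewrite E big_nat big1 // => k /= kp; apply: contrapT.
move=> /(tilde_class kp (lproj_mem k a))[s e]; apply: nx; exists (k%:Z + s * p%:Z).
by rewrite -[LHS](subrK (k%:R / p%:R)) e intrD intrM mulrDl mulfK ?p_neq0 // addrC.
Qed.

End TwistedModule.

Definition ev (mu : h0_dual L) (a : h) : R[i] := mu (vsproj (ld_part L 0) (lproj L 0 a)).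

Lemma evD mu a b : ev mu (a + b) = ev mu a + ev mu b.
Proof. by rewrite /ev !linearD. Qed.

Lemma ev_add mu nu a : ev (mu + nu) a = ev mu a + ev nu a.
Proof. by rewrite /ev add_lfunE. Qed.

Lemma ev_val mu (u : subvs_of (ld_part L 0)) : ev mu (vsval u) = mu u.
Proof.
rewrite /ev (lproj_part (k := 0)) ?p_gt0 ?subvsP //= ; congr (mu _).
by apply: val_inj; rewrite /= vsprojK ?subvsP.
Qed.

Lemma ev_inj mu nu : (forall a, ev mu a = ev nu a) -> mu = nu.
Proof. by move=> e; apply/lfunP => u; rewrite -!ev_val. Qed.

Lemma ev_lproj0 mu a : ev mu (lproj L 0 a) = ev mu a.
Proof. by rewrite /ev lproj_lproj ?p_gt0. Qed.

Definition flat_fun (al : h) (u : subvs_of (ld_part L 0)) : R[i]^o := form (vsval u) al.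

Lemma flat_fun_linear al : linear (flat_fun al).
Proof. by move=> c u v; rewrite /flat_fun linearP bformDl bformZl. Qed.

HB.instance Definition _ al :=
  GRing.isLinear.Build R[i] (subvs_of (ld_part L 0)) R[i]^o _ (flat_fun al) (flat_fun_linear al).

(** By [heis_X] this is the shift of weight under every mode of X_al. *)
Definition flat (al : h) : h0_dual L := linfun (flat_fun al).

Lemma ev_flat al a : ev (flat al) a = form (lproj L 0 a) al.
Proof. by rewrite /ev lfunE /= /flat_fun vsprojK ?lproj_mem. Qed.

Lemma flatD al be : flat (al + be) = flat al + flat be.
Proof. by apply: ev_inj => a; rewrite ev_add !ev_flat bformDr. Qed.

Lemma flat_eq0 al : lproj L 0 al = 0 -> flat al = 0.
Proof.
move=> h0; apply: ev_inj => a; rewrite ev_flat (form_lproj (l := 0)) ?p_gt0 ?dvdn0 //.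
by rewrite h0 bformC bform0l /ev zero_lfunE.
Qed.

Lemma flatN al : flat (- al) = - flat al.
Proof.
apply/eqP; rewrite -addr_eq0 -flatD addNr; apply/eqP/flat_eq0.
by rewrite linear0.
Qed.

(* Equal to (1/2)((al^[0]|al^[0]) - (al|al)), by the symmetry of the pairing of the
   components of classes k and p - k; comes from normally ordering al~_(-1) X_al. *)
Definition shift (al : h) : R[i] := - \sum_(0 <= k < p) (k%:R / p%:R) * form (lproj L k al) al.

(** The index y at which the scalar terms of D X_al = al~_(-1) X_al on [Om mu] balance, that is, -
    (y + 1) = mu(al) + shift al. The leading coefficient sits there. *)
Definition top (mu : h0_dual L) (al : h) : R[i] := - 1 - ev mu al - shift al.

(** The classes k and p - k are paired; their factors k/p and (p - k)/p add up to 1. The mixed terms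
    thus give minus the sum of (al^[k/p] | be) over 1 <= k < p, in which only the class 0 is missing
    from (al | be). *)
Lemma shiftD al be :
  shift (al + be) = shift al + shift be + form (lproj L 0 al) be - form al be.
Proof.
have p0 := p_neq0 L.
pose f k := form (lproj L k al) be.
have E k : (0 < k < p)%N -> form (lproj L k be) al = f (p - k)%N.
  move=> /andP[k0 kp]; rewrite /f bformC; apply/esym/form_lproj => //.
    by rewrite ltn_subrL k0 p_gt0.
  by rewrite subnK // ltnW.
have S : \sum_(1 <= k < p) (k%:R / p%:R) * f (p - k)%N = \sum_(1 <= k < p) ((p - k)%:R / p%:R) * f k.
  rewrite big_nat_rev big_nat [RHS]big_nat; apply: eq_bigr => k /andP[k1 kp].
  have -> : (1 + p - k.+1 = p - k)%N by lia.
  by rewrite subKn // ltnW.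
have F : form al be = f 0%N + \sum_(1 <= k < p) f k.
  rewrite -{1}(sum_lproj al) form_suml big_ltn ?p_gt0 //.
rewrite /shift.
have -> : \sum_(0 <= k < p) k%:R / p%:R * form (lproj L k (al + be)) (al + be) =
  \sum_(0 <= k < p) k%:R / p%:R * form (lproj L k al) al +
  \sum_(0 <= k < p) k%:R / p%:R * form (lproj L k be) be + \sum_(1 <= k < p) f k.
  have -> : \sum_(1 <= k < p) f k =
      \sum_(0 <= k < p) k%:R / p%:R * (f k + form (lproj L k be) al).
    rewrite [RHS]big_ltn ?p_gt0 // mul0r mul0r add0r.
    under [RHS]eq_bigr do rewrite mulrDr; rewrite big_split /=.
    under [X in _ = _ + X]eq_big_nat => k kp do rewrite E //.
    rewrite S -big_split /= big_nat [RHS]big_nat; apply: eq_bigr => k /andP[k1 kp].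
    by rewrite -mulrDl -mulrDl -natrD subnKC ?divff ?mul1r // ltnW.
  rewrite -!big_split /=; apply: eq_bigr => k _.
  by rewrite linearD /= bformDl !bformDr /f; ring.
rewrite F /f; ring.
Qed.

(** For n = - (al | be) - 1, this matches the mode [top mu (al + be)] of X_al_(n) X_be with the
    total index of U_al U_be. *)
Lemma top_add mu al be :
  top (mu + flat be) al + top mu be = top mu (al + be) - form al be - 1.
Proof.
by rewrite /top shiftD evD ev_add ev_flat; ring.
Qed.

Lemma top_sym mu al be :
  top (mu + flat be) al + top mu be = top (mu + flat al) be + top mu al.
Proof. by rewrite !top_add addrC [in RHS]bformC [in RHS](addrC be) addrC. Qed.

Lemma shift0 : shift 0 = 0.
Proof. by rewrite /shift big1 ?oppr0 // => k _; rewrite linear0 bform0l mulr0. Qed.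

Lemma ev0 mu : ev mu 0 = 0.
Proof. by rewrite /ev !linear0. Qed.

Lemma top0 mu : top mu 0 = - 1.
Proof. by rewrite /top shift0 ev0 !subr0. Qed.

Definition Om (V : gen_module A) (mu : h0_dual L) : set V :=
  [set v | vacuum_space tilde v /\ weight_space tilde mu v].

(* On [Om mu], the coefficients of X_al vanish outside top mu al - N / p. *)
Definition Uop (V : gen_module A) (mu : h0_dual L) (al : h) (v : V) : V :=
  gm_act (X al) (top mu al) v.
Arguments Om : clear implicits.
Arguments Uop {V}.

(** Every positive integer is p (i + 1) - k for exactly one i >= 0 and one 0 <= k < p, so the
    classes k share out the creation modes. *)
Lemma sum_strides (V : zmodType) (F : nat -> V) B :
  \sum_(0 <= k < p) \sum_(i < B) F (p * i.+1 - k)%N = \sum_(n < p * B) F n.+1.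
Proof.
rewrite exchange_big /=; elim: B => [|B IH]; first by rewrite muln0 !big_ord0.
rewrite big_ord_recr /= IH mulnS addnC -!(big_mkord xpredT (fun n => F n.+1)).
rewrite [RHS](big_cat_nat (n := (p * B)%N)) ?leq_addr //=; congr (_ + _).
rewrite -{2}[(p * B)%N]add0n big_addn addnC addnK big_nat_rev /= add0n.
rewrite big_nat [RHS]big_nat; apply: eq_bigr => k /= kp.
by congr F; lia.
Qed.

Lemma sum_ord_trunc (V : zmodType) (F : nat -> V) N M : (N <= M)%N ->
  (forall n, (N <= n)%N -> F n = 0) -> \sum_(n < M) F n = \sum_(n < N) F n.
Proof.
move=> NM F0; rewrite -!(big_mkord xpredT F) [LHS](big_cat_nat (leq0n N) NM) /=.
rewrite [X in _ + X](_ : _ = 0) ?addr0 // big_nat big1 // => n /andP[Nn _]; exact: F0.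
Qed.

(** * The fields X_al on vacuum vectors and the operators U_al *)

Section VacuumVectors.
Variable V : gen_module A.
Hypothesis V_tw : twisted sigmahat V.
Local Notation hs := (heis tilde (V := V)).
Implicit Type v : V.

Lemma OmP mu v : Om V mu v <->
  (forall a (n : nat), (0 < n)%N -> hs a n%:Z v = 0) /\ (forall a, hs a 0 v = ev mu a *: v).
Proof.
split=> [[vac wt]|[vac wt]]; split.
- by move=> a n n0; apply: vac.
- move=> a; rewrite -(heis_cproj a 0) (cprojE (k := 0%N) (p_gt0 L)); last by exists 0; rewrite mul0r.
  by have := wt (vsproj (ld_part L 0) (lproj L 0 a)); rewrite vsprojK ?lproj_mem.
- by move=> a [n|//] n0; exact: vac.
- by move=> u; rewrite wt ev_val.
Qed.

Lemma Om_subspace mu : subspace (Om V mu).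
Proof.
split; first by apply/OmP; split=> [a n _|a]; rewrite (lin0 (heis_lin _ _)) ?scaler0.
move=> c u v /OmP[u1 u2] /OmP[v1 v2]; apply/OmP; split=> [a n n0|a]; rewrite heis_lin.
  by rewrite u1 // v1 // scaler0 addr0.
by rewrite u2 v2 scalerDr !scalerA mulrC.
Qed.

Lemma Uop_lin mu al : lin (@Uop V mu al).
Proof. exact: act_lin. Qed.

(** A field is truncated on each class modulo Z separately; the progression y + n/p meets p classes,
    and the largest bound serves for all. *)
Lemma X_trunc b y v : exists N, forall n, (N <= n)%N -> gm_act (X b) (y + n%:R / p%:R) v = 0.
Proof.
have [_ _ tr] := gm_field V (X b).
have H (t : nat) : exists N : nat, forall j : nat, (N <= j)%N ->
    gm_act (X b) (y + t%:R / p%:R + j%:R) v = 0.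
  have [N HN] := tr (y + t%:R / p%:R) v; exists `|N|%N => j Nj.
  by apply: (HN j%:Z); lia.
have [Nf HN] := choice H.
exists (p * (\max_(t < p) Nf t).+1)%N => n nN.
rewrite (divn_eq n p) natrD natrM mulrDl mulfK ?p_neq0 // addrA addrAC.
have tp : (n %% p < p)%N by rewrite ltn_mod p_gt0.
apply: (HN (n %% p)%N (n %/ p)%N).
have h1 : (\max_(t < p) Nf t < n %/ p)%N by rewrite leq_divRL ?p_gt0 // mulnC.
exact: leq_trans (leq_bigmax (Ordinal tp)) (ltnW h1).
Qed.

Section Weight.
Variables (mu : h0_dual L) (al : h).
Hypothesis al_Lam : Lam L al.

(** The share of the class k in al~_(-1) X_al on a vacuum vector. Of the normally ordered product
    there remain the creation modes, moved to the left of X_al, and a multiple of the coefficient at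
    [y]. *)
Let field_part k B y v : Om V mu v -> (k < p)%N -> (0 < B)%N ->
  (forall n, (p * B <= n)%N -> gm_act (X al) (y + n%:R / p%:R) v = 0) ->
  gm_act (vs_prod (-1) (tilde (lproj L k al)) (X al)) (y + 1) v =
  \sum_(i < B) hs al (- (p * i.+1 - k)%N%:Z) (gm_act (X al) (y + (p * i.+1 - k)%N%:R / p%:R) v)
  + ((if k == 0%N then ev mu al else 0) - k%:R / p%:R * form (lproj L k al) al) *: gm_act (X al) y v.
Proof.
move=> /OmP[vac wt] kp B0 X0; have p0 := p_neq0 L.
set a := lproj L k al.
pose l : R[i] := if k == 0%N then 0 else 1 - k%:R / p%:R.
have lc : class_rep l.
  rewrite /l; case: (posnP k) => [_|k0]; first by rewrite /class_rep /=; split; rewrite ?ltr01.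
  have -> : (1 - k%:R / p%:R : R[i]) = ((1 - k%:R / p%:R : R)%:C)%C.
    by rewrite rmorphB rmorph1 fmorph_div !rmorph_nat.
  have pR : (0 : R) < p%:R by rewrite ltr0n p_gt0.
  split=> /=; first by rewrite subr_ge0 ler_pdivrMr // mul1r ler_nat ltnW.
  by rewrite gtrBl divr_gt0 // ltr0n.
have ll : isint (k%:R / p%:R + l).
  rewrite /l; case: (posnP k) => [->|k0]; first by rewrite mul0r addr0; exists 0.
  by rewrite addrC subrK; exists 1.
have ac := tilde_class V_tw kp (lproj_mem k al).
have aX n : (1 <= n)%N -> vs_prod n%:Z (tilde a) (X al) = 0.
  by case: n => // n _; rewrite tilde_X.
have aX2 n : (2 <= n)%N -> vs_prod n%:Z (tilde a) (X al) = 0.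
  by move=> n2; apply: aX; exact: ltnW.
rewrite (act_prodN1 (tilde_even a) (X_par al_Lam) ac lc ll aX2 _ _ (aX 1%N isT)).
rewrite (tilde_X 0) //= (linZ (act_lin_l _ _)) addrK.
have cpE (q : int) : cproj L (k%:Z + q * p%:Z) al = a by rewrite (cprojE kp) //; exists q.
have hkE (q : int) w : gm_act (tilde a) (q%:~R + k%:R / p%:R) w = hs al (k%:Z + q * p%:Z) w.
  rewrite /heis cpE; congr gm_act; rewrite intrD intrM -[k%:~R]/(k%:R) -[(p%:Z)%:~R]/(p%:R).
  by field.
have posE (q : int) : (0 < k%:Z + q * p%:Z) -> gm_act (tilde a) (q%:~R + k%:R / p%:R) v = 0.
  by rewrite hkE; case: (k%:Z + _) => // n n0; exact: vac.
have lE : l = (k != 0%N)%:R - k%:R / p%:R.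
  by rewrite /l; case: (posnP k) => [->|k0]; rewrite ?mul0r ?subr0 //= gtn_eqF.
have a0 i : (0 < i)%N -> gm_act (tilde a) (i%:R - l) v = 0.
  move=> i0; have -> : i%:R - l = (i%:Z - (k != 0%N)%:Z)%:~R + k%:R / p%:R.
    by rewrite lE intrD mulrNz -[i%:~R]/(i%:R) -[(_ != _)%:~R]/((k != 0%N)%:R); ring.
  by apply: posE; case: (k) i i0 kp => [|k'] [|i] //= _ kp'; nia.
have strideE i : (p * i.+1 - k)%N%:R / p%:R = i.+1%:R - k%:R / p%:R :> R[i].
  rewrite natrB ?natrM ?mulrBl ?[p%:R * _]mulrC ?mulfK //.
  by rewrite (leq_trans (ltnW kp)) // leq_pmulr.
pose G i := hs al (- (p * i.+1 - k)%N%:Z) (gm_act (X al) (y + (p * i.+1 - k)%N%:R / p%:R) v).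
have kle i : (k <= p * i.+1)%N by rewrite (leq_trans (ltnW kp)) // leq_pmulr.
have firstE i : gm_act (tilde a) (- 1 - i%:R - l) (gm_act (X al) (y + 1 + l + i%:R) v) =
    G (i + (k != 0))%N.
  have -> : - 1 - i%:R - l = (- (i%:Z + 1 + (k != 0%N)%:Z))%:~R + k%:R / p%:R.
    by rewrite lE mulrNz !intrD -[i%:~R]/(i%:R) -[(_ != _)%:~R]/((k != 0%N)%:R); ring.
  rewrite hkE /G; congr (hs al _ (gm_act _ _ v)); first by have := kle (i + (k != 0%N))%N; lia.
  by rewrite strideE -natr1 natrD lE; ring.
have G0 i : (B <= i)%N -> G i = 0.
  move=> Bi; rewrite /G X0 ?(lin0 (heis_lin _ _)) //.
  rewrite leq_subRL // -{1}[B]addn0; nia.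
(* For k > 0 the mode of index - l = k/p - 1 is a creation mode on the wrong side. Commuting it past
   X_al costs - (a | al), which together with the correction l = 1 - k/p of [act_prodN1] leaves -
   (k/p) (a | al). For k = 0 it is the zero mode, acting through mu. *)
have secE : gm_act (X al) (y + 1 + l - 1 - 0%N%:R) (gm_act (tilde a) (0%N%:R - l) v) =
    (if k == 0%N then 0 else G 0%N) +
    ((if k == 0%N then ev mu al else 0) - (k != 0%N)%:R * form a al) *: gm_act (X al) y v.
  have -> : 0%N%:R - l = (- (k != 0%N)%:Z)%:~R + k%:R / p%:R.
    by rewrite lE mulrNz -[(_ != _)%:~R]/((k != 0%N)%:R); ring.
  rewrite hkE; have -> : y + 1 + l - 1 - 0%N%:R = y + l by ring.
  case: (posnP k) => [k0|k0].
    have -> : l = 0 by rewrite /l k0.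
    rewrite (_ : hs al _ v = hs al 0 v); last by congr (hs al _ v); lia.
    by rewrite wt (linZ (act_lin _ _)) /= addr0 add0r mul0r subr0.
  rewrite (_ : hs al _ v = hs al (- (p * 1 - k)%N%:Z) v); last by congr (hs al _ v); lia.
  have := heis_X V_tw al (- (p * 1 - k)%N%:Z) (y + l) v al_Lam.
  have cE : cproj L (- (p * 1 - k)%N%:Z) al = a.
    by rewrite -(cpE (- 1)); congr (cproj L _ al); lia.
  have e : (- (p * 1 - k)%N%:Z)%:~R / p%:R + (y + l) = y.
    rewrite mulrNz -[(_%:Z)%:~R]/((p * 1 - k)%N%:R) natrB ?muln1 1?ltnW // mulNr mulrBl divff //.
    by rewrite lE gtn_eqF //=; ring.
  rewrite cE e => hX; rewrite /= mul1r sub0r scaleNr; apply/eqP; rewrite eq_sym subr_eq -hX; apply/eqP.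
  rewrite /G; congr (hs al _ (gm_act _ _ v)).
  by rewrite natrB ?muln1 1?ltnW // mulrBl divff // lE gtn_eqF.
rewrite (@NP_N1 _ _ V _ _ _ _ _ _ _ B); last first.
- by move=> i Bi; apply: a0; exact: leq_trans Bi.
- move=> i Bi; have -> : y + 1 + l + i%:R = y + (p * (i + (k != 0)).+1 - k)%N%:R / p%:R.
    by rewrite strideE -natr1 natrD lE; ring.
  apply: X0; rewrite leq_subRL //; case: (k) kp => [|k'] kp' /=; nia.
rewrite /psign /= expr0; under eq_bigr do rewrite scale1r.
rewrite big_split /=; under eq_bigr do rewrite firstE.
have -> : \sum_(i < B) gm_act (X al) (y + 1 + l - 1 - i%:R) (gm_act (tilde a) (i%:R - l) v) =
    gm_act (X al) (y + 1 + l - 1 - 0%N%:R) (gm_act (tilde a) (0%N%:R - l) v).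
  rewrite (bigD1 (Ordinal B0)) //= big1 ?addr0 // => i i0.
  by rewrite a0 ?(lin0 (act_lin _ _)) // lt0n.
rewrite secE !addrA -[LHS]addrA scalerA -scalerDl; congr (_ + _ *: _); last first.
  by rewrite /a lE; ring.
case: (posnP k) => [k0|k0]; first by rewrite addr0; apply: eq_bigr => i _; rewrite addn0.
have -> : \sum_(i < B) G (i + ~~ false)%N + G 0%N = \sum_(i < B.+1) G i.
  by rewrite big_ord_recl addrC; congr (_ + _); apply: eq_bigr => i _; rewrite addn1.
by rewrite big_ord_recr /= G0 // addr0.
Qed.

(** The coefficient of D X_al = al~_(-1) X_al at [y + 1]: the scalar terms of all classes add up to
    mu(al) + shift al and combine with - (y + 1) on the left. *)
Lemma X_diffeq N y v : Om V mu v ->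
  (forall n, (N <= n)%N -> gm_act (X al) (y + n%:R / p%:R) v = 0) ->
  (top mu al - y) *: gm_act (X al) y v =
  \sum_(n < N) hs al (- n.+1%:Z) (gm_act (X al) (y + n.+1%:R / p%:R) v).
Proof.
move=> vO X0; pose B := N.+1.
have pB : (N <= p * B)%N by have := p_gt0 L; rewrite /B; nia.
have X0' n : (p * B <= n)%N -> gm_act (X al) (y + n%:R / p%:R) v = 0.
  by move=> h; apply: X0; exact: leq_trans h.
pose G n := hs al (- n%:Z) (gm_act (X al) (y + n%:R / p%:R) v).
rewrite -(@sum_ord_trunc _ (fun n => G n.+1) _ _ pB); last first.
  by move=> n Nn; rewrite /G X0 ?(lin0 (heis_lin _ _)) // ltnW.
rewrite -sum_strides.
have := act_D (y + 1) v (X_par al_Lam); rewrite (lv_DX A_lattice) //.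
rewrite -{1}(sum_lproj al) (lin_sum tilde_lin) (lin_sum (vs_prodl_lin _ _)) (lin_sum (act_lin_l _ _)).
under eq_big_nat => k kp do rewrite (field_part vO kp (ltn0Sn N) X0').
rewrite big_split /= -scaler_suml sumrB => /(canRL (addrK _)) ->.
rewrite addrK -scalerBl; congr (_ *: _).
rewrite [X in _ - (X - _)]big_ltn ?p_gt0 //= big_nat big1 ?addr0; last by case.
by rewrite /top /shift; ring.
Qed.

Lemma X_support y v : Om V mu v -> (forall k : nat, y <> top mu al - k%:R / p%:R) ->
  gm_act (X al) y v = 0.
Proof.
move=> vO; have [N] := X_trunc al y v; elim: N y => [|N IH] y X0 ny.
  by have := X0 0%N isT; rewrite mul0r addr0.
have := X_diffeq vO X0; rewrite big1 => [/eqP|n _].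
  rewrite scaler_eq0 => /orP[|/eqP //]; rewrite subr_eq0 => /eqP e.
  by case: (ny 0%N); rewrite mul0r subr0 e.
rewrite IH ?(lin0 (heis_lin _ _)) // => [m Nm|k e].
  by rewrite -addrA -mulrDl -natrD; apply: X0; rewrite addSn ltnS (leq_trans Nm) // leq_addl.
apply: (ny (k + n.+1)%N); rewrite natrD mulrDl opprD addrA -e; ring.
Qed.

Lemma X_above (n : nat) v : Om V mu v -> gm_act (X al) (top mu al + n.+1%:R / p%:R) v = 0.
Proof.
move=> vO; apply: X_support => // k e.
have p0 : (0 : R[i]) < p%:R by rewrite ltr0n p_gt0.
have : 0 < n.+1%:R / p%:R + k%:R / p%:R :> R[i].
  by rewrite -mulrDl -natrD divr_gt0 // ltr0n.
have -> : n.+1%:R / p%:R + k%:R / p%:R = 0 :> R[i].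
  by apply: (addrI (top mu al)); rewrite addrA e subrK addr0.
by rewrite ltxx.
Qed.

Lemma X_below (k : nat) v : Om V mu v ->
  (k%:R / p%:R) *: gm_act (X al) (top mu al - k%:R / p%:R) v =
  \sum_(n < k) hs al (- n.+1%:Z) (gm_act (X al) (top mu al - (k - n.+1)%N%:R / p%:R) v).
Proof.
move=> vO; set y := top mu al - k%:R / p%:R.
transitivity ((top mu al - y) *: gm_act (X al) y v); first by congr (_ *: _); rewrite /y; ring.
rewrite (X_diffeq (N := k.+1)) // /y; last first.
  move=> n kn; have -> : top mu al - k%:R / p%:R + n%:R / p%:R = top mu al + (n - k.+1).+1%:R / p%:R.
    by rewrite -subSn // subSS natrB ?mulrBl 1?ltnW // addrAC addrA.
  exact: X_above.
have e : top mu al - k%:R / p%:R + k.+1%:R / p%:R = top mu al + 1%:R / p%:R.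
  by rewrite -natr1 mulrDl; ring.
rewrite big_ord_recr /= e X_above //.
rewrite (lin0 (heis_lin _ _)) addr0; apply: eq_bigr => n _.
by rewrite natrB // mulrBl opprB addrA addrAC.
Qed.

Lemma X_Fock (k : nat) v : Om V mu v ->
  Fock hs [set u | exists c : R[i], u = c *: Uop mu al v] k (gm_act (X al) (top mu al - k%:R / p%:R) v).
Proof.
move=> vO; elim/ltn_ind: k => -[|k] IH.
  by rewrite mul0r subr0; apply: Fock_base; exists 1; rewrite scale1r.
have k0 : (k.+1%:R / p%:R : R[i]) != 0 by rewrite mulf_neq0 ?invr_eq0 ?p_neq0 // pnatr_eq0.
rewrite -[gm_act _ _ _](scalerK k0) X_below //; apply/FockZ/Fock_sum => n.
rewrite -{1}(subnK (ltn_ord n)); apply: Fock_op => //; apply: IH.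
by rewrite ltn_subrL.
Qed.

Lemma Uop_Om v : Om V mu v -> Om V (mu + flat al) (Uop mu al v).
Proof.
move=> vO; have [vac wt] := (OmP mu v).1 vO; apply/OmP; split=> [a n n0|a].
  rewrite /Uop (heis_X V_tw) // vac // (lin0 (act_lin _ _)) add0r.
  by case: n n0 => // n _; rewrite addrC X_above ?scaler0.
rewrite /Uop (heis_X V_tw) // wt (linZ (act_lin _ _)) mul0r add0r -scalerDl.
rewrite ev_add ev_flat (cprojE (k := 0%N) (p_gt0 L)) //; last by exists 0; rewrite mul0r.
Qed.

End Weight.

(** The coefficients of X_be below its top are Heisenberg descendants, whose creation modes are
    moved past X_al. The induction needs [t > 0] as well: a term with the creation mode on the left
    has its excess [t] raised by n + 1, and therefore vanishes. *)
Lemma pair_below mu al be (k : nat) : Lam L al -> Lam L be ->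
  exists c : R[i], (k = 0%N -> c = 1) /\ forall (t : nat) v, Om V mu v ->
    gm_act (X al) (top (mu + flat be) al + k%:R / p%:R + t%:R / p%:R)
      (gm_act (X be) (top mu be - k%:R / p%:R) v) =
    (if t == 0%N then c else 0) *: Uop (mu + flat be) al (Uop mu be v).
Proof.
move=> Lal Lbe; elim/ltn_ind: k => k IH.
have [k0|k0] := posnP k.
  exists 1; split=> // t v vO; rewrite k0 !mul0r subr0 addr0.
  have bO := Uop_Om Lbe vO.
  by case: t => [|t] /=; rewrite ?mul0r ?addr0 ?scale1r // scale0r X_above.
have [F HF] : exists F : nat -> R[i], forall m, (m < k)%N -> forall (t : nat) v, Om V mu v ->
    gm_act (X al) (top (mu + flat be) al + m%:R / p%:R + t%:R / p%:R)
      (gm_act (X be) (top mu be - m%:R / p%:R) v) =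
    (if t == 0%N then F m else 0) *: Uop (mu + flat be) al (Uop mu be v).
  suff /choice[F HF] : forall m, exists c : R[i], (m < k)%N -> forall (t : nat) v, Om V mu v ->
      gm_act (X al) (top (mu + flat be) al + m%:R / p%:R + t%:R / p%:R)
        (gm_act (X be) (top mu be - m%:R / p%:R) v) =
      (if t == 0%N then c else 0) *: Uop (mu + flat be) al (Uop mu be v) by exists F.
  by move=> m; case: (ltnP m k) => [/IH[c [_ Hc]]|_]; [exists c|exists 0].
pose G n := form (cproj L (- n.+1%:Z) be) al * F (k - n.+1)%N.
exists (- (k%:R / p%:R)^-1 * \sum_(n < k) G n).
split=> [k00|t v vO]; first by rewrite k00 in k0.
have kp0 : (k%:R / p%:R : R[i]) != 0 by rewrite mulf_neq0 ?invr_eq0 ?p_neq0 // pnatr_eq0 -lt0n.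
apply: (scalerI kp0); rewrite -(linZ (act_lin _ _)) X_below // (lin_sum (act_lin _ _)).
set u := Uop _ al _; set z := top (mu + flat be) al + k%:R / p%:R + t%:R / p%:R.
transitivity (\sum_(n < k) (- (if t == 0%N then G n else 0)) *: u); last first.
  rewrite -scaler_suml scalerA; congr (_ *: _); case: eqP => _.
    by rewrite sumrN mulrA mulrN divff // mulN1r.
  by rewrite sumrN big1 // oppr0 mulr0.
apply: eq_bigr => n _; set w := gm_act (X be) _ v.
have := heis_X V_tw be (- n.+1%:Z) z w Lal.
have kn : (k - n.+1 < k)%N by rewrite ltn_subrL.
have zE : z = top (mu + flat be) al + (k - n.+1)%N%:R / p%:R + (t + n.+1)%N%:R / p%:R.
  by rewrite /z natrB // natrD; ring.
have zE' : (- n.+1%:Z)%:~R / p%:R + z = top (mu + flat be) al + (k - n.+1)%N%:R / p%:R + t%:R / p%:R.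
  by rewrite /z natrB // mulrNz -[n.+1%:~R]/(n.+1%:R); ring.
rewrite {1}zE (HF _ kn) // addnS /= scale0r (lin0 (heis_lin _ _)) zE' (HF _ kn) // => /esym/eqP.
rewrite addr_eq0 => /eqP ->; rewrite scalerA -scaleNr /G; congr (_ *: _).
by case: eqP => _ //; rewrite mulr0.
Qed.

Lemma pair_scalar mu al be : Lam L al -> Lam L be ->
  exists F : R[i] -> R[i], [/\ F (top mu be) = 1,
    forall j : nat, F (top mu be + j.+1%:R) = 0 &
    forall n1 n2 v, Om V mu v -> n1 + n2 = top (mu + flat be) al + top mu be ->
      gm_act (X al) n1 (gm_act (X be) n2 v) = F n2 *: Uop (mu + flat be) al (Uop mu be v)].
Proof.
move=> Lal Lbe.
suff /choice[F HF] : forall n2 : R[i], exists c : R[i], [/\ n2 = top mu be -> c = 1,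
    forall j : nat, n2 = top mu be + j.+1%:R -> c = 0 &
    forall n1 v, Om V mu v -> n1 + n2 = top (mu + flat be) al + top mu be ->
      gm_act (X al) n1 (gm_act (X be) n2 v) = c *: Uop (mu + flat be) al (Uop mu be v)].
  exists F; split=> [|j|n1 n2 v vO e]; first by have [H _ _] := HF (top mu be); exact: H.
    by have [_ H _] := HF (top mu be + j.+1%:R); exact: (H j).
  by have [_ _ H] := HF n2; exact: H.
move=> n2; case: (pselect (exists k : nat, n2 = top mu be - k%:R / p%:R)) => [[k ->]|nk].
  have [c [c1 Hc]] := pair_below mu k Lal Lbe; exists c; split.
  - move=> /(canRL (subrK _)) e; apply: c1; apply/eqP.
    have : k%:R / p%:R = 0 :> R[i] by apply: (addrI (top mu be)); rewrite addr0.
    by move/eqP; rewrite mulf_eq0 invr_eq0 (negbTE (p_neq0 L)) orbF pnatr_eq0.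
  - move=> j /addrI e; have p0 : (0 : R[i]) < p%:R by rewrite ltr0n p_gt0.
    have : 0 < k%:R / p%:R + j.+1%:R :> R[i] by rewrite ltr_wpDl ?divr_ge0 ?ler0n ?ltr0n.
    by rewrite -e subrr ltxx.
  - move=> n1 v vO e; have -> : n1 = top (mu + flat be) al + k%:R / p%:R + 0%N%:R / p%:R.
      by rewrite mul0r addr0; move/(canRL (addrK _)): e => ->; ring.
    exact: Hc 0%N v vO.
exists 0; split=> // [e|n1 v vO _]; first by case: nk; exists 0%N; rewrite mul0r subr0.
rewrite scale0r (X_support Lbe vO) ?(lin0 (act_lin _ _)) // => k e; apply: nk; by exists k.
Qed.

(* Locality, read off at the highest mode that does not kill v. *)
Lemma Uop_swap mu al be : Lam L al -> Lam L be -> exists g : R[i], forall v, Om V mu v ->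
  Uop (mu + flat be) al (Uop mu be v) = g *: Uop (mu + flat al) be (Uop mu al v).
Proof.
move=> Lal Lbe; have [F [F1 F0 FE]] := pair_scalar mu Lal Lbe.
have [G [_ _ GE]] := pair_scalar mu Lbe Lal.
have [N HN] := gm_local V (X_par Lal) (X_par Lbe).
set s := psign R _ _ in HN.
pose m := top (mu + flat be) al - N%:R.
exists ((-1) ^+ N * s * \sum_(i < N.+1) (-1) ^+ i * ('C(N, i))%:R * G (m + i%:R)) => v vO.
have := HN m (top mu be) v.
set u := Uop _ al _; set u' := Uop _ be _.
rewrite (eq_bigr (fun i : 'I_N.+1 => ((-1) ^+ i * ('C(N, i))%:R) *: (F (top mu be + (N - i)%N%:R) *: u)
   - (s * ((-1) ^+ i * ('C(N, i))%:R * G (m + i%:R))) *: u')); last first.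
  move=> i _; have le_iN : (i <= N)%N by rewrite -ltnS.
  rewrite scalerBr FE //; last by rewrite /m natrB //; ring.
  rewrite GE //; last by rewrite -top_sym /m natrB //; ring.
  by rewrite !scalerA mulrCA !mulrA.
rewrite sumrB -scaler_suml -mulr_sumr big_ord_recr /= subnn addr0 F1 binn mulr1 scale1r big1 ?add0r; last first.
  move=> i _; have iN := ltn_ord i.
  by rewrite -(prednK (n := (N - i)%N)) ?subn_gt0 // F0 scale0r scaler0.
move/eqP; rewrite subr_eq0 => /eqP /(congr1 (fun x => (-1) ^+ N *: x)).
by rewrite !scalerA -exprD -signr_odd addnn odd_double expr0 scale1r mulrA.
Qed.

(** For n = - (al | be) - 1 the product X_al_(n) X_be is varkappa X_(al + be). In its coefficient at
    [top mu (al + be)] every term has the total index of [pair_scalar], hence is a multiple of U_al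
    U_be or of U_be U_al, and [Uop_swap] turns the former into the latter. *)
Lemma Uop_prod mu al be : Lam L al -> Lam L be -> exists C : R[i], forall v, Om V mu v ->
  varkappa al be *: Uop mu (al + be) v = C *: Uop (mu + flat al) be (Uop mu al v).
Proof.
move=> Lal Lbe; have [F [_ _ FE]] := pair_scalar mu Lal Lbe.
have [G [_ _ GE]] := pair_scalar mu Lbe Lal.
have [g gE] := Uop_swap mu Lal Lbe.
pose n : int := - ipair al be - 1.
pose x := top mu (al + be).
have nx : n%:~R + x = top (mu + flat be) al + top mu be.
  by rewrite top_add /n intrD mulrNz -(form_int L_ok Lal Lbe) /x mulrNz; ring.
set s := psign R (odd `|ipair al al|%N) (odd `|ipair be be|%N).
pose c l (j : nat) : R[i] :=
  \sum_(i \in [set: nat]) ((-1) ^+ i * gbin ((n + j%:Z)%:~R : R[i]) i) * F (x + l - j%:R + i%:R) * g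
  - s * \sum_(i \in [set: nat]) ((-1) ^ (n + j%:Z - i%:Z) * gbin ((n + j%:Z)%:~R : R[i]) i) * G (i%:R - l).
exists (\sum_(l \in @class_rep R) \sum_(j \in [set: nat]) gbin l j * c l j) => v vO.
have -> : varkappa al be *: Uop mu (al + be) v = gm_act (vs_prod n (X al) (X be)) x v.
  have XXE : vs_prod n (X al) (X be) = varkappa al be *: X (al + be).
    have := lv_XX A_lattice 0%N Lal Lbe; rewrite fact0 divr1 /= => <-.
    by congr (vs_prod _ _ _); rewrite /n; lia.
  by rewrite XXE (linZ (act_lin_l _ _)).
rewrite (gm_prod _ _ _ (X_par Lal) (X_par Lbe)) nprodE -/s.
set u := Uop _ be _.
apply: eq_fsum_scaler => l _; apply: eq_fsum_scaler => j _.
rewrite -[RHS]scalerA; congr (_ *: _); rewrite /NP /c /= scalerBl; congr (_ - _).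
  apply: eq_fsum_scaler => i _; rewrite FE //; last by rewrite -nx intrD -[j%:~R]/(j%:R); ring.
  by rewrite gE // !scalerA mulrA.
rewrite -[RHS]scalerA; congr (_ *: _).
apply: eq_fsum_scaler => i _; rewrite GE ?scalerA //.
by rewrite -top_sym -nx intrD -[j%:~R]/(j%:R); ring.
Qed.

Lemma varkappa_neq0 al be : Lam L al -> Lam L be -> varkappa al be != 0 :> R[i].
Proof.
move=> Lal Lbe; have [_ [e0 _] _] := L_ok; rewrite /varkappa !mulf_neq0 //.
- by apply/eqP; exact: e0.
- by rewrite expfz_neq0 // p_neq0.
rewrite prodf_seq_neq0; apply/allP => s; rewrite mem_index_iota => sp /=.
rewrite expfz_neq0 // subr_eq0 eq_sym.
have -> : omega L ^+ s = exp2pii (s%:R / p%:R) by rewrite /omega -exp2piiX -[_ *+ s]mulr_natl.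
exact: exp2pii_frac_neq1.
Qed.

Lemma Uop0 mu v : Uop mu 0 v = ld_eps (0 : h) 0 *: v.
Proof.
by rewrite /Uop top0 (lv_X0 A_lattice) (linZ (act_lin_l _ _)) gm_one eqxx.
Qed.

Lemma eps00_neq0 : ld_eps (0 : h) 0 != 0 :> R[i].
Proof. by have [_ [e0 _] _] := L_ok; apply/eqP; apply: e0; exact: Lam0. Qed.

(** For be = - al the product formula ends in U_0 = eps(0,0), a nonzero scalar, which forces C to be
    nonzero as soon as [Om V mu] is. If that space is zero, any constant will do. *)
Lemma Uop_inv mu al : Lam L al -> exists2 c : R[i], c != 0 & forall v, Om V mu v ->
  Uop (mu + flat al) (- al) (Uop mu al v) = c *: v.
Proof.
move=> Lal; case: (pselect (exists v, Om V mu v /\ v <> 0)) => [[v0 [v0O v00]]|nv]; last first.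
  exists 1; rewrite ?oner_eq0 // => v vO; have -> : v = 0.
    by apply: contrapT => v0; apply: nv; exists v.
  by rewrite (lin0 (Uop_lin _ _)) (lin0 (Uop_lin _ _)) scaler0.
have [C HC] := Uop_prod mu Lal (LamN Lal).
set k := varkappa al (- al) in HC.
have k0 : k * ld_eps (0 : h) 0 != 0 by rewrite mulf_neq0 ?eps00_neq0 // varkappa_neq0 //; exact: LamN.
have HC' v : Om V mu v -> (k * ld_eps (0 : h) 0) *: v = C *: Uop (mu + flat al) (- al) (Uop mu al v).
  by move=> vO; rewrite -HC // subrr Uop0 scalerA.
have C0 : C != 0.
  apply/eqP => C0; have := HC' v0 v0O; rewrite C0 scale0r => /eqP.
  by rewrite scaler_eq0 (negbTE k0) => /eqP.
exists (C^-1 * (k * ld_eps (0 : h) 0)) => [|v vO]; first by rewrite mulf_neq0 ?invr_eq0.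
by rewrite -scalerA HC' // scalerA mulVf // scale1r.
Qed.

Lemma Uop_inj mu al v : Lam L al -> Om V mu v -> Uop mu al v = 0 -> v = 0.
Proof.
move=> Lal vO e; have [c c0 /(_ v vO)] := Uop_inv mu Lal.
by rewrite e (lin0 (Uop_lin _ _)) => /esym/eqP; rewrite scaler_eq0 (negbTE c0) => /eqP.
Qed.

Lemma Uop_mul mu al be : Lam L al -> Lam L be -> exists2 c : R[i], c != 0 & forall v, Om V mu v ->
  Uop (mu + flat al) be (Uop mu al v) = c *: Uop mu (al + be) v.
Proof.
move=> Lal Lbe; case: (pselect (exists v, Om V mu v /\ v <> 0)) => [[v0 [v0O v00]]|nv]; last first.
  exists 1; rewrite ?oner_eq0 // => v vO; have -> : v = 0.
    by apply: contrapT => v0; apply: nv; exists v.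
  by rewrite !(lin0 (Uop_lin _ _)) scaler0.
have [C HC] := Uop_prod mu Lal Lbe; have k0 := varkappa_neq0 Lal Lbe.
have C0 : C != 0.
  apply/eqP => C0; have := HC v0 v0O; rewrite C0 scale0r => /eqP.
  rewrite scaler_eq0 (negbTE k0) => /eqP /(Uop_inj (LamD Lal Lbe) v0O); exact: v00.
exists (C^-1 * varkappa al be) => [|v vO]; first by rewrite mulf_neq0 ?invr_eq0.
by rewrite -scalerA HC // scalerA mulVf // scale1r.
Qed.

(** Since [top] is invariant under sigma, [act_sigmahat_X] compares leading coefficients with
    leading coefficients. *)
Lemma Uop_sigma mu al : Lam L al -> exists2 f : R[i], f != 0 & 
  [/\ sigmahat (X al) = f *: X (sigma L al), top mu (sigma L al) = top mu al &
   forall v, Om V mu v ->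
    f *: Uop mu (sigma L al) v = exp2pii (top mu al) *: Uop mu al v].
Proof.
move=> Lal; have [f f0 fE] := sigmahat_X Lal; exists f => //.
have tE : top mu (sigma L al) = top mu al.
  have l0 : lproj L 0 (sigma L al) = lproj L 0 al.
    by rewrite lproj_sigma ?p_gt0 // mul0r exp2pii0 scale1r.
  rewrite /top -ev_lproj0 l0 ev_lproj0; congr (_ - _); rewrite /shift; congr (- _).
  rewrite big_nat [RHS]big_nat; apply: eq_bigr => k /= kp; congr (_ * _).
  by rewrite -(form_sigma (lproj L k al) al) (sigma_part kp (lproj_mem k al)) lproj_sigma.
split=> // v vO; rewrite /Uop tE -(linZ (act_lin_l _ _)) -fE.
exact: (act_sigmahat_X V_tw).
Qed.

End VacuumVectors.

Lemma Fock_mono (V : lmodType R[i]) (op : h -> int -> V -> V) (S S' : set V) d v :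
  (forall x, S x -> S' x) -> Fock op S d v -> Fock op S' d v.
Proof.
move=> SS'; elim=> {d v} [v Sv|d a n v n0 _ IH|d|d c u v _ IHu _ IHv].
- by apply: Fock_base; exact: SS'.
- exact: Fock_op.
- exact: Fock_zero.
- exact: Fock_lin.
Qed.

Lemma Fock_le_subspace (V : lmodType R[i]) (op : h -> int -> V -> V) (S : set V) :
  subspace [set v | exists D, Fock_le op S D v].
Proof.
split; first by exists 0%N; exact: Fock_le0.
move=> c u v [D1 F1] [D2 F2]; exists (maxn D1 D2).
by apply: Fock_leL; [apply: Fock_le_widen F1|apply: Fock_le_widen F2]; rewrite (leq_maxl, leq_maxr).
Qed.

(** * Submodules generated by a vacuum vector *)

Section GeneratedSubmodules.
Variable V : gen_module A.
Hypothesis V_tw : twisted sigmahat V.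
Local Notation hs := (heis tilde (V := V)).
Implicit Types (u v x : V) (mu : h0_dual L).

Lemma vacP v : vacuum_space tilde v <-> forall a (n : nat), (0 < n)%N -> hs a n%:Z v = 0.
Proof.
split=> [vac a n n0|vac a [n|//] n0]; first exact: vac.
exact: vac.
Qed.

Lemma weight_subspace (xi : h0_dual L) : subspace (@weight_space R L A tilde V xi).
Proof.
split=> [u|c x y Wx Wy u]; first by rewrite (lin0 (heis_lin _ _)) scaler0.
by rewrite heis_lin Wx Wy scalerDr !scalerA mulrC.
Qed.

(* The tilde a and the X_al generate A. *)
Lemma gen_closed (Q : set V) : subspace Q ->
  (forall a n u, Q u -> Q (hs a n u)) ->
  (forall al y u, Lam L al -> Q u -> Q (gm_act (X al) y u)) ->
  forall a n u, Q u -> Q (gm_act a n u).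
Proof.
move=> QS Qh QX.
have Qt a y u : Q u -> Q (gm_act (tilde a) y u).
  move=> Qu; case: (act_tilde V_tw y) => [[n H]|H]; rewrite H; first exact: Qh.
  exact: sub0.
have QM al B : Lam L al -> forall y u, Q u -> Q (gm_act (heis_monomial tilde X al B) y u).
  move=> Lal; rewrite /heis_monomial.
  suff: exists b, vs_par b (foldr (fun (q : 'I_(\dim (fullv : {vspace h})) * nat) z =>
      vs_prod (- (q.2.+1)%:Z) (tilde (vbasis (fullv : {vspace h}))`_(q.1)) z) (X al) (enum_mset B)) /\
    forall y u, Q u -> Q (gm_act (foldr (fun (q : 'I_(\dim (fullv : {vspace h})) * nat) z =>
      vs_prod (- (q.2.+1)%:Z) (tilde (vbasis (fullv : {vspace h}))`_(q.1)) z) (X al) (enum_mset B)) y u).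
    by case=> b [].
  elim: (enum_mset B) => [|q s [b [pb IH]]] /=.
    by exists (odd `|ipair al al|%N); split; [exact: X_par|move=> y u; exact: QX].
  exists (false (+) b); split; first by apply: vs_prod_par pb; exact: tilde_even.
  move=> y u Qu; rewrite (gm_prod _ _ _ (tilde_even _) pb) nprodE.
  apply: sub_fsum => // l _; apply: sub_fsum => // j _; apply: subZ => //; rewrite /NP.
  apply: subB => //; [|apply: subZ => //]; apply: sub_fsum => // i _; apply: subZ => //.
    by apply: Qt; exact: IH.
  by apply: IH; exact: Qt.
move=> a n u Qu; have [comp [[_ ex _] _ _ hb]] := lv_comp A_lattice.
have [w [wc _ ->]] := ex a; apply: (fsum_ind (P := fun b => Q (gm_act b n u))).
- by rewrite (lin0 (act_lin_l _ _)); exact: sub0.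
- by move=> b c Qb Qc; rewrite (linD (act_lin_l _ _)); exact: subD.
move=> al Lal; have [c [_ ->]] := ((hb al Lal).1 _).1 (wc al Lal).
apply: (fsum_ind (P := fun b => Q (gm_act b n u))).
- by rewrite (lin0 (act_lin_l _ _)); exact: sub0.
- by move=> b d Qb Qd; rewrite (linD (act_lin_l _ _)); exact: subD.
by move=> B _; rewrite (linZ (act_lin_l _ _)); apply: subZ => //; exact: QM.
Qed.

Definition span_U mu v0 : set V := [set x | exists s : seq (R[i] * h),
  (forall q, q \in s -> Lam L q.2) /\ x = \sum_(q <- s) q.1 *: Uop mu q.2 v0].

(** Built from Heisenberg descendants only, so that [Fock_vacuum] determines its vacuum vectors;
    stability under all fields is a separate result. *)
Definition gen_sub mu v0 : set V := [set v | exists D, Fock_le hs (span_U mu v0) D v].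

Lemma span_U_subspace mu v0 : subspace (span_U mu v0).
Proof.
split; first by exists [::]; rewrite big_nil.
move=> c _ _ [s [Ls ->]] [t [Lt ->]]; exists ([seq (c * q.1, q.2) | q <- s] ++ t); split.
  by move=> q; rewrite mem_cat => /orP[/mapP[q' /Ls Lq ->]|/Lt].
rewrite big_cat big_map scaler_sumr; congr (_ + _).
by apply: eq_bigr => q _; rewrite scalerA.
Qed.

Lemma span_U_mem mu v0 al : Lam L al -> span_U mu v0 (Uop mu al v0).
Proof.
move=> Lal; exists [:: (1, al)]; split; last by rewrite big_seq1 scale1r.
by move=> q; rewrite inE => /eqP ->.
Qed.

Section FromVacuum.
Variables (mu : h0_dual L) (v0 : V).
Hypothesis v0O : Om V mu v0.

Lemma span_U_vac a (n : nat) x : (0 < n)%N -> span_U mu v0 x -> hs a n%:Z x = 0.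
Proof.
move=> n0 [s [Ls ->]]; rewrite (lin_sum (heis_lin _ _)) big_seq big1 // => q qs.
by rewrite (linZ (heis_lin _ _)) ((OmP _ _).1 (Uop_Om V_tw (Ls _ qs) v0O)).1 // scaler0.
Qed.

Lemma span_U_op0 a x : span_U mu v0 x -> span_U mu v0 (hs a 0 x).
Proof.
move=> [s [Ls ->]]; rewrite (lin_sum (heis_lin _ _)); apply: sub_sum_seq => [|q qs].
  exact: span_U_subspace.
rewrite (linZ (heis_lin _ _)) ((OmP _ _).1 (Uop_Om V_tw (Ls _ qs) v0O)).2 scalerA.
by apply: subZ; [exact: span_U_subspace|apply: span_U_mem; exact: Ls].
Qed.

Lemma gen_sub_self : gen_sub mu v0 v0.
Proof.
exists 1%N; apply: (Fock_le_of (d := 0%N)) => //; apply: Fock_base.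
have := span_U_mem mu v0 (Lam0 L); rewrite Uop0; apply: subZ_inv.
  exact: span_U_subspace.
exact: eps00_neq0.
Qed.

(** A mode of X_al commutes with creation modes up to other modes of X_al, which reduces the claim
    to the vectors U_be v0. There its values are Fock descendants of U_al U_be v0, a multiple of
    U_(al + be) v0. *)
Lemma gen_sub_submodule : submodule (gen_sub mu v0).
Proof.
have GS := Fock_le_subspace hs (span_U mu v0).
have Gh a n u : gen_sub mu v0 u -> gen_sub mu v0 (hs a n u).
  by move=> [D Fu]; exact: (Fock_le_op (@heis_lin V) (heis_comm V_tw) span_U_vac a n span_U_op0 Fu).
split=> //; apply: gen_closed => // al y u Lal [D [w Fw ->]].
rewrite (lin_sum (act_lin _ _)); apply: sub_sum => // d _.
elim: (Fw d) y => {w Fw d D u} [x [s [Ls ->]]|d a n x n0 _ IH|d|d c x y _ IHx _ IHy] z.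
- rewrite (lin_sum (act_lin _ _)); apply: sub_sum_seq => // q qs; have Lq := Ls _ qs.
  rewrite (linZ (act_lin _ _)); apply: subZ => //.
  have qO := Uop_Om V_tw Lq v0O.
  case: (pselect (exists k : nat, z = top (mu + flat q.2) al - k%:R / p%:R)) => [[k ->]|nk].
    exists k.+1; apply: (Fock_le_of (d := k)) => //; apply: Fock_mono (X_Fock V_tw Lal k qO).
    move=> _ [c ->]; apply: subZ; first exact: span_U_subspace.
    have [e _ ->] := Uop_mul V_tw mu Lq Lal; last by [].
    apply: subZ; first exact: span_U_subspace.
    by apply: span_U_mem; exact: LamD.
  by rewrite (X_support V_tw Lal qO) => [|k e]; [exact: sub0|apply: nk; exists k].
- have := heis_X V_tw a (- n%:Z) z x Lal => /(canLR (addrK _)) <-.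
  by apply: subB => //; [apply: Gh; exact: IH|apply: subZ].
- by rewrite (lin0 (act_lin _ _)); exact: sub0.
- by rewrite act_lin; apply: GS.2; [exact: IHx|exact: IHy].
Qed.

Lemma gen_sub_vacuum x : gen_sub mu v0 x -> vacuum_space tilde x -> span_U mu v0 x.
Proof.
move=> [D Fx] /vacP vac.
have [S0 SL] := span_U_subspace mu v0.
exact: (Fock_vacuum (@heis_lin V) (heis_comm V_tw) (@heis_dual V) span_U_vac S0 SL Fx vac).
Qed.

Lemma gen_sub_min (Q : set V) : submodule Q -> Q v0 -> gen_sub mu v0 `<=` Q.
Proof.
move=> [QS Qact] Qv x [D Fx]; apply: (Fock_le_sub QS _ _ Fx) => [y [s [_ ->]]|a n u Qu].
  by apply: sub_sum_seq => // q _; apply: subZ => //; exact: Qact.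
exact: Qact.
Qed.

End FromVacuum.
End GeneratedSubmodules.

(** * Vacuum vectors in objects of the category *)

Section ObjectO.
Variable V : gen_module A.
Hypothesis VO : in_O tilde sigmahat V.
Local Notation hs := (heis tilde (V := V)).
Implicit Types (u v x : V) (mu : h0_dual L).

Let V_tw : twisted sigmahat V. Proof. by case: VO. Qed.

(** Positive modes commute with the zero modes, so they kill every weight component of a vector that
    they kill. *)
Lemma vacuum_decomp v : vacuum_space tilde v ->
  exists s : seq V, (forall x, x \in s -> exists mu, Om V mu x) /\ v = \sum_(x <- s) x.
Proof.
move=> /vacP vac; have [_ [_ ex un] _] := VO; have [w [wW wf vE]] := ex v.
have [r [ur rP rE]] := fsum_supp_seq wf.
exists [seq w i | i <- r]; split; last by rewrite big_map -rE.
move=> x /mapP[xi _ ->]; exists xi; split; last exact: wW.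
apply/vacP => a n n0.
apply: (un (fun xi => hs a n%:Z (w xi))) => //.
- move=> i _ u; rewrite (heis_comm V_tw) add0r; have -> : (n%:Z == 0) = false by lia.
  by rewrite scale0r addr0 (wW i) // (linZ (heis_lin _ _)).
- by apply: sub_finite_set wf => i /= [_ h0]; split=> // w0; apply: h0; rewrite w0 (lin0 (heis_lin _ _)).
- rewrite (fsum_seq (r := r)) // => [|i _].
    by rewrite -(lin_sum (heis_lin _ _)) -rE -vE; exact: vac.
  move=> /negP ir; apply: contrapT => h0; apply: ir; apply/rP; split=> // w0.
  by apply: h0; rewrite w0 (lin0 (heis_lin _ _)).
Qed.

Lemma O_gen (Q : set V) : subspace Q -> (forall a n u, Q u -> Q (hs a n u)) ->
  (forall mu v, Om V mu v -> Q v) -> forall v, Q v.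
Proof.
move=> QS Qh QO v; have [_ _ UH] := VO.
have : [set: V] v by []; rewrite -UH => -[s [sv ->]].
apply: sub_sum_seq => // -[q x] /sv /= /vacuum_decomp[t [tO ->]].
elim: q => [|q s' IH] /=; last exact: Qh.
by apply: sub_sum_seq => // y /tO[mu]; exact: QO.
Qed.

(** Positive modes lower a vector of [Q] to a vacuum vector; zero modes separate the weights of the
    latter, so [eigen_pick] finds a vector of one weight without leaving [Q]. *)
Lemma O_lowest (Q : set V) : submodule Q -> (exists v, Q v /\ v <> 0) ->
  exists mu x, [/\ Om V mu x, x <> 0 & Q x].
Proof.
move=> [QS Qact] [v [Qv v0]].
have vac0 : forall a (n : nat) x, (0 < n)%N -> vacuum_space tilde x -> hs a n%:Z x = 0.
  by move=> a n x n0 /vacP; apply.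
have [D FD] : exists D, Fock_le hs (vacuum_space tilde (V := V)) D v.
  apply: (O_gen (Q := [set v | exists D, Fock_le hs (vacuum_space tilde (V := V)) D v])).
  - exact: Fock_le_subspace.
  - move=> a n u [D Fu]; apply: (Fock_le_op (@heis_lin V) (heis_comm V_tw) vac0 a n _ Fu).
    move=> b x /vacP xv; apply/vacP => c k k0; rewrite (heis_comm V_tw) xv // (lin0 (heis_lin _ _)) add0r.
    have -> : (k%:Z + 0 == 0) = false by lia.
    by rewrite scale0r.
  - move=> mu x [xv _]; exists 1%N; apply: (Fock_le_of (d := 0%N)) => //; exact: Fock_base.
have [u [Qu u0 uvac]] := Fock_lowest (@heis_lin V) (heis_comm V_tw) vac0
  (fun a n u _ => @Qact (tilde (cproj L n%:Z a)) _ u) FD v0 Qv.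
have [s [sO uE]] := vacuum_decomp ((vacP u).2 uvac).
have [||||x [x0 [mu xO] Qx]] := @eigen_pick _ V Q [set x | exists mu, Om V mu x] QS _ _ s sO.
- by move=> c x [mu xO]; exists mu; apply: subZ xO; exact: Om_subspace.
- move=> x y [mu xO] [nu yO]; case: (pselect (mu = nu)) => [mn|mn].
    by left; exists mu; apply: subD => //; [exact: Om_subspace|rewrite mn].
  right; have [a an] : exists a, ev mu a <> ev nu a.
    by apply/existsNP => H; apply: mn; exact: ev_inj.
  exists (hs a 0); split; [exact: heis_lin|by move=> z; exact: Qact| |].
    by move=> z [xi /OmP[_ zw]]; exists (ev xi a).
  exists (ev mu a), (ev nu a); split; first exact/eqP.
    by have [_ ->] := (OmP _ _).1 xO.
  by have [_ ->] := (OmP _ _).1 yO.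
- by rewrite -uE.
- by rewrite -uE.
by exists mu, x.
Qed.

End ObjectO.

(** * The sublattice orthogonal to h^[0] and its operators on a fixed weight *)

Definition Lperp : set h := [set g | Lam L g /\ lproj L 0 g = 0].

Lemma Lperp_Lam g : Lperp g -> Lam L g. Proof. by case. Qed.

Lemma Lperp0 : Lperp 0. Proof. by split; [exact: Lam0|rewrite linear0]. Qed.

Lemma LperpB a b : Lperp a -> Lperp b -> Lperp (a - b).
Proof. by move=> [La a0] [Lb b0]; split; [exact: LamB|rewrite linearB /= a0 b0 subrr]. Qed.

Lemma LperpMn a n : Lperp a -> Lperp (a *+ n).
Proof. by move=> [La a0]; split; [exact: LamMn|rewrite linearMn /= a0 mul0rn]. Qed.

Lemma Lperp_flat g mu : Lperp g -> mu + flat g = mu.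
Proof. by move=> [_ /flat_eq0 ->]; rewrite addr0. Qed.

Lemma flat_inj a b : flat a = flat b -> lproj L 0 a = lproj L 0 b.
Proof.
move=> e; apply/eqP; rewrite -subr_eq0; apply/eqP/form_nondeg => c.
have := ev_flat a c; rewrite e ev_flat.
rewrite !(form_lproj (k := 0%N) (l := 0%N)) ?p_gt0 // => e'.
by rewrite bformDl bformNl !(bformC _ c) e' subrr.
Qed.

(** The sum of sigma^s g over s < p is p g^[0] = 0, so p g is the sum of the differences g - sigma^s
    g, each of which telescopes. *)
Lemma Lperp_mulp g : Lperp g -> exists2 be, Lam L be & g *+ p = sigma L be - be.
Proof.
move=> [Lg g0].
exists (- \sum_(s < p) \sum_(j < s) iter j (sigma L) g).
  by apply: LamN; apply: Lam_sum => s; apply: Lam_sum => j; exact: Lam_iter_sigma.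
have tel s : sigma L (\sum_(j < s) iter j (sigma L) g) - \sum_(j < s) iter j (sigma L) g =
    iter s (sigma L) g - g.
  elim: s => [|s IH]; first by rewrite !big_ord0 linear0 !subrr.
  by rewrite !big_ord_recr /= linearD /= opprD addrACA IH addrC addrA subrK.
rewrite linearN /= opprK addrC -opprB linear_sum -sumrB.
under eq_bigr => s _ do rewrite tel.
by rewrite sumrB sumr_const card_ord sum_iter_sigma g0 scaler0 sub0r opprK.
Qed.

Section Isotropic.
Variable V : gen_module A.
Hypothesis V_tw : twisted sigmahat V.
Implicit Types (u v x : V) (mu : h0_dual L).

Lemma Uop_perp mu g v : Lperp g -> Om V mu v -> Om V mu (Uop mu g v).
Proof.
move=> Lg vO; rewrite -{1}(Lperp_flat mu Lg); apply: Uop_Om => //; exact: Lperp_Lam.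
Qed.

Lemma perp_mul mu g d : Lperp g -> Lam L d -> exists2 c : R[i], c != 0 &
  forall v, Om V mu v -> Uop mu d (Uop mu g v) = c *: Uop mu (g + d) v.
Proof.
move=> Lg Ld; have [c c0 H] := Uop_mul V_tw mu (Lperp_Lam Lg) Ld; exists c => // v vO.
by rewrite -H // Lperp_flat.
Qed.

Lemma perp_swap mu g d : Lperp g -> Lperp d -> exists2 c : R[i], c != 0 &
  forall v, Om V mu v -> Uop mu d (Uop mu g v) = c *: Uop mu g (Uop mu d v).
Proof.
move=> Lg Ld; have [c c0 H] := perp_mul mu Lg (Lperp_Lam Ld).
have [c' c'0 H'] := perp_mul mu Ld (Lperp_Lam Lg).
exists (c / c') => [|v vO]; first by rewrite mulf_neq0 // invr_eq0.
by rewrite H // H' // addrC scalerA divfK.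
Qed.

Lemma Uop_coboundary mu be : Lam L be -> exists2 c : R[i], c != 0 &
  forall v, Om V mu v -> Uop mu (sigma L be - be) v = c *: v.
Proof.
move=> Lbe; pose nu := mu + flat (- be).
have nuE : nu + flat be = mu by rewrite /nu flatN subrK.
have [c c0 cE] := Uop_inv V_tw mu (LamN Lbe); rewrite -/nu opprK in cE.
have Lsb := Lam_sigma sigma_Lam Lbe.
have [f f0 [_ _ fE]] := Uop_sigma V_tw nu Lbe.
have [d d0 dE] := Uop_mul V_tw nu Lbe (LamB Lsb Lbe); rewrite nuE in dE.
have e0 := exp2pii_neq0 (top nu be).
exists (d * (f^-1 * exp2pii (top nu be))) => [|v vO]; first by rewrite mulf_neq0 // mulf_neq0 // invr_eq0.
have wO : Om V nu (Uop mu (- be) v) by apply: Uop_Om => //; exact: LamN.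
apply: (scalerI c0); rewrite -(linZ (Uop_lin _ _)) -cE // dE // addrC subrK.
have -> : Uop nu (sigma L be) (Uop mu (- be) v) =
    (f^-1 * exp2pii (top nu be)) *: Uop nu be (Uop mu (- be) v).
  by rewrite -scalerA -fE // scalerA mulVf // scale1r.
by rewrite !scalerA cE // scalerA mulrC.
Qed.

(** Repeated use of [perp_mul]; the start of the induction inverts U_0 = eps(0,0). *)
Lemma Uop_iter mu g k : Lperp g -> exists2 c : R[i], c != 0 &
  forall v, Om V mu v -> iter k (Uop mu g) v = c *: Uop mu (g *+ k) v.
Proof.
move=> Lg; elim: k => [|k [c c0 IH]].
  exists (ld_eps (0 : h) 0)^-1 => [|v vO]; first by rewrite invr_eq0 eps00_neq0.
  by rewrite mulr0n Uop0 scalerA mulVf ?scale1r // eps00_neq0.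
have [d d0 dE] := perp_mul mu (LperpMn k Lg) (Lperp_Lam Lg).
exists (c * d) => [|v vO]; first by rewrite mulf_neq0.
by rewrite iterS IH // (linZ (Uop_lin _ _)) dE // scalerA mulrSr.
Qed.

Lemma Uop_pow mu g : Lperp g -> exists2 c : R[i], c != 0 &
  forall v, Om V mu v -> iter p (Uop mu g) v = c *: v.
Proof.
move=> Lg; have [c c0 cE] := Uop_iter mu p Lg.
have [be Lbe gE] := Lperp_mulp Lg; have [d d0 dE] := Uop_coboundary mu Lbe.
exists (c * d) => [|v vO]; first by rewrite mulf_neq0.
by rewrite cE // gE dE // scalerA.
Qed.

Lemma Uop_mulp mu g : Lperp g -> exists2 c : R[i], c != 0 &
  forall v, Om V mu v -> Uop mu (g *+ p) v = c *: v.
Proof.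
by move=> Lg; have [be Lbe ->] := Lperp_mulp Lg; exact: Uop_coboundary.
Qed.

Lemma Uop_iter_Om mu g k v : Lperp g -> Om V mu v -> Om V mu (iter k (Uop mu g) v).
Proof. by move=> Lg vO; elim: k => [//|k IH]; exact: Uop_perp. Qed.

End Isotropic.

(** * Constants made independent of the module by means of products *)

Lemma twisted_prodm (V1 V2 : gen_module A) :
  twisted sigmahat V1 -> twisted sigmahat V2 -> twisted sigmahat (prodm V1 V2).
Proof.
move=> t1 t2 l a al n v nz; case: (pselect (gm_act a n v.1 = 0)) => [e1|]; last exact: t1.
case: (pselect (gm_act a n v.2 = 0)) => [e2|]; last exact: t2.
by case: nz; rewrite /= /pact e1 e2.
Qed.

Lemma heis_prodm (V1 V2 : gen_module A) a n (v : prodm V1 V2) :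
  heis tilde a n v = (heis tilde a n v.1, heis tilde a n v.2).
Proof. by []. Qed.

Lemma Uop_prodm (V1 V2 : gen_module A) mu al (v : prodm V1 V2) :
  Uop mu al v = (Uop mu al v.1, Uop mu al v.2).
Proof. by []. Qed.

Lemma iter_Uop_prodm (V1 V2 : gen_module A) mu al k (v : prodm V1 V2) :
  iter k (Uop mu al) v = (iter k (Uop mu al) v.1, iter k (Uop mu al) v.2).
Proof. by elim: k => [|k IH]; [case: v|rewrite iterS IH]. Qed.

Lemma Om_prodm (V1 V2 : gen_module A) mu (v : prodm V1 V2) :
  Om (prodm V1 V2) mu v <-> Om V1 mu v.1 /\ Om V2 mu v.2.
Proof.
split=> [/OmP[h1 h2]|[/OmP[h1 h2] /OmP[h3 h4]]].
  split; apply/OmP; split=> [a n n0|a].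
  - by have := h1 a n n0; rewrite heis_prodm => -[].
  - by have := h2 a; rewrite heis_prodm => -[].
  - by have := h1 a n n0; rewrite heis_prodm => -[].
  - by have := h2 a; rewrite heis_prodm => -[].
apply/OmP; split=> [a n n0|a]; rewrite heis_prodm.
  by rewrite h1 // h3.
by rewrite h2 h4.
Qed.

Lemma Om0 (V : gen_module A) mu : Om V mu 0.
Proof. by case: (Om_subspace V mu). Qed.

Lemma in_O_prodm (V1 V2 : gen_module A) :
  in_O tilde sigmahat V1 -> in_O tilde sigmahat V2 -> in_O tilde sigmahat (prodm V1 V2).
Proof.
move=> [t1 [_ ex1 un1] UH1] [t2 [_ ex2 un2] UH2]; split; first exact: twisted_prodm.
- have WP xi (v : prodm V1 V2) : weight_space tilde xi v <->
      weight_space tilde xi v.1 /\ weight_space tilde xi v.2.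
    split=> [H|[H1 H2] u]; last by rewrite heis_prodm H1 H2.
    by split=> u; have := H u; rewrite heis_prodm => -[].
  split=> [xi _|v|w ww wf w0 xi _]; first exact: weight_subspace.
    have [w1 [ww1 wf1 e1]] := ex1 v.1; have [w2 [ww2 wf2 e2]] := ex2 v.2.
    exists (fun xi => (w1 xi, w2 xi) : prodm V1 V2); split.
    - by move=> xi _; apply/WP; split; [exact: ww1|exact: ww2].
    - apply: (sub_finite_set (B := [set i | setT i /\ w1 i <> 0] `|` [set i | setT i /\ w2 i <> 0])).
        move=> i /= [_ nz]; case: (pselect (w1 i = 0)) => [h1|h1]; last by left.
        by right; split=> // h2; apply: nz; rewrite h1 h2.
      by rewrite finite_setU.
    - by rewrite pair_fsum //= -e1 -e2; case: (v).
  have wf1 : finite_set [set i | [set: h0_dual L] i /\ (w i).1 <> 0].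
    by apply: sub_finite_set wf => i /= [_ nz]; split=> // h0; apply: nz; rewrite h0.
  have wf2 : finite_set [set i | [set: h0_dual L] i /\ (w i).2 <> 0].
    by apply: sub_finite_set wf => i /= [_ nz]; split=> // h0; apply: nz; rewrite h0.
  rewrite pair_fsum // in w0; case: w0 => s1 s2.
  rewrite [w xi]surjective_pairing (un1 (fun i => (w i).1)) // => [|i _].
    by rewrite (un2 (fun i => (w i).2)) // => i _; have [] := (WP _ _).1 (ww i Logic.I).
  by have [] := (WP _ _).1 (ww i Logic.I).
apply/seteqP; split=> // v _.
have : [set: V1] v.1 by []; rewrite -UH1 => -[s1 [vac1 e1]].
have : [set: V2] v.2 by []; rewrite -UH2 => -[s2 [vac2 e2]].
have f1 q (x : V1) : foldr (fun q (u : prodm V1 V2) => heis tilde q.1 q.2 u) (x, 0 : V2) q =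
    (foldr (fun q u => heis tilde q.1 q.2 u) x q, 0).
  elim: q => [//|q s IH]; rewrite /= IH.
  by apply: (congr2 pair) => //; exact: (lin0 (heis_lin _ _)).
have f2 q (x : V2) : foldr (fun q (u : prodm V1 V2) => heis tilde q.1 q.2 u) (0 : V1, x) q =
    (0, foldr (fun q u => heis tilde q.1 q.2 u) x q).
  elim: q => [//|q s IH]; rewrite /= IH.
  by apply: (congr2 pair) => //; exact: (lin0 (heis_lin _ _)).
exists ([seq (x.1, (x.2, 0 : V2) : prodm V1 V2) | x <- s1] ++
        [seq (x.1, (0 : V1, x.2) : prodm V1 V2) | x <- s2]); split.
  move=> x; rewrite mem_cat => /orP[] /mapP[y ys ->] a n n0; rewrite heis_prodm /=.
    by rewrite (vac1 _ ys) // (lin0 (heis_lin _ _)).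
  by rewrite (vac2 _ ys) // (lin0 (heis_lin _ _)).
rewrite big_cat !big_map /=; under eq_bigr do rewrite f1.
under [X in _ + X]eq_bigr do rewrite f2.
rewrite [LHS]surjective_pairing e1 e2 [RHS]surjective_pairing; congr (_, _).
  rewrite /= !(lin_sum (@fst_lin _ V1 V2)) /= [X in _ + X]big1 ?addr0 //.
rewrite /= !(lin_sum (@snd_lin _ V1 V2)) /= [X in X + _]big1 ?add0r //.
Qed.

(** In the product of V0 and V the scalar is the same on (v0, 0) and on (0, v), which carries it
    from V0 to every V. If no twisted module has a nonzero vector in [Om] at mu, the choice of l is
    immaterial. *)
Lemma Uop_pow_univ mu g : Lperp g -> exists l : R[i], forall V : gen_module A,
  twisted sigmahat V -> forall v, Om V mu v -> iter p (Uop mu g) v = exp2pii l *: v.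
Proof.
move=> Lg; case: (pselect (exists V0 : gen_module A, twisted sigmahat V0 /\
    exists v0, Om V0 mu v0 /\ v0 <> 0)) => [[V0 [t0 [v0 [v0O v00]]]]|no]; last first.
  exists 0 => V Vt v vO; have -> : v = 0.
    by apply: contrapT => v0; apply: no; exists V; split=> //; exists v.
  by rewrite (lin0 (lin_iter _ (Uop_lin _ _))) scaler0.
have [c c0 cE] := Uop_pow t0 mu Lg; have [l lE] := exp2pii_surj c0.
exists l => V Vt v vO; have [d d0 dE] := Uop_pow (twisted_prodm t0 Vt) mu Lg.
have dE1 : iter p (Uop mu g) v0 = d *: v0.
  have vO' : Om (prodm V0 V) mu (v0, 0) by apply/Om_prodm; split=> //; exact: Om0.
  by have /(congr1 fst) := dE _ vO'; rewrite iter_Uop_prodm.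
have -> : exp2pii l = d.
  rewrite lE; have := dE1; rewrite cE // => /eqP; rewrite -subr_eq0 -scalerBl scaler_eq0.
  by rewrite subr_eq0 => /orP[/eqP //|/eqP].
have vO' : Om (prodm V0 V) mu (0, v) by apply/Om_prodm; split=> //; exact: Om0.
by have /(congr1 snd) := dE _ vO'; rewrite iter_Uop_prodm.
Qed.

(** Quantified over all twisted modules, so that a maximal isotropic set, and with it the labels of
    irreducible modules, depends on mu alone. *)
Definition comm mu (g d : h) : Prop := forall V : gen_module A, twisted sigmahat V ->
  forall v, Om V mu v -> Uop mu g (Uop mu d v) = Uop mu d (Uop mu g v).

(** In the product of V0 and V one commutation constant serves both factors, and the nonzero vector
    v0 forces it to be 1. *)
Lemma comm_of_one mu g d (V0 : gen_module A) (v0 : V0) : twisted sigmahat V0 ->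
  Lperp g -> Lperp d -> Om V0 mu v0 -> v0 <> 0 ->
  Uop mu g (Uop mu d v0) = Uop mu d (Uop mu g v0) -> comm mu g d.
Proof.
move=> t0 Lg Ld v0O v00 e V Vt v vO.
have [c c0 cE] := perp_swap (twisted_prodm t0 Vt) mu Ld Lg.
have c1 : c = 1.
  have : Uop mu g (Uop mu d v0) = c *: Uop mu d (Uop mu g v0).
    have vO' : Om (prodm V0 V) mu (v0, 0) by apply/Om_prodm; split=> //; exact: Om0.
    by have /(congr1 fst) := cE _ vO'.
  rewrite -e -{1}[Uop mu g _]scale1r => /eqP; rewrite -subr_eq0 -scalerBl scaler_eq0 subr_eq0.
  move=> /orP[/eqP <- //|/eqP]; have dO := Uop_perp t0 Ld v0O.
  move/(Uop_inj t0 (Lperp_Lam Lg) dO)/(Uop_inj t0 (Lperp_Lam Ld) v0O); exact: (fun h => False_ind _ (v00 h)).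
have vO' : Om (prodm V0 V) mu (0, v) by apply/Om_prodm; split=> //; exact: Om0.
by have /(congr1 snd) := cE _ vO'; rewrite c1 scale1r.
Qed.

Lemma max_isotropic mu : exists I : set h, [/\ I `<=` Lperp,
  forall g d, I g -> I d -> comm mu g d &
  forall g, Lperp g -> (forall d, I d -> comm mu g d) -> I g].
Proof.
pose P (I : set h) := I `<=` Lperp /\ forall g d, I g -> I d -> comm mu g d.
have [F FP tot|I [[IL Ic] Imax]] := @Zorn_bigcup h P.
  split=> [g [J FJ Jg]|g d [J FJ Jg] [K FK Kd]]; first exact: (FP J FJ).1.
  have [JK|KJ] := tot J K FJ FK; first exact: (FP K FK).2 (JK _ Jg) Kd.
  exact: (FP J FJ).2 Jg (KJ _ Kd).
exists I; split=> // g Lg gI; apply: contrapT => nIg.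
apply: (Imax (I `|` [set g])); first by split; [left|move=> /(_ g); apply/not_implyP; split=> //; right].
split=> [x [/IL //|-> //]|x y [Ix|->] [Iy|->]] //.
- exact: Ic.
- by move=> V Vt v vO; rewrite (gI x).
- exact: gI.
Qed.

Lemma eigen_irreducible (V : gen_module A) mu (I : set h) (v0 : V) :
  in_O tilde sigmahat V -> I `<=` Lperp ->
  (forall g, Lperp g -> (forall d, I d -> comm mu g d) -> I g) ->
  Om V mu v0 -> v0 <> 0 -> (forall d, I d -> exists c : R[i], Uop mu d v0 = c *: v0) ->
  irreducible_submodule (gen_sub mu v0).
Proof.
move=> VO IL Imax v0O v00 Iv; have V_tw : twisted sigmahat V by case: VO.
split; first exact: gen_sub_submodule V_tw _ _ v0O.
  by exists v0; split=> //; exact: gen_sub_self.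
move=> U US UG; have [Usub Uact] := US.
case: (pselect (exists x, U x /\ x <> 0)) => [exU|nU]; last first.
  left; apply/seteqP; split=> [x Ux|x ->]; last exact: sub0.
  by apply: contrapT => x0; apply: nU; exists x.
right; apply/seteqP; split=> //; apply: gen_sub_min => //.
have [nu0 [x0 [x0O x00 Ux0]]] := O_lowest VO US exU.
have [s0 [Ls0 x0E]] := gen_sub_vacuum V_tw v0O (UG _ Ux0) x0O.1.
pose P1 nu (s : seq (R[i] * h)) (y : V) := (forall q, q \in s -> Lam L q.2 /\ mu + flat q.2 = nu) /\
  y = \sum_(q <- s) q.1 *: Uop mu q.2 v0.
have P1O nu s y : P1 nu s y -> Om V nu y.
  move=> [sP ->]; apply: sub_sum_seq => [|q /sP[Lq <-]]; first exact: Om_subspace.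
  by apply: subZ; [exact: Om_subspace|exact: Uop_Om].
have [|||||x [x'0 [nu [s P1x]] Ux]] := @eigen_pick _ V U [set y | exists nu s, P1 nu s y] Usub _ _
    [seq q.1 *: Uop mu q.2 v0 | q <- s0].
- move=> c y [nu [s [sP ->]]]; exists nu, [seq (c * q.1, q.2) | q <- s]; split.
    by move=> q /mapP[q' /sP q'P ->].
  by rewrite big_map scaler_sumr; apply: eq_bigr => q _; rewrite scalerA.
- move=> y z [nu1 [s1 Py]] [nu2 [s2 Pz]]; case: (pselect (nu1 = nu2)) => [e|ne].
    left; exists nu1, (s1 ++ s2); split; last by rewrite big_cat Py.2 Pz.2.
    by move=> q; rewrite mem_cat => /orP[/Py.1 //|/Pz.1]; rewrite e.
  right; have [a an] : exists a, ev nu1 a <> ev nu2 a.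
    by apply/existsNP => H; apply: ne; exact: ev_inj.
  exists (heis tilde a 0); split; [exact: heis_lin|by move=> w; exact: Uact| |].
    by move=> w [xi [s /P1O/OmP[_ we]]]; exists (ev xi a).
  exists (ev nu1 a), (ev nu2 a); split; first exact/eqP.
    by have [_ ->] := (OmP _ _).1 (P1O _ _ _ Py).
  by have [_ ->] := (OmP _ _).1 (P1O _ _ _ Pz).
- move=> y /mapP[q qs ->]; exists (mu + flat q.2), [:: q]; split; last by rewrite big_seq1.
  by move=> q'; rewrite inE => /eqP ->; split=> //; exact: Ls0.
- by rewrite big_map -x0E.
- by rewrite big_map -x0E.
have xO := P1O _ _ _ P1x; case: P1x => sP xE.
case: s => [|q0 s] in sP xE; first by rewrite big_nil in xE.
have [Lq0 nuE] := sP q0 (mem_head _ _).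
set s1 := q0 :: s in sP xE.
(* All labels in [s1] have the same image under [flat], so they differ from q0 by elements of Lperp;
   U_(- q0) brings every term back to the weight mu. *)
have yE : Uop nu (- q0.2) x = \sum_(y <- [seq q.1 *: Uop nu (- q0.2) (Uop mu q.2 v0) | q <- s1]) y.
  rewrite big_map xE (lin_sum (Uop_lin _ _)); apply: eq_bigr => q _.
  by rewrite (linZ (Uop_lin _ _)).
have y0 : Uop nu (- q0.2) x <> 0.
  by move/(Uop_inj V_tw (LamN Lq0) xO).
have [|||||z [z0 [c [g [Lg zE]]] Uz]] := @eigen_pick _ V U
  [set y | exists c g, Lperp g /\ y = c *: Uop mu g v0] Usub _ _
  [seq q.1 *: Uop nu (- q0.2) (Uop mu q.2 v0) | q <- s1].
- by move=> c y [d [g [Lg ->]]]; exists (c * d), g; rewrite scalerA.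
- move=> _ _ [ca [a [La ->]]] [cb [b [Lb ->]]].
  have eigI d g : I d -> Lperp g -> exists l : R[i], Uop mu d (Uop mu g v0) = l *: Uop mu g v0.
    move=> Id Lg; have [e _ ->] := perp_swap V_tw mu Lg (IL _ Id); last by [].
    by have [k ->] := Iv d Id; exists (e * k); rewrite (linZ (Uop_lin _ _)) scalerA.
  case: (pselect (exists d la lb, [/\ I d, la != lb :> R[i],
      Uop mu d (Uop mu a v0) = la *: Uop mu a v0 & Uop mu d (Uop mu b v0) = lb *: Uop mu b v0])).
    move=> [d [la [lb [Id lab aE bE]]]]; right; exists (Uop mu d); split.
    + exact: Uop_lin.
    + by move=> w; exact: Uact.
    + move=> w [k [g [Lg ->]]]; have [l lE] := eigI d g Id Lg; exists l.
      by rewrite (linZ (Uop_lin _ _)) lE !scalerA mulrC.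
    exists la, lb; split=> //.
      by rewrite (linZ (Uop_lin _ _)) aE !scalerA mulrC.
    by rewrite (linZ (Uop_lin _ _)) bE !scalerA mulrC.
  (* No d in I separates the two translates. Then U_(b - a) commutes with I on the vector U_a v0, so
     b - a lies in I; v0 is an eigenvector of U_(b - a), and the translates are proportional. *)
  move=> nd; left; have Lba : Lperp (b - a) by exact: LperpB.
  have Iba : I (b - a).
    apply: Imax => // d Id; have Ld := IL _ Id; have wO := Uop_perp V_tw La v0O.
    have w0 : Uop mu a v0 <> 0 by move/(Uop_inj V_tw (Lperp_Lam La) v0O).
    apply: (comm_of_one V_tw Lba Ld wO w0).
    have [k _ kE] := perp_mul V_tw mu La (Lperp_Lam Lba).
    have eab : a + (b - a) = b by rewrite addrC subrK.
    rewrite eab in kE; rewrite kE //.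
    have [la laE] := eigI d a Id La; have [lb lbE] := eigI d b Id Lb.
    have lab : la = lb.
      by apply/eqP; apply: contrapT => /negP ne; apply: nd; exists d, la, lb.
    rewrite (linZ (Uop_lin _ _)) laE lbE (linZ (Uop_lin _ _)) -lab.
    by rewrite kE // !scalerA mulrC.
  have [k kE] := Iv _ Iba; have [e e0 eE] := perp_mul V_tw mu Lba (Lperp_Lam La).
  have := eE _ v0O; rewrite kE subrK (linZ (Uop_lin _ _)) => bE.
  exists (ca + cb * (e^-1 * k)), a; split=> //.
  by rewrite scalerDl -!scalerA bE (scalerK e0).
- move=> y /mapP[q qs ->]; have [Lq qE] := sP q qs.
  have [k _ kE] := Uop_mul V_tw mu Lq (LamN Lq0); rewrite qE in kE.
  exists (q.1 * k), (q.2 - q0.2); split; last by rewrite kE // scalerA.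
  split; first exact: LamB.
  rewrite linearB /=; apply/eqP; rewrite subr_eq0; apply/eqP/flat_inj/(addrI mu).
  by rewrite qE nuE.
- by rewrite -yE; exact: Uact.
- by rewrite -yE.
have c0 : c != 0 by apply/eqP => c0; apply: z0; rewrite zE c0 scale0r.
rewrite zE in Uz; have Ug := subZ_inv Usub c0 Uz.
have [k k0 kE] := Uop_inv V_tw mu (Lperp_Lam Lg).
by apply: (subZ_inv Usub k0); rewrite -kE //; exact: Uact.
Qed.

(** * Finitely many generators and their joint eigenvectors *)

Local Notation r := (\dim (fullv : {vspace h})).

Lemma residue_map (m : nat) : (0 < m)%N -> exists rs : h -> {ffun 'I_r -> 'I_m},
  forall a b, Lam L a -> Lam L b -> rs a = rs b -> exists2 c, Lam L c & a - b = c *+ m.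
Proof.
move=> m0; have m0' : m%:Z != 0 by rewrite eqz_nat -lt0n.
have mlt (n : int) : (absz (n %% m)%Z < m)%N.
  by rewrite -ltz_nat gez0_abs ?modz_ge0 // ltz_pmod.
have ex a : exists f : {ffun 'I_r -> 'I_m}, Lam L a -> exists x : 'I_r -> int,
    a = \sum_(i < r) (ld_basis L)`_i *~ x i /\ forall i, (x i %% m)%Z = (f i : nat)%:Z.
  case: (pselect (Lam L a)) => [[x xE]|na]; last by exists [ffun=> Ordinal m0].
  exists [ffun i => Ordinal (mlt (x i))] => _; exists x; split=> // i.
  by rewrite ffunE /= gez0_abs ?modz_ge0.
have [rs rsP] := choice ex; exists rs => a b La Lb e.
have [x [aE xr]] := rsP a La; have [y [bE yr]] := rsP b Lb.
exists (\sum_(i < r) (ld_basis L)`_i *~ ((x i %/ m)%Z - (y i %/ m)%Z)).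
  by exists (fun i => (x i %/ m)%Z - (y i %/ m)%Z).
rewrite aE bE -sumrB -sumrMnl; apply: eq_bigr => i _.
rewrite -mulrzBr [in RHS]pmulrn -mulrzA; congr (_ *~ _).
rewrite {1}(divz_eq (x i) m) {1}(divz_eq (y i) m) xr yr e mulrBl; ring.
Qed.

(** Two elements of I congruent modulo p Lam differ by p e, where e lies in Lperp because p e^[0] =
    0, so U_(p e) is a scalar. One representative for each class that meets I is therefore enough;
    the other classes get the default 0, an element of I. *)
Lemma isotropic_gens mu (I : set h) : I `<=` Lperp ->
  (forall g, Lperp g -> (forall d, I d -> comm mu g d) -> I g) ->
  exists G : {ffun 'I_r -> 'I_p} -> h, (forall t, I (G t)) /\
    forall V : gen_module A, twisted sigmahat V -> forall v, Om V mu v ->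
      (forall t, exists c : R[i], Uop mu (G t) v = c *: v) ->
      forall d, I d -> exists c : R[i], Uop mu d v = c *: v.
Proof.
move=> IL Imax; have [rs rsP] := residue_map (p_gt0 L).
have I0 : I 0.
  apply: Imax => [|d _ V Vt v vO]; first exact: Lperp0.
  by rewrite !Uop0 (linZ (Uop_lin _ _)).
have ex t : exists g, I g /\ ((exists2 g', I g' & rs g' = t) -> rs g = t).
  case: (pselect (exists2 g', I g' & rs g' = t)) => [[g Ig <-]|no]; first by exists g.
  by exists 0.
have [G GP] := choice ex; exists G; split=> [t|V Vt v vO Gv d Id]; first by case: (GP t).
have [Ig rg] := GP (rs d); have /rg {}rg : exists2 g', I g' & rs g' = rs d by exists d.
have [Ld d0] := IL _ Id; have [Lg g0] := IL _ Ig.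
have [e Le eE] := rsP _ _ Ld Lg (esym rg).
have {}Le : Lperp e.
  split=> //; have : p%:R *: lproj L 0 e = 0.
    by rewrite scaler_nat -linearMn -eE linearB /= d0 g0 subrr.
  by move/eqP; rewrite scaler_eq0 (negbTE (p_neq0 L)) => /eqP.
have [c _ cE] := Uop_mulp Vt mu Le; have [k kE] := Gv (rs d).
have [f f0 fE] := perp_mul Vt mu (IL _ Ig) (LamMn p (Lperp_Lam Le)).
have := fE _ vO; rewrite kE (linZ (Uop_lin _ _)) cE // -eE addrC subrK => fE'.
by exists (f^-1 * (k * c)); rewrite -scalerA -[(k * c) *: v]scalerA fE' scalerA mulVf ?scale1r.
Qed.

(** Splitting a vector outside S into eigenvectors leaves at least one of them outside S. These are
    polynomials in the operator applied to the vector, so the eigenvalues of the commuting operators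
    treated earlier survive. S will be a sum of submodules or zero. *)
Lemma joint_eigenvector (V : gen_module A) mu (T : finType) (G : T -> h) (l : T -> R[i]) :
  twisted sigmahat V -> (forall t, Lperp (G t)) -> (forall s t, comm mu (G s) (G t)) ->
  (forall t v, Om V mu v -> iter p (Uop mu (G t)) v = exp2pii (l t) *: v) ->
  forall (S : set V) v, subspace S -> Om V mu v -> ~ S v ->
  exists v' (j : {ffun T -> 'I_p}), [/\ Om V mu v', ~ S v' &
    forall t, Uop mu (G t) v' = exp2pii ((l t + (j t)%:R) / p%:R) *: v'].
Proof.
move=> Vt GL Gc Gp S v SS vO nSv.
suff [v' [v'O nSv' vE]] : exists v', [/\ Om V mu v', ~ S v' & forall t, t \in enum T ->
    exists j : 'I_p, Uop mu (G t) v' = exp2pii ((l t + j%:R) / p%:R) *: v'].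
  have /choice[j jE] : forall t, exists j : 'I_p,
      Uop mu (G t) v' = exp2pii ((l t + j%:R) / p%:R) *: v'.
    by move=> t; apply: vE; rewrite mem_enum.
  by exists v', (finfun j); split=> // t; rewrite ffunE.
elim: (enum T) => [|t s [u [uO nSu uE]]]; first by exists v.
have [w [wsum wE [a aE]]] := eigen_split (p_gt0 L) (@Uop_lin V mu (G t)) (Gp t u uO).
have [j nSw] : exists j : 'I_p, ~ S (w j).
  apply/existsNP => H; apply: nSu; rewrite wsum; apply: sub_sum => // i _; exact: H.
have itO i := Uop_iter_Om Vt i (GL t) uO.
exists (w j); split=> //.
  by rewrite aE; apply: sub_sum => [|i _]; [exact: Om_subspace|apply: subZ; [exact: Om_subspace|exact: itO]].
move=> t'; rewrite inE => /orP[/eqP ->|t's]; first by exists j.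
have [k kE] := uE t' t's; exists k; rewrite aE (lin_sum (Uop_lin _ _)) scaler_sumr.
apply: eq_bigr => i _; rewrite (linZ (Uop_lin _ _)) scalerA mulrC -scalerA; congr (_ *: _).
elim: (nat_of_ord i) => [|i' IH] //=.
by rewrite (Gc t' t _ Vt _ (itO i')) IH (linZ (Uop_lin _ _)).
Qed.

Local Notation codes := {ffun {ffun 'I_r -> 'I_p} -> 'I_p}.

(** A code selects, for each generator, one p-th root of the scalar U_(G t)^p. The generators and
    scalars are fixed before any module is considered, so codes can be compared across modules and
    pass to products. *)
Lemma weight_codes mu : exists code : forall V : gen_module A, V -> codes -> Prop,
  [/\ forall V : gen_module A, twisted sigmahat V -> forall (S : set V) v, subspace S ->
        Om V mu v -> ~ S v -> exists v' j, [/\ Om V mu v', ~ S v' & code V v' j],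
      forall V : gen_module A, in_O tilde sigmahat V -> forall v j, Om V mu v -> v <> 0 ->
        code V v j -> irreducible_submodule (gen_sub mu v) &
      forall (V V' : gen_module A) v v' j, code V v j -> code V' v' j ->
        code (prodm V V') (v, v') j].
Proof.
have [I [IL Ic Imax]] := max_isotropic mu; have [G [GI Geig]] := isotropic_gens IL Imax.
have /choice[l lP] := fun t => Uop_pow_univ mu (IL _ (GI t)).
exists (fun (V : gen_module A) (v : V) (j : codes) => forall t, Uop mu (G t) v = exp2pii ((l t + (j t)%:R) / p%:R) *: v); split.
- move=> V Vt S v SS vO nSv; apply: (joint_eigenvector (l := l) Vt _ _ _ SS vO nSv).
  + by move=> t; apply: IL.
  + by move=> s t; apply: Ic.
  + by move=> t u uO; apply: lP.
- move=> V VO v j vO v0 vE; apply: (eigen_irreducible VO IL Imax vO v0).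
  by case: VO => Vt _ _; apply: Geig => // t; rewrite vE; eexists.
- by move=> V V' v v' j vE v'E t; rewrite Uop_prodm vE v'E.
Qed.

(** W is the graph of the isomorphism: its projections are nonzero submodules, hence everything, and
    its intersections with the two factors are proper in W, hence zero. *)
Lemma prodm_iso (V V' : gen_module A) (W : set (prodm V V')) v v' :
  irreducible_module V -> irreducible_module V' -> irreducible_submodule W ->
  W (v, v') -> v <> 0 -> v' <> 0 -> module_iso V V'.
Proof.
move=> [_ _ Vi] [_ _ Vi'] [[Ws Wact] _ Wi] Wv v0 v'0.
have ex1 x : exists y, W (x, y).
  have [] := Vi [set x | exists y, W (x, y)] => //.
  - split=> [|a n z [y Wzy]]; last by exists (gm_act a n y); exact: (Wact a n _ Wzy).
    split; first by exists 0; exact: (sub0 Ws).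
    by move=> c x1 x2 [y1 W1] [y2 W2]; exists (c *: y1 + y2); exact: (Ws.2 c _ _ W1 W2).
  - by move=> e; have : [set x | exists y, W (x, y)] v by [exists v']; rewrite e.
  - by move=> e; have : [set: V] x by []; rewrite -e.
have ex2 y : exists x, W (x, y).
  have [] := Vi' [set y | exists x, W (x, y)] => //.
  - split=> [|a n z [x Wxz]]; last by exists (gm_act a n x); exact: (Wact a n _ Wxz).
    split; first by exists 0; exact: (sub0 Ws).
    by move=> c y1 y2 [x1 W1] [x2 W2]; exists (c *: x1 + x2); exact: (Ws.2 c _ _ W1 W2).
  - by move=> e; have : [set y | exists x, W (x, y)] v' by [exists v]; rewrite e.
  - by move=> e; have : [set: V'] y by []; rewrite -e.
have un1 x y y' : W (x, y) -> W (x, y') -> y = y'.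
  move=> W1 W2; have [] := Wi [set z | W z /\ z.1 = 0].
  - split=> [|a n z [Wz z0]]; last by split; [exact: Wact|rewrite /= z0 (lin0 (act_lin _ _))].
    split; first by split; [exact: (sub0 Ws)|].
    by move=> c z1 z2 [Wz1 e1] [Wz2 e2]; split; [exact: Ws.2|rewrite /= e1 e2 scaler0 addr0].
  - by move=> z [].
  - move=> e; have : [set z | W z /\ z.1 = 0] (0, y - y').
      split=> //; rewrite (_ : (0, y - y') = ((x, y) : prodm V V') - (x, y')); first exact: subB.
      exact: (congr2 pair (esym (subrr x)) erefl).
    by rewrite e => -[/eqP]; rewrite subr_eq0 => /eqP.
  - by move=> e; have : W (v, v') by []; rewrite -e => -[_ /v0].
have un2 x x' y : W (x, y) -> W (x', y) -> x = x'.
  move=> W1 W2; have [] := Wi [set z | W z /\ z.2 = 0].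
  - split=> [|a n z [Wz z0]]; last by split; [exact: Wact|rewrite /= z0 (lin0 (act_lin _ _))].
    split; first by split; [exact: (sub0 Ws)|].
    by move=> c z1 z2 [Wz1 e1] [Wz2 e2]; split; [exact: Ws.2|rewrite /= e1 e2 scaler0 addr0].
  - by move=> z [].
  - move=> e; have : [set z | W z /\ z.2 = 0] (x - x', 0).
      split=> //; rewrite (_ : (x - x', 0) = ((x, y) : prodm V V') - (x', y)); first exact: subB.
      exact: (congr2 pair erefl (esym (subrr y))).
    by rewrite e => -[/eqP]; rewrite subr_eq0 => /eqP.
  - by move=> e; have : W (v, v') by []; rewrite -e => -[_ /v'0].
have /choice[f fW] := ex1; have /choice[g gW] := ex2; exists f; split.
- by move=> c x y; apply: (un1 (c *: x + y)) => //; exact: (Ws.2 c _ _ (fW x) (fW y)).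
- exists g => x; first exact: (un2 _ _ (f x)).
  exact: (un1 (g x)).
- by move=> a n x; apply: (un1 (gm_act a n x)) => //; exact: (Wact a n _ (fW x)).
Qed.

(** * Complete reducibility *)

Section Semisimple.
Variable V : gen_module A.

Definition independent (F : set (set V)) := forall s : seq (set V * V),
  uniq (map fst s) -> (forall q, q \in s -> F q.1 /\ q.1 q.2) ->
  \sum_(q <- s) q.2 = 0 -> forall q, q \in s -> q.2 = 0.

Definition family_sum (F : set (set V)) : set V := [set x | exists s : seq (set_type F * V),
  (forall q, q \in s -> (set_val q.1) q.2) /\ x = \sum_(q <- s) q.2].

Lemma max_independent (P : set (set V)) : exists F, [/\ F `<=` P, independent F &
  forall F', F' `<=` P -> independent F' -> F `<=` F' -> F' `<=` F].
Proof.
have [C CP tot|F [[FP Fi] Fmax]] := @Zorn_bigcup (set V) [set F | F `<=` P /\ independent F].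
  split=> [W [Y CY YW]|s us sC]; first exact: (CP Y CY).1.
  (* A finite sequence in the union of a chain already lies in one member. *)
  have [->|[Z CZ sZ]] : s = [::] \/ exists2 Z, C Z & forall q, q \in s -> Z q.1.
  - elim: s {us} sC => [|q s IH] sC; [by left|right].
    have [[Z CZ Zq] _] := sC q (mem_head _ _).
    have [q' q's|e|[Y CY sY]] := IH; first by apply: sC; rewrite inE q's orbT.
      by exists Z => // q'; rewrite e inE => /eqP ->.
    have [ZY|YZ] := tot Z Y CZ CY.
      by exists Y => // q'; rewrite inE => /orP[/eqP ->|/sY //]; exact: ZY.
    by exists Z => // q'; rewrite inE => /orP[/eqP ->|/sY /YZ].
  - by [].
  by apply: (CP Z CZ).2 => // q qs; split; [exact: sZ|case: (sC q qs)].
exists F; split=> // F' F'P F'i FF'; apply: contrapT => nF.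
by apply: (Fmax F'); split.
Qed.

Lemma family_sum_subspace F : (forall W, F W -> subspace W) -> subspace (family_sum F).
Proof.
move=> FS; split; first by exists [::]; rewrite big_nil.
move=> c _ _ [s [Ps ->]] [t [Pt ->]]; exists ([seq (q.1, c *: q.2) | q <- s] ++ t); split.
  move=> q; rewrite mem_cat => /orP[/mapP[q' /Ps q'P ->]|/Pt //].
  by apply: subZ => //; apply: FS; exact: set_valP.
by rewrite big_cat big_map scaler_sumr.
Qed.

Lemma family_sum_mem (F : set (set V)) W x : F W -> W x -> family_sum F x.
Proof.
move=> FW Wx; exists [:: (exist _ W (mem_set FW), x)]; rewrite big_seq1; split=> // q.
by rewrite inE => /eqP ->.
Qed.

Lemma independent_setU1 (F : set (set V)) W : (forall W, F W -> subspace W) -> independent F ->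
  subspace W -> (forall x, family_sum F x -> W x -> x = 0) ->
  independent (F `|` [set W]).
Proof.
move=> FS Fi WS Wd s us sP s0; have SS := family_sum_subspace FS.
have [/mapP[q qs qE]|nW] := boolP (W \in map fst s); last first.
  apply: Fi => // q qs; have [[Fq|e] qq] := sP q qs; first by split.
  by case/negP: nW; rewrite -(e : q.1 = W); exact: map_f.
have pq := perm_to_rem qs; rewrite (perm_big _ pq) /= big_cons /= in s0.
have := us; rewrite (perm_uniq (perm_map _ pq)) /= => /andP[nq ur].
have remP q' : q' \in rem q s -> F q'.1 /\ q'.1 q'.2.
  move=> q'r; have [[Fq'|e] q'q'] := sP q' (mem_rem q'r); first by split.
  by case/negP: nq; rewrite -qE -(e : q'.1 = W); exact: map_f.
have q0 : q.2 = 0.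
  apply: Wd; last by rewrite qE; case: (sP q qs).
  move/eqP: s0; rewrite addr_eq0 => /eqP ->; rewrite -scaleN1r; apply: subZ => //.
  by apply: sub_sum_seq => // q' /remP[Fq' q'q']; exact: family_sum_mem q'q'.
rewrite q0 add0r in s0 => q'; rewrite (perm_mem pq) inE => /orP[/eqP -> //|q'r].
exact: (Fi _ ur remP s0).
Qed.

Lemma independent_direct_sum (F : set (set V)) : (forall W, F W -> subspace W) ->
  independent F -> (forall x, family_sum F x) ->
  direct_sum [set: set_type F] (fun i => set_val i : set V).
Proof.
move=> FS Fi all; split=> [i _|x|w wW wf w0 i _]; first by apply: FS; exact: set_valP.
- have [s [Ps ->]] := all x; set rs := undup (map fst s).
  have w0 i : i \notin rs -> \sum_(q <- s | q.1 == i) q.2 = 0.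
    rewrite mem_undup => ns; rewrite big_seq_cond big1 // => q /andP[qs /eqP e].
    by case/negP: ns; rewrite -e; exact: map_f.
  exists (fun i => \sum_(q <- s | q.1 == i) q.2); split.
  + move=> i _; have iS : subspace (set_val i : set V) by apply: FS; exact: set_valP.
    rewrite big_seq_cond; apply: (sub_sum iS) => q /andP[qs /eqP <-].
    exact: Ps.
  + apply: (sub_finite_set (B := [set` rs])); last exact: finite_seq.
    by move=> i /= [_ nz]; apply: contrapT => /negP /w0.
  + rewrite (fsum_seq (r := rs)) ?undup_uniq // => [|i _]; last exact: w0.
    rewrite (exchange_big_dep xpredT) //= big_seq [RHS]big_seq; apply: eq_bigr => q qs.
    rewrite big_mkcond /= (bigD1_seq q.1) ?undup_uniq ?mem_undup ?map_f //= eqxx.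
    by rewrite big1 ?addr0 // => i /negbTE; rewrite eq_sym => ->.
have [rs [ur rP rE]] := fsum_supp_seq wf; rewrite rE in w0.
case: (pselect (w i = 0)) => // wi0.
apply: (Fi [seq (set_val j, w j) | j <- rs] _ _ _ (set_val i, w i)).
- by rewrite -map_comp map_inj_uniq //; exact: val_inj.
- move=> q /mapP[j _ ->]; split; first exact: set_valP.
  exact: wW.
- by rewrite big_map.
- by apply/mapP; exists i => //; apply/rP.
Qed.

Lemma O_semisimple : in_O tilde sigmahat V ->
  exists (I : choiceType) (W : I -> set V),
    (forall i, irreducible_submodule (W i)) /\ direct_sum [set: I] W.
Proof.
move=> VO; have Vt : twisted sigmahat V by case: VO.
have [F [Firr Fi Fmax]] := max_independent (@irreducible_submodule R A V).
have FS W : F W -> subspace W by move=> /Firr[[]].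
have SS := family_sum_subspace FS.
have Sact a n u : family_sum F u -> family_sum F (gm_act a n u).
  move=> [s [Ps ->]]; rewrite (lin_sum (act_lin _ _)); apply: sub_sum_seq => // q qs.
  have [[_ Wact] _ _] := Firr _ (set_valP q.1).
  by apply: (family_sum_mem (set_valP q.1)); apply: Wact; exact: Ps.
exists (set_type F), (fun i => set_val i); split; first by move=> i; apply: Firr; exact: set_valP.
apply: independent_direct_sum => //; apply: (O_gen VO SS) => [a n u|mu v vO]; first exact: Sact.
(* A vacuum vector outside the sum yields a joint eigenvector outside it; the irreducible submodule
   generated by the latter meets the sum trivially and could be added to the maximal family. *)
apply: contrapT => nSv; have [code [ex irr _]] := weight_codes mu.
have [v' [j [v'O nSv' v'j]]] := ex V Vt _ _ SS vO nSv.
have v'0 : v' <> 0 by move=> e; apply: nSv'; rewrite e; exact: (sub0 SS).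
have Wirr := irr V VO v' j v'O v'0 v'j; set W := gen_sub mu v' in Wirr.
have Wv' : W v' by exact: gen_sub_self.
have [[WS Wact] _ Wmin] := Wirr.
apply: (nSv'); apply: (family_sum_mem (W := W)) => //.
apply: (Fmax (F `|` [set W])); [|apply: independent_setU1 => //|by move=> ?; left|by right].
  by move=> U [/Firr //|->].
move=> x Sx Wx; have [] := Wmin (family_sum F `&` W).
- split; last by move=> a n u [Su Wu]; split; [exact: Sact|exact: Wact].
  split; first by split; [exact: (sub0 SS)|exact: (sub0 WS)].
  by move=> c y z [Sy Wy] [Sz Wz]; split; [exact: SS.2|exact: WS.2].
- by move=> y [].
- by move=> e; have : (family_sum F `&` W) x by []; rewrite e.
- by move=> e; have : W v' by []; rewrite -e => -[/nSv'].
Qed.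

End Semisimple.

(** * Finiteness of the set of irreducible modules *)

Definition realized mu : Prop := exists V : gen_module A, in_O tilde sigmahat V /\
  exists v, Om V mu v /\ v <> 0.

Lemma ev_sum mu (I : Type) (s : seq I) (c : I -> R[i]) (F : I -> h) :
  ev mu (\sum_(i <- s) c i *: F i) = \sum_(i <- s) c i * ev mu (F i).
Proof.
by rewrite /ev !linear_sum; apply: eq_bigr => i _; rewrite !linearZ.
Qed.

(** A nonzero vector of a realized weight shows that sigmahat multiplies X_al by exp(2 pi i top).
    This eigenvalue belongs to the algebra, so [top] agrees modulo Z for both weights, and mu(al) is
    the only part of it that varies. *)
Lemma weight_int mu mu' al : realized mu -> realized mu' -> Lam L al -> sigma L al = al ->
  isint (ev mu al - ev mu' al).
Proof.
have E nu : realized nu -> Lam L al -> sigma L al = al ->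
    sigmahat (X al) = exp2pii (top nu al) *: X al.
  move=> [V [[Vt _ _] [v [vO v0]]]] Lal sal.
  have [f f0 [fE _ H]] := Uop_sigma Vt nu Lal.
  have := H v vO; rewrite fE sal => /eqP; rewrite -subr_eq0 -scalerBl scaler_eq0 subr_eq0.
  by move=> /orP[/eqP -> //|/eqP/(Uop_inj Vt Lal vO)].
move=> rm rm' Lal sal; have := E mu rm Lal sal; rewrite (E mu' rm' Lal sal) => /eqP.
rewrite -subr_eq0 -scalerBl scaler_eq0 subr_eq0 => /orP[/eqP/exp2pii_eq|/eqP/(X_neq0 Lal) //].
by rewrite (_ : _ - _ = ev mu al - ev mu' al) // /top; ring.
Qed.

(** The vector p b^[0] is the sum of the sigma^s b, so it lies in the lattice and is fixed by
    sigma. *)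
Lemma weight_int_basis mu mu' (i : 'I_r) : realized mu -> realized mu' ->
  isint (p%:R * (ev mu (ld_basis L)`_i - ev mu' (ld_basis L)`_i)).
Proof.
move=> rm rm'; set b := (ld_basis L)`_i.
have E nu : ev nu (p%:R *: lproj L 0 b) = p%:R * ev nu b.
  by have := ev_sum nu [:: tt] (fun=> p%:R) (fun=> lproj L 0 b); rewrite !big_seq1 ev_lproj0.
rewrite mulrBr -!E; apply: weight_int => //.
  by rewrite -sum_iter_sigma; apply: Lam_sum => s; apply: Lam_iter_sigma => //; exact: Lam_basis.
rewrite linearZ /= (sigma_part (k := 0%N)) ?p_gt0 ?lproj_mem //.
by rewrite mul0r exp2pii0 scale1r.
Qed.

(** The inverse of the integral Gram matrix is its adjugate divided by its determinant, whose
    absolute value serves as d. *)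
Lemma dual_basis_Lam : exists2 d : nat, (0 < d)%N &
  forall i, Lam L (d%:R *: dual_basis (L := L) i).
Proof.
pose Gz : 'M[int]_r := \matrix_(i, j) ipair (ld_basis L)`_i (ld_basis L)`_j.
have gE : gram L = map_mx intr Gz.
  by apply/matrixP => i j; rewrite !mxE form_int //; exact: Lam_basis.
have dE : \det (gram L) = (\det Gz)%:~R by rewrite gE det_map_mx.
have d0 : (\det Gz)%:~R != 0 :> R[i].
  by rewrite -dE -unitfE -unitmxE gram_unit.
have LdZ i : Lam L ((\det Gz)%:~R *: dual_basis i).
  exists (fun j => (\adj Gz) i j); rewrite /dual_basis scaler_sumr; apply: eq_bigr => j _.
  rewrite scalerA {1}/invmx gram_unit dE !mxE mulrA divff // mul1r -scaler_int.
  by congr (_ *: _); rewrite gE cofactor_map_mx.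
exists (absz (\det Gz)) => [|i]; first by rewrite absz_gt0; move: d0; rewrite intr_eq0.
move: (LdZ i); case: (\det Gz) => n //; rewrite NegzE mulrNz scaleNr => /LamN.
by rewrite opprK.
Qed.

(** For m = p d and a realized mu0, m (mu - mu0) is the image under [flat] of a lattice vector
    [lam mu]: p makes the values on the basis integral, and d clears the denominators of the dual
    basis. If two such vectors agree modulo m, dividing their difference by m gives c. *)
Lemma weight_classes : exists (K : finType) (cl : h0_dual L -> K),
  forall mu mu', realized mu -> realized mu' -> cl mu = cl mu' ->
    exists2 c, Lam L c & mu = mu' + flat c.
Proof.
case: (pselect (exists mu0, realized mu0)) => [[mu0 r0]|no]; last first.
  by exists unit, (fun=> tt) => mu mu' rmu; case: no; exists mu.
have [d d0 dL] := dual_basis_Lam; pose m := (p * d)%N.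
have m0 : (0 < m)%N by rewrite muln_gt0 p_gt0.
have [rs rsP] := residue_map m0.
pose z mu (i : 'I_r) := toint (p%:R * (ev mu (ld_basis L)`_i - ev mu0 (ld_basis L)`_i)).
pose lam mu := \sum_i (d%:R *: dual_basis i) *~ z mu i.
have Llam mu : Lam L (lam mu) by apply: Lam_sum => i; exact: LamMz.
have lamE mu a : realized mu -> ev (flat (lam mu)) a = m%:R * (ev mu a - ev mu0 a).
  move=> rm; have E nu : ev nu a = \sum_i form (dual_basis i) (lproj L 0 a) * ev nu (ld_basis L)`_i.
    by rewrite -ev_lproj0 -{1}(dual_basisE (lproj L 0 a)) ev_sum.
  rewrite ev_flat !E /lam -sumrB form_sumr mulr_sumr; apply: eq_bigr => i _.
  rewrite -scaler_int scalerA bformZr bformC tointK; last exact: weight_int_basis.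
  by rewrite /m natrM; ring.
exists _, (fun mu => rs (lam mu)) => mu mu' rm rm' e.
have [c Lc cE] := rsP _ _ (Llam mu) (Llam mu') e.
have mR : (m%:R : R[i]) != 0 by rewrite pnatr_eq0 -lt0n.
exists c => //; apply: ev_inj => a; rewrite ev_add; apply: (mulfI mR).
have : ev (flat (lam mu - lam mu')) a = m%:R * ev (flat c) a.
  rewrite cE; elim: (m) => [|k IH]; first by rewrite mul0r flat_eq0 ?linear0 // /ev zero_lfunE.
  by rewrite mulrS flatD ev_add IH -natr1; ring.
rewrite flatD flatN ev_add; have -> : ev (- flat (lam mu')) a = - ev (flat (lam mu')) a.
  by rewrite /ev opp_lfunE.
by rewrite !lamE // => H; rewrite mulrDr -H; ring.
Qed.

Lemma O_finite : exists (N : nat) (S : 'I_N -> gen_module A),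
  (forall i, in_O tilde sigmahat (S i) /\ irreducible_module (S i)) /\
  (forall V : gen_module A, in_O tilde sigmahat V -> irreducible_module V ->
     exists i, module_iso V (S i)).
Proof.
have [K [cl clP]] := weight_classes; have /choice[code codeP] := weight_codes.
have /choice[wt wtP] : forall k, exists mu,
    (exists2 mu', realized mu' & cl mu' = k) -> realized mu /\ cl mu = k.
  move=> k; case: (pselect (exists2 mu', realized mu' & cl mu' = k)) => [[mu rm e]|no].
    by exists mu.
  by exists 0.
(* A label is a class of weights with a code. An operator U_c carries a vacuum vector to the chosen
   weight of its class, so that all codes of one class refer to the same mu. *)
pose has (V : gen_module A) (q : K * codes) :=
  exists v : V, [/\ Om V (wt q.1) v, v <> 0 & code (wt q.1) V v q.2].
pose good (V : gen_module A) := in_O tilde sigmahat V /\ irreducible_module V.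
have has_ex V : good V -> exists q, has V q.
  move=> [VO Virr]; have [Vsub Vnz _] := Virr; have Vt : twisted sigmahat V by case: VO.
  have [mu [x [xO x0 _]]] := O_lowest VO Vsub Vnz.
  have rmu : realized mu by exists V; split=> //; exists x.
  have [rw ew] : realized (wt (cl mu)) /\ cl (wt (cl mu)) = cl mu by apply: wtP; exists mu.
  have [c Lc wE] := clP _ _ rw rmu ew.
  have [ex _ _] := codeP (wt (cl mu)).
  have [|||v [j [vO v0 vj]]] := ex V Vt [set 0] (Uop mu c x).
  - by split=> // a u v -> ->; rewrite scaler0 addr0.
  - by rewrite wE; exact: Uop_Om.
  - by move/(Uop_inj Vt Lc xO).
  by exists (cl mu, j), v.
have has_iso V V' q : good V -> good V' -> has V q -> has V' q -> module_iso V V'.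
  move=> [VO Vi] [V'O V'i] [v [vO v0 vj]] [v' [v'O v'0 v'j]].
  have [_ irr cp] := codeP (wt q.1).
  have vvO : Om (prodm V V') (wt q.1) (v, v') by apply/Om_prodm.
  have Pirr := irr _ (in_O_prodm VO V'O) _ _ vvO (fun e => v0 (congr1 fst e)) (cp _ _ _ _ _ vj v'j).
  by apply: (prodm_iso Vi V'i Pirr _ v0 v'0); exact: gen_sub_self.
(* Only labels that occur are kept, since each must be represented by an irreducible module. *)
pose E := [set q | `[< exists V, good V /\ has V q >]]%SET.
have /choice[S SP] : forall i : 'I_#|E|, exists V, good V /\ has V (enum_val i).
  by move=> i; have := enum_valP i; rewrite inE => /asboolP.
exists #|E|, S; split=> [i|V VO Vi]; first by case: (SP i).
have [q Vq] := has_ex V (conj VO Vi).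
have qE : q \in E by rewrite inE; apply/asboolP; exists V.
exists (enum_rank_in qE q); have [Sg Sq] := SP (enum_rank_in qE q).
by apply: (has_iso _ _ q) => //; move: Sq; rewrite enum_rankK_in.
Qed.

End LatticeAlgebra.

Theorem theorem5 (R : realType) (L : lattice_data R)
  (A : vertex_superalgebra R) (tilde X : ld_h L -> A) (sigmahat : A -> A)
  (L_ok : lattice_ok L)
  (A_lattice : is_lattice_vsa tilde X)
  (sigma_Lam : [set sigma L a | a in Lam L] = Lam L)
  (sigmahat_aut : vs_automorphism sigmahat)
  (sigmahat_ext : forall a, sigmahat (tilde a) = tilde (sigma L a)) :
  (forall V : gen_module A, in_O tilde sigmahat V ->
     exists (I : choiceType) (W : I -> set V),
       (forall i, irreducible_submodule (W i)) /\ direct_sum [set: I] W) /\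
  (exists (N : nat) (S : 'I_N -> gen_module A),
     (forall i, in_O tilde sigmahat (S i) /\ irreducible_module (S i)) /\
     (forall V : gen_module A, in_O tilde sigmahat V -> irreducible_module V ->
        exists i, module_iso V (S i))).
Proof.
split=> [V|]; first exact: (O_semisimple L_ok A_lattice sigma_Lam sigmahat_aut sigmahat_ext).
exact: (O_finite L_ok A_lattice sigma_Lam sigmahat_aut sigmahat_ext).
Qed.
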